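(* Any regular exponential family of order 1 with constant Hessian sectional curvature is equivalent (as an exponential family) to one of the following families, where in (1), (3)–(6) the indicated parameter is fixed. Below, $X$ is the sample space, the density is with respect to Lebesgue measure if $X=\mathbb{R}$ or $\mathbb{R}_{>0}$ and to counting measure if $X$ is discrete, $\theta$ is the natural parameter, $\varphi(\theta)$ the log normalizer, $\eta=\varphi'(\theta)$ the mean, $V(\eta)=\varphi''(\theta)$ the variance function, and HSC the Hessian sectional curvature. (1) Normal ($\sigma^2\in\mathbb{R}_{>0}$ fixed): $X=\mathbb{R}$; density $\frac{1}{\sqrt{2\pi\sigma^2}}e^{-(x-m)^2/2\sigma^2}$ ($m\in\mathbb{R}$); $\theta=\frac{m}{\sigma^2}$; $\varphi(\theta)=\frac{m^2}{2\sigma^2}=\frac{\sigma^2\theta^2}{2}$; $\eta=\sigma^2\theta$; $V(\eta)=\sigma^2$; HSC $=0$. (2) Poisson: $X=\mathbb{Z}_{\ge0}$; density $\frac{\lambda^xe^{-\lambda}}{x!}$ ($\lambda\in\mathbb{R}_{>0}$); $\theta=\log\lambda$; $\varphi(\theta)=\lambda=e^\theta$; $\eta=\lambda$; $V(\eta)=\eta$; HSC $=0$. (3) Gamma ($a\in\mathbb{R}_{>0}$ fixed): $X=\mathbb{R}_{>0}$; density $\frac{(bx)^a}{\Gamma(a)}\frac{e^{-bx}}{x}$ ($b\in\mathbb{R}_{>0}$); $\theta=-b$; $\varphi(\theta)=-a\log b$; $\eta=\frac{a}{b}=-\frac{a}{\theta}$; $V(\eta)=\frac{a}{\theta^2}=\frac1a\eta^2$;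 HSC $=\frac1a$. (4) Binomial ($n\in\mathbb{Z}_{>0}$ fixed): $X=\{0,\dots,n\}$; density $\binom{n}{x}p^x(1-p)^{n-x}$ ($0<p<1$); $\theta=\log\frac{p}{1-p}$; $\varphi(\theta)=-n\log(1-p)=n\log(1+e^\theta)$; $\eta=\frac{n}{1+e^{-\theta}}$; $V(\eta)=\frac{ne^\theta}{(1+e^\theta)^2}=-\frac1n\eta^2+\eta$; HSC $=-\frac1n$. (5) Negative binomial ($r\in\mathbb{R}_{>0}$ fixed): $X=\mathbb{Z}_{\ge0}$; density $\frac{\Gamma(x+r)}{\Gamma(r)x!}p^x(1-p)^r$ ($0<p<1$); $\theta=\log p$; $\varphi(\theta)=-r\log(1-p)=-r\log(1-e^\theta)$; $\eta=\frac{r}{e^{-\theta}-1}$; $V(\eta)=\frac{re^{-\theta}}{(e^{-\theta}-1)^2}=\frac1r\eta^2+\eta$; HSC $=\frac1r$. (6) NEF-GHS ($r\in\mathbb{R}_{>0}$ fixed): $X=\mathbb{R}$; density $(2\cos\theta)^re^{\theta x}\frac{b_r(x)}{4\pi}$ with $\theta\in(-\frac\pi2,\frac\pi2)$, where $b_r(x)=\frac{\Gamma(\frac{r+ix}{2})\Gamma(\frac{r-ix}{2})}{\Gamma(r)}=\frac{|\Gamma(\frac{r+ix}{2})|^2}{\Gamma(r)}$; $\varphi(\theta)=-r\log\cos\theta$; $\eta=r\tan\theta$; $V(\eta)=r(1+\tan^2\theta)=r+\frac{\eta^2}{r}$; HSC $=\frac1r$. Furthermore, the normal families (1) for different values of $\sigma$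 are equivalent to each other, whereas within each of the series (3), (4), (5), (6), families with different values of the fixed parameter are not equivalent as exponential families.
   Context: Exponential families. In the continuous category, $X$ is a locally compact Hausdorff space and $\mathcal{P}$ is a non-empty set of Radon probability measures on $X$. $\mathcal{P}$ is an exponential family on $X$ if there is a triple $(E,T,\mu)$ (a realization) with $E$ a finite dimensional real vector space, $T\colon X\to E$ continuous, $\mu$ a Radon measure on $X$, such that every $\nu\in\mathcal{P}$ has the form $d\nu(x)=\exp(\langle\theta,T(x)\rangle-\varphi(\theta))\,d\mu(x)$ for some $\theta\in E^\vee$, where $\varphi(\theta)=\log\int_X\exp(\langle\theta,T(x)\rangle)\,d\mu(x)$ is the log normalizer. In the measurable category, $X$ is a measurable space, $\mathcal{P}$ a non-empty set of probability measures on $X$, $T$ is measurable and $\mu$ is $\sigma$-finite. A realization is minimal if $\dim E$ is minimal among all realizations; this dimension is the order of $\mathcal{P}$. For a minimal realization, $\theta$ is uniquely determined by $\nu$, giving the injective parameter map $a\colon\mathcal{P}\to E^\vee$. $\mathcal{P}$ is regular if $a(\mathcal{P})=\{\theta\in E^\vee\mid\int_X\exp(\langle\theta,T(x)\rangle)\,d\mu(x)<\infty\}$ and $a(\mathcal{P})$ is open in $E^\vee$ (independent of the choice of minimal realization). Equivalence. $\mathcal{P}_1$ (on $X_1$) and $\mathcal{P}_2$ (on $X_2$) are equivalent if there exist minimal realizations $(E,T_1,\mu_1)$ of $\mathcal{P}_1$ and $(E,T_2,\mu_2)$ of $\mathcal{P}_2$ with $T_{1*}\mathcal{P}_1=T_{2*}\mathcal{P}_2$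 as sets of probability measures on $E$, where $T_{i*}\mathcal{P}_i=\{T_{i*}\nu\mid\nu\in\mathcal{P}_i\}$. Hessian sectional curvature. For a regular exponential family of order 1 with a minimal realization, $\Theta=a(\mathcal{P})$ is an open subset of the line $E^\vee\cong\mathbb{R}$; with the standard flat connection and the Fisher metric $g\,d\theta^2$, $g=\varphi''$, it is a one-dimensional Hessian manifold, and $\mathcal{P}$ is identified with it (the structure is independent of the minimal realization). Its Hessian sectional curvature is the function $S=\frac{1}{2g}\frac{d^2}{d\theta^2}\log g$, where $\theta$ is an affine coordinate. For the six families the sample space is a subset of $\mathbb{R}$ and the data refer to the realization with $E=\mathbb{R}$, $T$ the inclusion $X\hookrightarrow\mathbb{R}$. *)

(* Defs.v *)
From HB Require Import structures.
From mathcomp Require Import all_boot all_order all_algebra.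
From mathcomp Require Import all_classical all_reals all_analysis.
From mathcomp Require Import measurable_realfun.
From mathcomp.real_closed Require Import complex.

Set Implicit Arguments.
Unset Strict Implicit.
Unset Printing Implicit Defensive.

Import Order.TTheory GRing.Theory Num.Theory.
Import numFieldNormedType.Exports.

Local Open Scope classical_set_scope.
Local Open Scope ring_scope.

Definition borel (X : ptopologicalType) := g_sigma_algebraType (@open X).

(* Conventions for Radon measures differ (regularity of open or of all Borel
   sets), but agree on sigma-finite measures. The base measure of a realization
   of a non-empty family is sigma-finite, as a positive continuous multiple of it
   is a probability measure. *)
Definition radon (R : realType) (X : ptopologicalType)
    (mu : {measure set (borel X) -> \bar R}) : Prop :=
  (forall K : set X, compact K -> (mu K < +oo)%E) /\
  (forall A : set (borel X), measurable A ->
     mu A = ereal_sup [set mu K | K in [set K : set X | compact K /\ K `<=` A]]).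

(* The two categories differ only in which measures and which statistics are
   allowed on the underlying measurable space. *)
Record sampleSpace (R : realType) := SampleSpace {
  disp : measure_display;
  points :> measurableType disp;
  ok_measure : {measure set points -> \bar R} -> Prop;
  ok_stat : forall n, (points -> 'rV[R]_n) -> Prop
}.
Arguments ok_measure {R} s _.
Arguments ok_stat {R} s {n} _.

Variant category := Continuous | Measurable.

Definition contSpace (R : realType) (X : ptopologicalType) : sampleSpace R :=
  @SampleSpace R _ (borel X) (@radon R X)
    (fun n T => continuous (T : X -> 'rV[R]_n)).

Definition measSpace (R : realType) d (X : measurableType d) : sampleSpace R :=
  @SampleSpace R d X (fun mu => sigma_finite setT mu)
    (fun n T => measurable_fun setT (T : X -> borel 'rV[R]_n)).

Variant in_category (R : realType) : category -> sampleSpace R -> Prop :=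
| InContinuous (X : ptopologicalType) of
    hausdorff_space X & locally_compact [set: X] :
    in_category Continuous (contSpace R X)
| InMeasurable d (X : measurableType d) :
    in_category Measurable (measSpace R X).

(* A topological space seen in either category, in the second one through its
   Borel sets. *)
Definition borelSpace (R : realType) (c : category) (X : ptopologicalType) :
    sampleSpace R :=
  @SampleSpace R _ (borel X)
    (match c with
     | Continuous => ok_measure (contSpace R X)
     | Measurable => ok_measure (measSpace R (borel X))
     end)
    (match c with
     | Continuous => @ok_stat R (contSpace R X)
     | Measurable => @ok_stat R (measSpace R (borel X))
     end).

Section exponential_families.
Variables (R : realType) (X : sampleSpace R).
Implicit Types (P : set (probability X R)) (nu : probability X R).
Implicit Types mu : {measure set X -> \bar R}.

Section statistic.
Variables (n : nat) (T : X -> 'rV[R]_n).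

(* E is 'rV[R]_n and its dual is 'cV[R]_n, a column acting on rows. *)
Definition pairing (theta : 'cV[R]_n) (t : 'rV[R]_n) : R := (t *m theta) 0 0.

Definition partition_function mu (theta : 'cV[R]_n) : \bar R :=
  (\int[mu]_x (expR (pairing theta (T x)))%:E)%E.

Definition log_normalizer mu (theta : 'cV[R]_n) : R :=
  ln (fine (partition_function mu theta)).

Definition natural_domain mu : set 'cV[R]_n :=
  [set theta | (partition_function mu theta < +oo)%E].

Definition exp_form mu (theta : 'cV[R]_n) nu : Prop :=
  natural_domain mu theta /\
  forall A, measurable A ->
    nu A = (\int[mu]_(x in A)
      (expR (pairing theta (T x) - log_normalizer mu theta))%:E)%E.

Definition realization P mu : Prop :=
  [/\ ok_stat X T, ok_measure X mu &
      forall nu, P nu -> exists theta, exp_form mu theta nu].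

(* a(P), for a minimal realization *)
Definition parameter_set P mu : set 'cV[R]_n :=
  [set theta | exists2 nu, P nu & exp_form mu theta nu].

End statistic.

Definition exponential_family P : Prop :=
  [/\ P !=set0, forall nu, P nu -> ok_measure X nu &
      exists n (T : X -> 'rV[R]_n) mu, realization T P mu].

Definition minimal_realization P n (T : X -> 'rV[R]_n) mu : Prop :=
  realization T P mu /\
  forall n' (T' : X -> 'rV[R]_n') mu', realization T' P mu' -> (n <= n')%N.

Definition has_order P (n : nat) : Prop :=
  exists (T : X -> 'rV[R]_n) mu, minimal_realization P T mu.

Definition regular_via P n (T : X -> 'rV[R]_n) mu : Prop :=
  [/\ minimal_realization P T mu,
      parameter_set T P mu = natural_domain T mu &
      open (parameter_set T P mu)].

Definition regular P : Prop :=
  exponential_family P /\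
  exists n (T : X -> 'rV[R]_n) mu, regular_via P T mu.

(* For n = 1, the log normalizer in the affine coordinate of the dual line. *)
Definition log_normalizer1 (T : X -> 'rV[R]_1) mu (t : R) : R :=
  log_normalizer T mu (t%:M).

Definition fisher_metric (T : X -> 'rV[R]_1) mu : R -> R :=
  ((log_normalizer1 T mu)^`(2))%classic.

Definition hsc (T : X -> 'rV[R]_1) mu (t : R) : R :=
  ((fun s => ln (fisher_metric T mu s))^`(2))%classic t / (2 * fisher_metric T mu t).

Definition constant_hsc P : Prop :=
  exists (T : X -> 'rV[R]_1) mu, minimal_realization P T mu /\
  exists c, forall t : R, parameter_set T P mu t%:M -> hsc T mu t = c.

(* T_* P. Measures on E are functions on the type of Borel sets of E, so that
   their equality is equality on Borel sets. *)
Definition pushforward_laws n (T : X -> 'rV[R]_n) P :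
    set (set_type [set B : set (borel 'rV[R]_n) | measurable B] -> \bar R) :=
  [set (fun B => pushforward nu (T : X -> borel 'rV[R]_n) (set_val B))
     | nu in P].

End exponential_families.

Definition equivalent (R : realType) (X1 X2 : sampleSpace R)
    (P1 : set (probability X1 R)) (P2 : set (probability X2 R)) : Prop :=
  exists n (T1 : X1 -> 'rV[R]_n) mu1 (T2 : X2 -> 'rV[R]_n) mu2,
    [/\ minimal_realization P1 T1 mu1, minimal_realization P2 T2 mu2 &
        pushforward_laws T1 P1 = pushforward_laws T2 P2].

Section reference_measures.
Variable R : realType.

Lemma borel_line_measurable (A : set (borel R)) :
  measurable A -> measurable (A : set (measurableTypeR R)).
Proof.
apply: smallest_sub; first exact: sigma_algebra_measurable.
by move=> U; exact: open_measurable.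
Qed.

Definition lebesgue_line (A : set (borel R)) : \bar R :=
  lebesgue_measure (A : set (measurableTypeR R)).

Let lebesgue_line0 : lebesgue_line set0 = 0%E.
Proof. exact: measure0. Qed.

Let lebesgue_line_ge0 A : (0 <= lebesgue_line A)%E.
Proof. exact: measure_ge0. Qed.

Let lebesgue_line_sigma_additive : semi_sigma_additive lebesgue_line.
Proof.
move=> F mF tF mUF; apply: measure_semi_sigma_additive => //.
- by move=> i; exact: borel_line_measurable.
- exact: borel_line_measurable.
Qed.

HB.instance Definition _ := isMeasure.Build _ _ _ lebesgue_line
  lebesgue_line0 lebesgue_line_ge0 lebesgue_line_sigma_additive.

Definition posReal : Type := set_type [set x : R | 0 < x].

HB.instance Definition _ :=
  Topological.copy posReal (set_type [set x : R | 0 < x]).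

Lemma one_posReal : (1 : R) \in [set x : R | 0 < x].
Proof. by rewrite inE /=. Qed.

HB.instance Definition _ := isPointed.Build posReal (SigSub one_posReal).

Definition posReal_val (x : posReal) : R := set_val x.

Lemma posReal_val_inj : injective posReal_val.
Proof. exact: val_inj. Qed.

Lemma image_posReal_measurable (A : set (borel posReal)) :
  measurable A -> measurable (posReal_val @` A : set (measurableTypeR R)).
Proof.
have mpos : measurable ([set x : R | 0 < x] : set (measurableTypeR R)).
  rewrite (_ : [set x : R | 0 < x] = `]0, +oo[%classic); first exact: measurable_itv.
  by apply/seteqP; split=> x /=; rewrite in_itv /= andbT.
have rangeE : range posReal_val = [set x : R | 0 < x].
  apply/seteqP; split=> [_ [x _ <-]|x x0]; first exact: (set_valP x).
  by exists (SigSub (mem_set x0 : x \in [set x : R | 0 < x])).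
have := smallest_sub (G := open)
  (X := [set A | measurable (posReal_val @` A : set (measurableTypeR R))]).
apply; first split=> /=.
- by rewrite image_set0.
- move=> B mB; rewrite (_ : posReal_val @` (setT `\` B) =
      range posReal_val `\` (posReal_val @` B)).
    by apply: measurableD => //; rewrite rangeE.
  apply/seteqP; split=> [_ [x [_ Bx] <-]|_ [[x _ <-] nB]].
    by split; [exists x|case=> y By /posReal_val_inj xy; apply: Bx; rewrite -xy].
  by exists x => //; split=> // Bx; apply: nB; exists x.
- by move=> F mF; rewrite image_bigcup; apply: bigcupT_measurable.
- move=> B [U oU UB] /=.
  have -> : posReal_val @` B = U `&` range posReal_val.
    have memB x : B x = U (posReal_val x) by rewrite -UB.
    apply/seteqP; split=> [y [x Bx xy]|y [Uy [x _ xy]]].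
      by split; [rewrite -xy -memB|exists x].
    by exists x => //; rewrite memB xy.
  by apply: measurableI; [exact: open_measurable|rewrite rangeE].
Qed.

Definition lebesgue_posReal (A : set (borel posReal)) : \bar R :=
  lebesgue_measure (posReal_val @` A : set (measurableTypeR R)).

Let lebesgue_posReal0 : lebesgue_posReal set0 = 0%E.
Proof. by rewrite /lebesgue_posReal image_set0 measure0. Qed.

Let lebesgue_posReal_ge0 A : (0 <= lebesgue_posReal A)%E.
Proof. exact: measure_ge0. Qed.

Let lebesgue_posReal_sigma_additive : semi_sigma_additive lebesgue_posReal.
Proof.
move=> F mF tF mUF; rewrite /lebesgue_posReal image_bigcup.
apply: measure_semi_sigma_additive.
- by move=> i; exact: image_posReal_measurable.
- apply/trivIsetP => i j _ _ ij.
  move/trivIsetP : tF => /(_ _ _ I I ij) Fij.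
  apply/seteqP; split=> // _ [[x Fx <-] [y Fy /posReal_val_inj yx]].
  suff: (F i `&` F j) x by rewrite Fij.
  by split; [exact: Fx|rewrite -yx].
- by rewrite -image_bigcup; exact: image_posReal_measurable.
Qed.

HB.instance Definition _ := isMeasure.Build _ _ _ lebesgue_posReal
  lebesgue_posReal0 lebesgue_posReal_ge0 lebesgue_posReal_sigma_additive.

End reference_measures.

Definition upto (n : nat) : Type := 'I_n.+1.
HB.instance Definition _ (n : nat) := Choice.copy (upto n) 'I_n.+1.
HB.instance Definition _ (n : nat) := isPointed.Build (upto n) (ord0 : 'I_n.+1).
HB.instance Definition _ (n : nat) := hasNbhs.Build (upto n) principal_filter.
HB.instance Definition _ (n : nat) := Discrete_ofNbhs.Build (upto n) erefl.

Definition upto_val (n : nat) (x : upto n) : nat := (x : 'I_n.+1).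

(* A parametrized family of densities on a space included in the real line. *)
Record densityFamily (R : realType) := DensityFamily {
  fspace : ptopologicalType;
  incl : fspace -> R;
  ref_measure : {measure set (borel fspace) -> \bar R};
  par : set R;
  dens : R -> fspace -> R
}.

Section density_families.
Variables (R : realType) (F : densityFamily R).

Definition has_density (p : R) (nu : probability (borel (fspace F)) R) : Prop :=
  forall A, measurable A ->
    nu A = (\int[ref_measure F]_(x in A) (dens p x)%:E)%E.

Definition members : set (probability (borel (fspace F)) R) :=
  [set nu | exists2 p, par F p & has_density p nu].

Definition inclusion (x : borel (fspace F)) : 'rV[R]_1 := (incl x)%:M.

End density_families.

Arguments has_density {R} F p nu.
Arguments members {R} F _.
Arguments inclusion {R} F x.

Section inclusion_realizations.
Variables (R : realType) (c : category) (F : densityFamily R).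
Variable mu : {measure set (borel (fspace F)) -> \bar R}.

Definition phi : R -> R :=
  log_normalizer1 (X := borelSpace R c (fspace F)) (inclusion F) mu.

Definition HSC : R -> R :=
  hsc (X := borelSpace R c (fspace F)) (inclusion F) mu.

(* The family F is a regular exponential family of order 1, realized by the
   inclusion and the measure mu, and the law of parameter p has natural
   parameter nat_par p, mean phi' and variance phi'' there. *)
Definition inclusion_realization (nat_par : R -> R) : Prop :=
  let X := borelSpace R c (fspace F) in
  [/\ in_category c X,
      exponential_family (X := X) (members F),
      regular_via (X := X) (members F) (inclusion F) mu,
      forall p x, par F p -> 0 <= dens (d := F) p x &
      forall p, par F p ->
        (exists nu, has_density F p nu) /\
        forall nu, has_density F p nu ->
          [/\ exp_form (X := X) (inclusion F) mu (nat_par p)%:M nu,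
              expectation nu (@incl R F) = (derive1 phi (nat_par p))%:E &
              variance nu (@incl R F) = (derive1n 2 phi (nat_par p))%:E]].

End inclusion_realizations.

Arguments phi {R} c F mu _.
Arguments HSC {R} c F mu _.
Arguments inclusion_realization {R} c F mu nat_par.

Section gamma_functions.
Variable R : realType.
Implicit Types (s t : R) (z : R[i]).

Definition Gamma s : R :=
  \int[@lebesgue_measure R]_(t in `]0, +oo[) (t `^ (s - 1) * expR (- t)).

(* For t > 0, t `^ (z - 1) has modulus t `^ (Re z - 1) and argument Im z * ln t. *)
Definition cGamma z : R[i] :=
  Complex
    (\int[@lebesgue_measure R]_(t in `]0, +oo[)
       (t `^ (complex.Re z - 1) * expR (- t) * cos (complex.Im z * ln t)))
    (\int[@lebesgue_measure R]_(t in `]0, +oo[)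
       (t `^ (complex.Re z - 1) * expR (- t) * sin (complex.Im z * ln t))).

Definition ghs_complex_weight (r x : R) : R[i] :=
  cGamma ((r +i* x)%C / 2) * cGamma ((r -i* x)%C / 2) / (Gamma r)%:C%C.

Definition ghs_weight (r x : R) : R := complex.Re (ghs_complex_weight r x).

End gamma_functions.

Section six_families.
Variable R : realType.

Definition normal_family (sigma : R) : densityFamily R :=
  @DensityFamily R R id (@lebesgue_line R) setT
    (fun m x => (Num.sqrt (2 * pi * sigma ^+ 2))^-1
                * expR (- (x - m) ^+ 2 / (2 * sigma ^+ 2))).

Definition poisson_family : densityFamily R :=
  @DensityFamily R nat (fun x => x%:R) (@counting (borel nat) R)
    [set lambda | 0 < lambda]
    (fun lambda x => lambda ^+ x * expR (- lambda) / x`!%:R).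

Definition gamma_family (a : R) : densityFamily R :=
  @DensityFamily R (posReal R) (@posReal_val R) (@lebesgue_posReal R)
    [set b | 0 < b]
    (fun b x => (b * posReal_val x) `^ a / Gamma a
                * (expR (- b * posReal_val x) / posReal_val x)).

Definition binomial_family (n : nat) : densityFamily R :=
  @DensityFamily R (upto n) (fun x => (upto_val x)%:R)
    (@counting (borel (upto n)) R)
    [set p | 0 < p < 1]
    (fun p x => 'C(n, upto_val x)%:R
                * p ^+ upto_val x * (1 - p) ^+ (n - upto_val x)).

Definition negative_binomial_family (r : R) : densityFamily R :=
  @DensityFamily R nat (fun x => x%:R) (@counting (borel nat) R)
    [set p | 0 < p < 1]
    (fun p x => Gamma (x%:R + r) / (Gamma r * x`!%:R) * p ^+ x * (1 - p) `^ r).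

Definition ghs_family (r : R) : densityFamily R :=
  @DensityFamily R R id (@lebesgue_line R)
    [set theta | - (pi / 2) < theta < pi / 2]
    (fun theta x => (2 * cos theta) `^ r * expR (theta * x)
                    * (ghs_weight r x / (4 * pi))).

End six_families.

(* Main.v *)
Require Import Defs.
From HB Require Import structures.
From mathcomp Require Import all_boot all_order all_algebra.
From mathcomp Require Import all_classical all_reals all_analysis.
From mathcomp Require Import measurable_realfun.
From mathcomp Require Import ring lra.
From mathcomp.real_closed Require Import complex.

Set Implicit Arguments.
Unset Strict Implicit.
Unset Printing Implicit Defensive.

Import Order.TTheory GRing.Theory Num.Theory.
Import numFieldNormedType.Exports.

Local Open Scope classical_set_scope.
Local Open Scope ring_scope.

(* Relative to one of its members, an exponential family of order 1 consists of
   exponential tilts of the law of a real statistic t, and two minimal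
   realizations differ by an affine change of t. With V the variance as a function
   of the mean, S is V'' / 2, so a constant curvature c says that V(y) = c y^2 +
   p y + q. The equation phi'' = V(phi') and the mean at one point determine phi,
   hence the Laplace transform near 0, hence the law of t. So the family is known
   up to equivalence once an affine change of t has normalized (p, q) to the values
   of one of the six families; the sign of p^2 - 4 c q selects among them.
   When c < 0 the law of t has moment generating function (1 - w + w e^h)^s with
   s = -1/c; its binomial series would have negative coefficients unless s is an
   integer. Conversely c is invariant under affine changes of t, which separates the
   families of each series.

   The Laplace transform of |Gamma((r + ix)/2)|^2 is obtained without Fourier
   inversion: the recurrence from r to r + 2 turns even moments into derivatives of
   (cos th)^(-r), whose Taylor coefficients are nonnegative polynomials in tan th. *)

(** * Taylor expansions with nonnegative or bounded derivatives *)

Section taylor.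
Context {R : realType}.
Implicit Types (f g : R -> R) (x B : R).

(** It suffices to match one member of each family: the other members are tilts, and regularity says
    that every tilt with finite normalizer occurs on both sides.

    That a law is determined by its Laplace transform near 0 is itself proved, by enlarging the
    class of bounded functions that can be integrated equally against both laws, from sines and
    cosines of small frequency to indicators of half-lines.

    For c < 0 the sign of the affine change is free (counting successes or failures). It is chosen
    so that the success probability w is below 1/2, where the series in e^h converges near h = 0.
    This requires a member whose mean is not the symmetry point -p/(2c) of V; as the mean is
    strictly increasing in the parameter, there is one.

    The recurrence for |Gamma((r + ix)/2)|^2 starts from its total mass. That mass comes from
    Euler's Beta integral and a Poisson kernel concentrating at t = 1, the origin of the factor
    2^(-r).

    In the continuous category all measures must be Radon. Inner approximation by compact sets is
    therefore formulated up to null sets, which passes to densities. *)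

Lemma derive_ge0_ge0 f f' B : (forall x, 0 <= x < B -> is_derive x 1 f (f' x)) ->
  (forall x, 0 <= x < B -> 0 <= f' x) -> 0 <= f 0 ->
  forall x, 0 <= x < B -> 0 <= f x.
Proof.
move=> df f'0 f0 x /andP[]; rewrite le_eqVlt => /predU1P[<- //|x0 xB].
have sub y : y \in `[0, x] -> 0 <= y < B.
  by rewrite in_itv/= => /andP[-> /le_lt_trans ->].
have [|//|c c0x] := @MVT _ f f' 0 x x0.
- by move=> y /subset_itv_oo_cc/sub; exact: df.
- by apply: derivable_within_continuous => y /sub/df[].
rewrite subr0 => fx; rewrite -[f x](subrK (f 0)) fx addr_ge0// mulr_ge0//.
  by apply/f'0/sub/subset_itv_oo_cc.
exact: ltW.
Qed.

Lemma is_derive_monomial (a : R) n x :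
  is_derive x 1 (fun y : R => a * y ^+ n) (a * (n%:R * x ^+ n.-1)).
Proof.
have h : is_derive x 1 (fun y : R => y ^+ n : R) (n%:R * x ^+ n.-1).
  apply: DeriveDef; first exact: exprn_derivable.
  by have := @exp_derive R n x 1; rewrite /GRing.scale/= mulr1 mulr_natl.
exact: is_deriveZ.
Qed.

Definition taylor_poly (c : nat -> R) (n : nat) x : R :=
  \sum_(k < n) c k * x ^+ k / k`!%:R.

Lemma is_derive_taylor_poly c n x :
  is_derive x 1 (taylor_poly c n) (taylor_poly (fun k => c k.+1) n.-1 x).
Proof.
elim: n => [|n IH].
  rewrite /taylor_poly big_ord0.
  have -> : (fun x : R => \sum_(k < 0) c k * x ^+ k / k`!%:R) = cst 0.
    by apply/funext => y; rewrite big_ord0.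
  exact: is_derive_cst.
have -> : taylor_poly c n.+1 = taylor_poly c n \+ (fun x => (c n / n`!%:R) * x ^+ n).
  by apply/funext => y; rewrite /taylor_poly/= big_ord_recr/= mulrAC.
have dn := is_derive_monomial (c n / n`!%:R) n x.
apply: (is_derive_eq (is_deriveD IH dn)).
case: n {IH dn} => [|n]; first by rewrite mul0r mulr0 addr0.
rewrite {2}/taylor_poly/= big_ord_recr/= factS natrM; congr +%R.
have : (n`!%:R : R) != 0 by rewrite pnatr_eq0 -lt0n fact_gt0.
have : (n.+1%:R : R) != 0 by [].
by move=> ? ?; field; exact/andP.
Qed.

Lemma taylor_poly0 c n : taylor_poly c n.+1 0 = c 0%N.
Proof.
rewrite /taylor_poly big_ord_recl/= expr0 mulr1 divr1 big1 ?addr0// => i _.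
by rewrite expr0n/= mulr0 mul0r.
Qed.

Section derivative_sequence.
Variables (f : nat -> R -> R) (B : R).
Hypothesis df : forall k x, 0 <= x < B -> is_derive x 1 (f k) (f k.+1 x).

(** Remainders of all derivatives are treated together: the family is closed under differentiation,
    which lowers the order, and positive orders vanish at 0. So bounds propagate by induction on
    n. *)
Let rest k n x := f k x - taylor_poly (fun j => f (k + j) 0) n x.

Let is_derive_rest k n x : 0 <= x < B -> is_derive x 1 (rest k n.+1) (rest k.+1 n x).
Proof.
move=> xB; apply: is_deriveB; first exact: df.
have -> : (fun j => f (k.+1 + j) 0) = (fun j => f (k + j.+1) 0).
  by apply/funext => j; rewrite addSnnS.
exact: is_derive_taylor_poly.
Qed.

Let rest0 k n : rest k n.+1 0 = 0.
Proof. by rewrite /rest taylor_poly0 addn0 subrr. Qed.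

Section absolutely_monotone.
Hypothesis f_ge0 : forall k x, 0 <= x < B -> 0 <= f k x.

Let rest_ge0 n k x : 0 <= x < B -> 0 <= rest k n x.
Proof.
elim: n k x => [|n IH] k x xB; first by rewrite /rest /taylor_poly big_ord0 subr0 f_ge0.
apply: (@derive_ge0_ge0 _ (rest k.+1 n) B) => //.
- by move=> y yB; exact: is_derive_rest.
- by move=> y yB; exact: IH.
- by rewrite rest0.
Qed.

Let rest_le n k x : 0 <= x < B -> n.+1%:R * rest k n.+1 x <= x * rest k.+1 n x.
Proof.
elim: n k x => [|n IH] k x xB.
  rewrite -subr_ge0.
  have ex n1 y : 0 <= y < B -> is_derive y 1 (fun x => x * rest k.+1 0 x - n1 * rest k 1 x)
      (rest k.+1 0 y + y * f k.+2 y - n1 * rest k.+1 0 y).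
    move=> yB; have h1 := is_derive_rest k 0 yB.
    have h2 : is_derive y 1 (rest k.+1 0) (f k.+2 y).
      have -> : rest k.+1 0 = f k.+1.
        by apply/funext => z; rewrite /rest /taylor_poly big_ord0 subr0.
      exact: df.
    apply: is_derive_eq; rewrite /GRing.scale/=.
    by ring.
  apply: (derive_ge0_ge0 (ex 1)) => //.
    move=> y yB; rewrite mul1r addrAC subrr add0r mulr_ge0 ?f_ge0//.
    by case/andP: yB.
  by rewrite mul0r rest0 mulr0 subr0.
rewrite -subr_ge0.
have ex y : 0 <= y < B ->
   is_derive y 1 (fun x => x * rest k.+1 n.+1 x - n.+2%:R * rest k n.+2 x)
      (y * rest k.+2 n y - n.+1%:R * rest k.+1 n.+1 y).
  move=> yB; have h1 := is_derive_rest k n.+1 yB.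
  have h2 := is_derive_rest k.+1 n yB.
  apply: is_derive_eq; rewrite /GRing.scale/= -[in n.+2%:R]natr1.
  by ring.
apply: (derive_ge0_ge0 ex) => //.
  by move=> y yB; rewrite subr_ge0 IH.
by rewrite mul0r rest0 mulr0 subr0.
Qed.

(* If r is the Taylor remainder of order n, then x r' - n r has the same form one
   order lower, so n r <= x r' <= x f'. *)
Lemma cvg_taylor_ge0 x : 0 <= x < B ->
  taylor_poly (fun k => f k 0) n x @[n --> \oo] --> f 0 x.
Proof.
move=> xB; have x0 : 0 <= x by case/andP: xB.
have restle k n : rest k n x <= f k x.
  rewrite lerBlDr lerDl sumr_ge0// => i _.
  rewrite divr_ge0// mulr_ge0 ?exprn_ge0// f_ge0// lexx/=.
  by case/andP: xB => _; exact: le_lt_trans.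
rewrite -cvg_shiftS/=.
apply/subr_cvg0 => /=.
suff : - (taylor_poly (fun k => f k 0) n.+1 x - f 0 x) @[n --> \oo] --> (0 : R).
  by move/cvgN; rewrite oppr0; apply: cvg_trans; apply: near_eq_cvg; near=> n; rewrite opprK.
apply: (@squeeze_cvgr _ _ _ _ (cst 0) (fun n => x * f 1 x * harmonic n)).
- near=> n; rewrite opprB.
  have -> : f 0 x - taylor_poly (fun k => f k 0) n.+1 x = rest 0 n.+1 x by [].
  rewrite rest_ge0//= /harmonic/= ler_pdivlMr// mulrC.
  by apply: (le_trans (rest_le _ _ _)) => //; rewrite ler_wpM2l.
- exact: cvg_cst.
- rewrite -[X in _ --> X](mulr0 (x * f 1 x)); apply: cvgM; first exact: cvg_cst.
  exact: cvg_harmonic.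
Unshelve. all: by end_near. Qed.

End absolutely_monotone.

(** The bound on the n-th derivative is integrated n times from 0, where the remainder and its
    derivatives of order below n vanish. Each integration is a comparison of derivatives, once for
    each sign. *)
Lemma taylor_bound (C : nat -> R) : (forall k x, 0 <= x < B -> `|f k x| <= C k) ->
  forall n x, 0 <= x < B ->
  `|f 0 x - taylor_poly (fun k => f k 0) n x| <= C n * x ^+ n / n`!%:R.
Proof.
move=> fC n x xB; suff H k : `|rest k n x| <= C (k + n)%N * x ^+ n / n`!%:R by exact: (H 0%N).
elim: n k x xB => [|n IH] k x xB.
  by rewrite /rest /taylor_poly big_ord0 subr0 addn0 expr0 mulr1 divr1 fC.
have Cd (y : R) : is_derive y 1 (fun x : R => C (k + n.+1)%N / n.+1`!%:R * x ^+ n.+1)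
    (C (k.+1 + n)%N * y ^+ n / n`!%:R).
  apply: is_derive_eq; first exact: is_derive_monomial.
  rewrite addSnnS factS natrM/=.
  have : (n`!%:R : R) != 0 by rewrite pnatr_eq0 -lt0n fact_gt0.
  have : (n.+1%:R : R) != 0 by [].
  by move=> ? ?; field; exact/andP.
rewrite ler_norml -mulrA [_ ^+ _ / _]mulrC mulrA -(subr_ge0 _ (rest _ _ _)).
rewrite -[X in X && _]subr_ge0 opprK; apply/andP; split.
  have ex y : 0 <= y < B -> is_derive y 1 (rest k n.+1 \+
      (fun x : R => C (k + n.+1)%N / n.+1`!%:R * x ^+ n.+1))%R
      (rest k.+1 n y + C (k.+1 + n)%N * y ^+ n / n`!%:R).
    by move=> yB; have := is_derive_rest k n yB => ?; exact: is_deriveD.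
  rewrite ?subr0; apply: (derive_ge0_ge0 ex) => //= [y yB|].
    by have := IH k.+1 y yB; rewrite ler_norml => /andP[+ _]; rewrite -subr_ge0 opprK.
  by rewrite rest0 expr0n/= mulr0 addr0.
have ex y : 0 <= y < B -> is_derive y 1 (
      (fun x : R => C (k + n.+1)%N / n.+1`!%:R * x ^+ n.+1) \- rest k n.+1)%R
      (C (k.+1 + n)%N * y ^+ n / n`!%:R - rest k.+1 n y).
  by move=> yB; have := is_derive_rest k n yB => ?; exact: is_deriveB.
rewrite -subr_ge0; apply: (derive_ge0_ge0 ex) => //= [y yB|].
  by have := IH k.+1 y yB; rewrite ler_norml => /andP[_]; rewrite -subr_ge0.
by rewrite rest0 expr0n/= mulr0 subr0.
Qed.

End derivative_sequence.
End taylor.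

(** * Rules for derivatives of real functions *)

Lemma is_derive_eq_const {R : realType} (f : R -> R) (a b : R) :
  (forall x, a < x < b -> is_derive x 1 f 0) ->
  forall x y, a < x < b -> a < y < b -> f x = f y.
Proof.
move=> df; have wlg x y : x <= y -> a < x < b -> a < y < b -> f x = f y.
  rewrite le_eqVlt => /predU1P[-> //|xy] /andP[ax xb] /andP[ay yb].
  have sub z : z \in `[x, y] -> a < z < b.
    rewrite in_itv/= => /andP[xz zy].
    by rewrite (lt_le_trans ax xz) (le_lt_trans zy yb).
  have [|//|c cxy] := @MVT _ f (cst 0) x y xy.
  - by move=> z /subset_itv_oo_cc/sub; exact: df.
  - by apply: derivable_within_continuous => z /sub/df[].
  - by rewrite /= mul0r => /eqP; rewrite subr_eq0 => /eqP.
move=> x y xab yab; have [|/ltW] := leP x y; first by move=> /wlg; exact.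
by move=> /wlg ->.
Qed.

Section is_derive_real.
Context {R : realType}.
Implicit Types (f g : R -> R) (x : R).

Lemma is_derive_expR_comp f (d : R) x : is_derive x 1 f d ->
  is_derive x 1 (fun y => expR (f y)) (d * expR (f x)).
Proof.
move=> dfx; have h := is_derive_expR (f x).
by apply: (is_derive_eq (@is_derive1_comp R expR f x _ _ _ _)) => //; rewrite mulrC.
Qed.

Lemma is_derive_ln_comp f (d : R) x : is_derive x 1 f d -> 0 < f x ->
  is_derive x 1 (fun y => ln (f y)) (d / f x).
Proof.
move=> dfx fx0; have h := is_derive1_ln fx0.
by apply: (is_derive_eq (@is_derive1_comp R (@ln R) f x _ _ _ _)) => //; rewrite mulrC.
Qed.

Lemma is_derive_inv_comp f (d : R) x : is_derive x 1 f d -> f x != 0 ->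
  is_derive x 1 (fun y => (f y)^-1) (- d / f x ^+ 2).
Proof.
move=> dfx fx0; have := is_deriveV fx0 dfx => h.
by apply: (is_derive_eq h); rewrite /GRing.scale/= mulNr mulNr mulrC.
Qed.

Lemma near_is_derive_derive1 f f' x : (\forall y \near x, is_derive (y : R) 1 f (f' y)) ->
  \forall y \near x, f^`()%classic y = f' y.
Proof. by apply: filterS => y [_ <-]; rewrite derive1E. Qed.

Lemma is_derive_derive1 f (d : R) x : is_derive x 1 f d -> f^`()%classic x = d.
Proof. by move=> [_ <-]; rewrite derive1E. Qed.

Lemma near_is_derive_derive2 f f' f'' x :
  (\forall y \near x, is_derive (y : R) 1 f (f' y)) ->
  (\forall y \near x, is_derive (y : R) 1 f' (f'' y)) ->
  f^`(2)%classic x = f'' x.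
Proof.
move=> df df'; rewrite /derive1n/=; apply: is_derive_derive1.
apply: (near_eq_is_derive _ (nbhs_singleton df')).
by near=> y; apply/esym; near: y; exact: near_is_derive_derive1.
Unshelve. all: by end_near. Qed.

End is_derive_real.

(** * Measures given by a density *)

Section density.
Context {R : realType} {d} {X : measurableType d}.
Local Open Scope ereal_scope.

(** The absolute value makes this a measure for every measurable [f], so that the measure instance
    can be declared without a sign condition; it disappears again in [exists_density_measure]. *)
Definition density_measure (mu : {measure set X -> \bar R}) (f : X -> R)
  (A : set X) : \bar R := \int[mu]_(x in A) (`|f x|)%:E.

Section density_measure.
Variables (mu : {measure set X -> \bar R}) (f : {mfun X >-> R}).

Let density_measure0 : density_measure mu f set0 = 0.
Proof. by rewrite /density_measure integral_set0. Qed.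

Let density_measure_ge0 A : 0 <= density_measure mu f A.
Proof. by apply: integral_ge0 => x _; rewrite lee_fin. Qed.

Let density_measure_sigma_additive : semi_sigma_additive (density_measure mu f).
Proof.
move=> F mF tF mUF; rewrite /density_measure ge0_integral_bigcup//=.
- apply: is_cvg_nneseries => n _ _; apply: integral_ge0 => x _.
  by rewrite lee_fin.
- apply/measurable_EFinP/measurableT_comp => //.
  exact/measurable_funTS.
Qed.

HB.instance Definition _ := isMeasure.Build _ _ _ (density_measure mu f)
  density_measure0 density_measure_ge0 density_measure_sigma_additive.

End density_measure.

Lemma exists_density_measure (mu : {measure set X -> \bar R}) (f : X -> R) :
  measurable_fun setT f -> (forall x, (0 <= f x)%R) ->
  exists nu : {measure set X -> \bar R},
    forall A, nu A = \int[mu]_(x in A) (f x)%:E.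
Proof.
move=> mf f0; pose g : {mfun X >-> R} := mfun_Sub (mem_set mf).
exists (density_measure mu g) => A.
by apply: eq_integral => x _ /=; rewrite ger0_norm// f0.
Qed.

Section integral_density.
Variables (mu nu : {measure set X -> \bar R}) (f : X -> R).
Hypotheses (mf : measurable_fun setT f) (f0 : forall x, (0 <= f x)%R).
Hypothesis nuE : forall A, measurable A -> nu A = \int[mu]_(x in A) (f x)%:E.

Import HBNNSimple.

(** For a simple function both sides reduce, level set by level set, to [nuE]; monotone convergence
    along [nnsfun_approx] does the rest. *)
Lemma ge0_integral_density (E : set X) (g : X -> \bar R) : measurable E ->
  measurable_fun E g -> (forall x, 0 <= g x) ->
  \int[nu]_(x in E) g x = \int[mu]_(x in E) (g x * (f x)%:E).
Proof.
move=> mE mg g0; have mEf : measurable_fun E (EFin \o f).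
  exact/measurable_EFinP/measurable_funTS.
pose h := nnsfun_approx mE mg.
have -> : \int[nu]_(x in E) g x =
    lim (\int[nu]_(x in E) (EFin \o h n) x @[n --> \oo]).
  have gE x : E x -> g x = lim ((EFin \o h n) x @[n --> \oo]).
    by move=> Ex; apply/esym/cvg_lim => //; exact: cvg_nnsfun_approx.
  under eq_integral => x /[!inE] /gE -> //.
  apply: monotone_convergence => //.
  - move=> n; apply/measurable_EFinP.
    by apply: (measurable_funS measurableT) => //; exact/measurable_funP.
  - by move=> n x Ex //=; rewrite lee_fin.
  - by move=> x Ex a b ab; rewrite lee_fin; exact/lefP/nd_nnsfun_approx.
have -> : \int[mu]_(x in E) (g x * (f x)%:E) =
    lim (\int[mu]_(x in E) ((EFin \o h n) x * (f x)%:E) @[n --> \oo]).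
  have fg x : E x -> g x * (f x)%:E = lim ((EFin \o h n) x * (f x)%:E @[n --> \oo]).
    by move=> Ex; apply/esym/cvg_lim => //; apply: cvgeZr;
      [|exact: cvg_nnsfun_approx].
  under eq_integral => x /[!inE] /fg -> //.
  apply: monotone_convergence => [//| | |].
  - move=> n; apply: emeasurable_funM => //; apply/measurable_funTS.
    exact/measurable_EFinP.
  - by move=> n x Ex /=; rewrite mule_ge0 ?lee_fin.
  - move=> x Ex a b ab/=; rewrite lee_wpmul2r ?lee_fin ?f0//.
    exact/lefP/nd_nnsfun_approx.
suff suf n : \int[mu]_(x in E) ((EFin \o h n) x * (f x)%:E) =
    \int[nu]_(x in E) (EFin \o h n) x.
  by congr (limn _); apply/funext => n; rewrite suf.
transitivity (\int[nu]_(x in E)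
   (\sum_(y \in range (h n)) (y * \1_(h n @^-1` [set y]) x)%:E)); last first.
  by apply: eq_integral => t tE; rewrite /= fimfunE -fsumEFin.
have indich m r : measurable_fun E (fun x => (r * \1_(h m @^-1` [set r]) x)%:E).
  by apply: (measurable_comp measurableT) => //; exact: measurable_funM.
rewrite ge0_integral_fsum//; last by move=> m y Ey; exact: nnfun_muleindic_ge0.
transitivity (\int[mu]_(x in E) (\sum_(y \in range (h n))
    (y * \1_(h n @^-1` [set y]) x)%:E * (f x)%:E)).
  under [RHS]eq_integral => x xE.
    rewrite -ge0_mule_fsuml => [|y]; last exact: nnfun_muleindic_ge0.
    rewrite fsumEFin // -(fimfunE _ x); over.
  by [].
rewrite ge0_integral_fsum//; last 2 first.
  - by move=> y; exact: emeasurable_funM.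
  - by move=> m y Ey; rewrite mule_ge0 ?lee_fin//; exact: nnfun_muleindic_ge0.
apply: eq_fsbigr => r rhn.
under [RHS]eq_integral do rewrite EFinM.
rewrite integralZl_indic_nnsfun => //.
under eq_integral do rewrite EFinM -muleA.
rewrite ge0_integralZl//.
- under eq_integral do rewrite muleC.
  rewrite (eq_integral ((EFin \o f) \_ (h n @^-1` [set r]))); last first.
    by move=> x xE; rewrite epatch_indic.
  rewrite -integral_mkcondr integral_indic// setIC nuE//.
  exact: measurableI.
- by apply: emeasurable_funM => //; exact/measurable_EFinP.
- by move=> t Et; rewrite mule_ge0 ?lee_fin.
- by move: rhn; rewrite inE => -[t _ <-]; rewrite lee_fin.
Qed.

(** Positive and negative parts agree separately, so the two sides agree even when the integral is a
    difference of infinities. *)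
Lemma integral_density (g : X -> R) : measurable_fun setT g ->
  \int[nu]_x (g x)%:E = \int[mu]_x (g x * f x)%:E.
Proof.
move=> mg; rewrite [LHS]integralE [RHS]integralE.
have pE x : ((fun x => (g x * f x)%:E)^\+ x) = ((EFin \o g)^\+ x) * (f x)%:E.
  by rewrite !funeposE EFinM -[in LHS](mul0e (f x)%:E) maxe_pMl ?lee_fin.
have nE x : ((fun x => (g x * f x)%:E)^\- x) = ((EFin \o g)^\- x) * (f x)%:E.
  by rewrite !funenegE EFinM -mulNe -[in LHS](mul0e (f x)%:E) maxe_pMl ?lee_fin.
under [X in _ = X - _]eq_integral do rewrite pE.
under [X in _ = _ - X]eq_integral do rewrite nE.
rewrite -!ge0_integral_density//.
- exact/measurable_funeneg/measurable_EFinP.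
- exact/measurable_funepos/measurable_EFinP.
Qed.

End integral_density.
End density.

(** * Exponential moments and differentiation under the integral *)

Section exponential_moments.
Context {R : realType} {d} {X : measurableType d}.
Variables (mu : {measure set X -> \bar R}) (t : X -> R).
Hypothesis mt : measurable_fun setT t.

Definition laplace (h : R) : \bar R := \int[mu]_x (expR (h * t x))%:E.

Definition exp_moment (n : nat) (h : R) : R :=
  (\int[mu]_x (t x ^+ n * expR (h * t x)))%R.

Lemma measurable_expR_lin h : measurable_fun setT (fun x => expR (h * t x)).
Proof. by apply: measurableT_comp => //; exact: measurable_funM. Qed.

Lemma measurable_exp_moment n h : measurable_fun setT (fun x => t x ^+ n * expR (h * t x)).
Proof.
by apply: measurable_funM; [exact: measurable_funX|exact: measurable_expR_lin].
Qed.

Lemma laplace_ge0 h : (0 <= laplace h)%E.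
Proof. by apply: integral_ge0 => x _; rewrite lee_fin expR_ge0. Qed.

Lemma expR_lin_between (a b h x : R) : a <= h <= b ->
  expR (h * x) <= expR (a * x) + expR (b * x).
Proof.
move=> /andP[ah hb]; have [x0|/ltW x0] := leP 0 x.
  by rewrite ler_wpDl ?expR_ge0// ler_expR ler_wpM2r.
by rewrite ler_wpDr ?expR_ge0// ler_expR ler_wnM2r.
Qed.

Lemma laplaceK h : (laplace h < +oo)%E -> laplace h = (fine (laplace h))%:E.
Proof. by move=> Zh; rewrite fineK// ge0_fin_numE// laplace_ge0. Qed.

Lemma fine_laplace h : fine (laplace h) = exp_moment 0 h.
Proof. by congr fine; apply: eq_integral => x _; rewrite expr0 mul1r. Qed.

Lemma exprn_le_expR n (x : R) : 0 <= x -> x ^+ n <= n`!%:R * expR x.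
Proof.
move=> x0; case: n => [|n]; first by rewrite expr0 fact0 mul1r -[1]expR0 ler_expR.
rewrite mulrC -ler_pdivrMr ?ltr0n ?fact_gt0//.
by apply: le_trans (expR_ge1Dxn n x0); rewrite lerDr.
Qed.

(** With e the distance from h to the nearer end, |x|^n <= n! e^(-n) exp (e |x|), and h x + e |x| is
    at most b x for x >= 0 and at most a x for x < 0. *)
Lemma exp_moment_dom n a b h (x : R) : a < h < b ->
  `|x ^+ n * expR (h * x)| <=
  n`!%:R / Num.min (h - a) (b - h) ^+ n * (expR (a * x) + expR (b * x)).
Proof.
move=> /andP[ah hb]; set e := Num.min _ _.
have e0 : 0 < e by rewrite lt_min !subr_gt0 ah hb.
have ea : e <= h - a by rewrite ge_min lexx.
have eb : e <= b - h by rewrite ge_min lexx orbT.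
rewrite normrM (ger0_norm (expR_ge0 _)) normrX.
apply: (@le_trans _ _ (n`!%:R / e ^+ n * (expR (e * `|x|) * expR (h * x)))).
  rewrite mulrA ler_wpM2r ?expR_ge0//.
  rewrite mulrAC ler_pdivlMr ?exprn_gt0// mulrC -exprMn exprn_le_expR//.
  by rewrite mulr_ge0// ltW.
apply: ler_wpM2l; first by rewrite divr_ge0// exprn_ge0// ltW.
rewrite -expRD; have [x0|x0] := leP 0 x.
  rewrite ler_wpDl ?expR_ge0// ler_expR ger0_norm// -mulrDl ler_wpM2r//.
  by move: eb; lra.
rewrite ler_wpDr ?expR_ge0// ler_expR ltr0_norm// mulrN -mulNr -mulrDl.
by rewrite ler_wnM2r ?(ltW x0)//; move: ea; lra.
Qed.

Lemma exp_moment_integrable n a b h : (laplace a < +oo)%E -> (laplace b < +oo)%E ->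
  a < h < b -> mu.-integrable setT (fun x => (t x ^+ n * expR (h * t x))%:E).
Proof.
move=> Za Zb ahb.
have iZ c : (laplace c < +oo)%E -> mu.-integrable setT (fun x => (expR (c * t x))%:E).
  move=> Zc; apply/integrableP; split.
    by apply/measurable_EFinP; exact: measurable_expR_lin.
  apply: le_lt_trans Zc; rewrite le_eqVlt; apply/orP; left; apply/eqP.
  by apply: eq_integral => x _ /=; rewrite ger0_norm// expR_ge0.
pose C := n`!%:R / Num.min (h - a) (b - h) ^+ n.
have := integrableZl measurableT C (integrableD measurableT (iZ _ Za) (iZ _ Zb)).
apply: le_integrable => //.
  by apply/measurable_EFinP; exact: measurable_exp_moment.
move=> x _ /=; rewrite lee_fin.
by apply: le_trans (exp_moment_dom _ _ ahb) _; exact: ler_norm.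
Qed.

(** On a smaller interval ]u, v[ around h, the moments of order n + 1 at u and at v dominate the
    derivative of the integrand uniformly in the parameter. *)
Lemma is_derive_exp_moment n a b h : (laplace a < +oo)%E -> (laplace b < +oo)%E ->
  a < h < b -> is_derive h 1 (exp_moment n) (exp_moment n.+1 h).
Proof.
move=> Za Zb /andP[ah hb].
pose u := (a + h) / 2; pose v := (h + b) / 2.
have [au uh hv vb] : [/\ a < u, u < h, h < v & v < b].
  by rewrite /u /v; split; lra.
have Iub y : `]u, v[%classic y -> a < y < b.
  by rewrite /= in_itv/= => /andP[uy yv]; rewrite (lt_trans au uy) (lt_trans yv vb).
pose f (y : R) (x : X) := t x ^+ n * expR (y * t x).
have df y x : is_derive (y : R) 1 (f ^~ x) (t x ^+ n.+1 * expR (y * t x)).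
  have h1 : is_derive (y : R) 1 (fun z => z * t x) (t x).
    by apply: is_derive_eq; rewrite /GRing.scale/= mulr1 mulr0 add0r.
  apply: (is_derive_eq (is_deriveZ (t x ^+ n) (is_derive_expR_comp h1))).
  by rewrite /GRing.scale/= exprSr mulrA.
have d1f y x : partial1of2 f y x = t x ^+ n.+1 * expR (y * t x).
  exact: (is_derive_derive1 (df y x)).
pose G (x : X) := `|t x ^+ n.+1 * expR (u * t x)| + `|t x ^+ n.+1 * expR (v * t x)|.
have ih : `]u, v[%classic h by rewrite /= in_itv/= uh hv.
have intf y : `]u, v[%classic y -> mu.-integrable setT (EFin \o f y).
  by move=> /Iub yab; exact: (exp_moment_integrable n Za Zb yab).
have derf y x : `]u, v[%classic y -> setT x -> derivable (f ^~ x) y 1.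
  by move=> _ _; have [] := df y x.
have G0 x : 0 <= G x by rewrite addr_ge0.
have iG : mu.-integrable setT (EFin \o G).
  have i1 : mu.-integrable setT (fun x => (t x ^+ n.+1 * expR (u * t x))%:E).
    by apply: (exp_moment_integrable n.+1 Za Zb); rewrite au (lt_trans uh hb).
  have i2 : mu.-integrable setT (fun x => (t x ^+ n.+1 * expR (v * t x))%:E).
    by apply: (exp_moment_integrable n.+1 Za Zb); rewrite vb (lt_trans ah hv).
  by have := integrableD measurableT (integrable_abse i1) (integrable_abse i2).
have Gub y x : `]u, v[%classic y -> setT x -> `|partial1of2 f y x| <= G x.
  rewrite /= in_itv/= => /andP[uy yv] _; rewrite d1f /G !normrM -mulrDr.
  rewrite !(ger0_norm (expR_ge0 _)) ler_wpM2l// expR_lin_between//.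
  by rewrite (ltW uy) (ltW yv).
have H1 := derivable_under_integral measurableT ih intf derf G0 iG Gub.
have H2 := differentiation_under_integral measurableT ih intf derf G0 iG Gub.
apply: DeriveDef; first exact: H1.
rewrite -derive1E [LHS]H2; apply: eq_Rintegral => x _; exact: d1f.
Qed.

End exponential_moments.

(** * A measure is determined by its Laplace transform near 0 *)

Section laplace_uniqueness.
Context {R : realType}.
Variables (m1 m2 : {measure set (measurableTypeR R) -> \bar R}) (e : R).
Hypothesis e0 : 0 < e.
Hypothesis laplace_lty : forall h, `|h| < e -> (laplace m1 id h < +oo)%E.
Hypothesis laplace_eq : forall h, `|h| < e -> laplace m1 id h = laplace m2 id h.

Let mid : measurable_fun setT (id : measurableTypeR R -> R).
Proof. exact: measurable_id. Qed.

Let laplace_lty2 h : `|h| < e -> (laplace m2 id h < +oo)%E.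
Proof. by move=> he; rewrite -laplace_eq// laplace_lty. Qed.

Let between h : `|h| < e -> exists a b, [/\ `|a| < e, `|b| < e & a < h < b].
Proof.
rewrite ltr_norml => /andP[h1 h2]; exists ((h - e) / 2), ((h + e) / 2).
by rewrite !ltr_norml; split; apply/andP; split; lra.
Qed.

Let moment_integrable n h : `|h| < e ->
  m1.-integrable setT (fun x => (x ^+ n * expR (h * x))%:E) /\
  m2.-integrable setT (fun x => (x ^+ n * expR (h * x))%:E).
Proof.
move=> /between[a [b [ae be ahb]]]; split.
  exact: (exp_moment_integrable mid n (laplace_lty ae) (laplace_lty be) ahb).
exact: (exp_moment_integrable mid n (laplace_lty2 ae) (laplace_lty2 be) ahb).
Qed.

Let exp_moment_eq n h : `|h| < e -> exp_moment m1 id n h = exp_moment m2 id n h.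
Proof.
elim: n h => [|n IH] h he.
  by rewrite -!fine_laplace laplace_eq.
have [a [b [ae be ahb]]] := between he.
have [_ <-] := is_derive_exp_moment mid n (laplace_lty ae) (laplace_lty be) ahb.
have [_ <-] := is_derive_exp_moment mid n (laplace_lty2 ae) (laplace_lty2 be) ahb.
apply: near_eq_derive.
have : h \in `](- e), e[ by rewrite in_itv/= -ltr_norml.
move=> /near_in_itvoo; apply: filterS => y; rewrite in_itv/= -ltr_norml; exact: IH.
Qed.

Let same (f : R -> R) := [/\ m1.-integrable setT (EFin \o f),
  m2.-integrable setT (EFin \o f) &
  (\int[m1]_x (f x)%:E = \int[m2]_x (f x)%:E)%E].

Let sameD f g : same f -> same g -> same (fun x => f x + g x).
Proof.
move=> [f1 f2 fE] [g1 g2 gE]; split.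
- by apply: eq_integrable (integrableD measurableT f1 g1) => // x _ /=; rewrite EFinD.
- by apply: eq_integrable (integrableD measurableT f2 g2) => // x _ /=; rewrite EFinD.
- under eq_integral do rewrite EFinD.
  under [RHS]eq_integral do rewrite EFinD.
  by rewrite !integralD// fE gE.
Qed.

Let sameZ k f : same f -> same (fun x => k * f x).
Proof.
move=> [f1 f2 fE]; split.
- by apply: eq_integrable (integrableZl measurableT k f1) => // x _ /=; rewrite EFinM.
- by apply: eq_integrable (integrableZl measurableT k f2) => // x _ /=; rewrite EFinM.
- under eq_integral do rewrite EFinM.
  under [RHS]eq_integral do rewrite EFinM.
  by rewrite !integralZl// fE.
Qed.

Let same_lim (f_ : nat -> R -> R) f G : (forall n, same (f_ n)) ->
  (forall x, f_ n x @[n --> \oo] --> f x) ->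
  (forall n x, `|f_ n x| <= G x) ->
  m1.-integrable setT (EFin \o G) -> m2.-integrable setT (EFin \o G) -> same f.
Proof.
move=> sf ff fG G1 G2.
have mf_ n : measurable_fun [set: measurableTypeR R] (EFin \o f_ n).
  by have [/integrableP[]] := sf n.
have mf : measurable_fun [set: measurableTypeR R] (EFin \o f).
  apply/measurable_EFinP; apply: (@measurable_fun_cvg _ _ _ _ f_) => //.
  by move=> n; apply/measurable_EFinP; exact: mf_.
have ffE x : (EFin \o f_ n) x @[n --> \oo] --> (EFin \o f) x.
  apply: cvg_EFin; first exact: nearW.
  exact: ff.
have fGE n x : (`|(EFin \o f_ n) x| <= (EFin \o G) x)%E by rewrite lee_fin.
have [i1 _ c1] := dominated_convergence measurableT mf_ mf
  (aeW m1 (fun x _ => ffE x)) G1 (aeW m1 (fun x n _ => fGE n x)).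
have [i2 _ c2] := dominated_convergence measurableT mf_ mf
  (aeW m2 (fun x _ => ffE x)) G2 (aeW m2 (fun x n _ => fGE n x)).
have E12 : (fun n => (\int[m1]_x (EFin \o f_ n) x)%E) =
    (fun n => (\int[m2]_x (EFin \o f_ n) x)%E).
  by apply/funext => n; have [] := sf n.
by split => //; move: c1; rewrite E12 => c1; exact: (cvg_unique _ c1 c2).
Qed.

Let bdd (f : R -> R) := measurable_fun [set: measurableTypeR R] f /\
  exists M, forall x, `|f x| <= M.

Let bddM f g : bdd f -> bdd g -> bdd (fun x => f x * g x).
Proof.
move=> [mf [M fM]] [mg [N gN]]; split; first exact: measurable_funM.
by exists (M * N) => x; rewrite normrM ler_pM.
Qed.

Let integrable_Mbdd (m : {measure set (measurableTypeR R) -> \bar R}) f g : bdd f ->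
  m.-integrable setT (EFin \o g) -> m.-integrable setT (fun x => (g x * f x)%:E).
Proof.
move=> [mf [M fM]] ig.
have := integrableZl measurableT M (integrable_norm ig).
apply: le_integrable => //.
  apply/measurable_EFinP/measurable_funM => //.
  by move: ig => /integrableP[/measurable_EFinP].
move=> x _ /=; rewrite lee_fin normrM mulrC.
apply: le_trans (ler_norm _); exact: ler_wpM2r.
Qed.

(** Asking for all powers x^n is what allows a power series in x, such as that of cos (s x), to be
    integrated term by term against f. *)
Let same_moments f := bdd f /\ forall n, same (fun x => x ^+ n * f x).

(** Only frequencies below e are controlled directly by the transforms. Multipliers, however, are
    closed under sums, products and bounded pointwise limits, and this leads from small frequencies
    to indicators. *)
Let multiplier g := bdd g /\
  forall f, same_moments f -> same_moments (fun x => f x * g x).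

Let multiplierM f g : multiplier f -> multiplier g -> multiplier (fun x => f x * g x).
Proof.
move=> [bf mf] [bg mg]; split; first exact: bddM.
by move=> k /mf/mg; under eq_fun do rewrite -mulrA.
Qed.

Let bddD f g : bdd f -> bdd g -> bdd (fun x => f x + g x).
Proof.
move=> [mf [M fM]] [mg [N gN]]; split; first exact: measurable_funD.
by exists (M + N) => x; rewrite (le_trans (ler_normD _ _))// lerD.
Qed.

Let bddZ k f : bdd f -> bdd (fun x => k * f x).
Proof.
move=> [mf [M fM]]; split; first exact: measurable_funM.
by exists (`|k| * M) => x; rewrite normrM ler_wpM2l.
Qed.

Let multiplierD f g : multiplier f -> multiplier g -> multiplier (fun x => f x + g x).
Proof.
move=> [bf mf] [bg mg]; split; first exact: bddD.
move=> k sk; have [b1 s1] := mf _ sk; have [b2 s2] := mg _ sk.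
split; first by under eq_fun do rewrite mulrDr; exact: bddD.
by move=> n; under eq_fun do rewrite mulrDr mulrDr; exact: sameD.
Qed.

Let multiplierZ k f : multiplier f -> multiplier (fun x => k * f x).
Proof.
move=> [bf mf]; split; first exact: bddZ.
move=> g sg; have [b1 s1] := mf _ sg.
split; first by under eq_fun do rewrite mulrCA; exact: bddZ.
move=> n; have -> : (fun x => x ^+ n * (g x * (k * f x))) =
    (fun x => k * (x ^+ n * (g x * f x))) by apply/funext => x; ring.
exact/sameZ/s1.
Qed.

Let multiplier1 : multiplier (cst 1).
Proof.
split; last by move=> f; under [X in _ -> same_moments X]eq_fun do rewrite mulr1.
by split; [exact: measurable_cst|exists 1 => x; rewrite normr1].
Qed.

Let multiplier_lim (g_ : nat -> R -> R) g M : (forall n, multiplier (g_ n)) ->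
  (forall x, g_ n x @[n --> \oo] --> g x) -> (forall n x, `|g_ n x| <= M) ->
  multiplier g.
Proof.
move=> mg gg gM.
have bg : bdd g.
  split.
    apply: (@measurable_fun_cvg _ _ _ _ g_) => //.
    by move=> n; have [[]] := mg n.
  exists M => x; rewrite -(cvg_lim _ (cvg_norm (gg x)))//.
  apply: limr_le; first by apply/cvg_ex; exists `|g x|; exact: cvg_norm (gg x).
  by apply: nearW => n.
split => // f sf; split; first exact: bddM (sf.1) bg.
move=> n; have [f1 f2 _] := sf.2 n.
apply: (@same_lim (fun k x => x ^+ n * (f x * g_ k x)) _
    (fun x => M * `|x ^+ n * f x|)).
- by move=> k; have [_] := (mg k).2 _ sf; exact.
- move=> x; apply: cvgM; first exact: cvg_cst.
  by apply: cvgM; [exact: cvg_cst|exact: gg].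
- by move=> k x; rewrite mulrA normrM mulrC ler_wpM2r.
- by have := integrableZl measurableT M (integrable_norm f1).
- by have := integrableZl measurableT M (integrable_norm f2).
Qed.

Let expR_partial (x : R) n : 0 <= x -> \sum_(0 <= k < n) x ^+ k / k`!%:R <= expR x.
Proof.
move=> x0; have := @nondecreasing_cvgn_le _ (series (exp_coeff x)) _
  (is_cvg_series_exp_coeff x) n; apply.
apply/nondecreasing_seqP => k; rewrite /series/= big_nat_recr//= lerDl.
by rewrite /exp_coeff/= divr_ge0// exprn_ge0.
Qed.

(** The partial sums, multiplied by x^n f, are dominated by a multiple of |x|^n exp (|s| |x|), hence
    by the sum of the two integrable functions with exp (|s| x) and exp (- |s| x); here |s| < e
    enters. *)
Let multiplier_series (c : nat -> R) (g : R -> R) s : `|s| < e ->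
  (forall k, `|c k| <= (k`!%:R)^-1) ->
  (forall x, \sum_(0 <= k < n) c k * x ^+ k @[n --> \oo] --> g x) ->
  bdd (fun x => g (s * x)) -> multiplier (fun x => g (s * x)).
Proof.
move=> se ck gE bg; split => // f sf; have [bf sn] := sf.
split; first exact: bddM bf bg.
move=> n.
pose f_ N x := \sum_(0 <= k < N) (c k * s ^+ k) * (x ^+ (n + k) * f x).
have f_E N x : f_ N x = x ^+ n * (f x * \sum_(0 <= k < N) c k * (s * x) ^+ k).
  rewrite /f_ mulr_sumr mulr_sumr; apply: eq_bigr => k _.
  by rewrite exprMn exprD; ring.
have [M fM] := bf.2.
apply: (@same_lim f_ _ (fun x => M * (`|x ^+ n * expR (`|s| * x)| +
     `|x ^+ n * expR (- `|s| * x)|))).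
- elim=> [|N IH].
    have -> : f_ 0%N = fun x => 0 * (x ^+ 0 * f x).
      by apply/funext => x; rewrite /f_ big_geq// mul0r.
    exact/sameZ/sn.
  have -> : f_ N.+1 = fun x => f_ N x + (c N * s ^+ N) * (x ^+ (n + N) * f x).
    by apply/funext => x; rewrite /f_ big_nat_recr.
  by apply: sameD IH _; exact/sameZ/sn.
- move=> x; under eq_fun do rewrite f_E.
  by apply: cvgM; [exact: cvg_cst|apply: cvgM; [exact: cvg_cst|exact: gE]].
- move=> N x; rewrite f_E mulrCA normrM.
  apply: ler_pM => //; rewrite normrM -(ger0_norm (expR_ge0 (`|s| * x))).
  rewrite -(ger0_norm (expR_ge0 (- `|s| * x))).
  rewrite ![in X in _ <= X]normrM -mulrDr ler_wpM2l//.
  rewrite !(ger0_norm (expR_ge0 _)).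
  apply: (@le_trans _ _ (expR (`|s| * `|x|))).
    apply: le_trans (expR_partial N (mulr_ge0 (normr_ge0 s) (normr_ge0 x))).
    apply: le_trans (ler_norm_sum _ _ _) _; apply: ler_sum => k _.
    by rewrite normrM normrX normrM mulrC ler_wpM2l.
  have [x0|x0] := leP 0 x; first by rewrite (ger0_norm x0) lerDl expR_ge0.
  by rewrite (ltr0_norm x0) mulrN mulNr lerDr expR_ge0.
- have [i1 _] := @moment_integrable n `|s| ltac:(by rewrite normr_id).
  have [i2 _] := @moment_integrable n (- `|s|) ltac:(by rewrite normrN normr_id).
  exact: (integrableZl measurableT M
    (integrableD measurableT (integrable_norm i1) (integrable_norm i2))).
- have [_ i1] := @moment_integrable n `|s| ltac:(by rewrite normr_id).
  have [_ i2] := @moment_integrable n (- `|s|) ltac:(by rewrite normrN normr_id).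
  exact: (integrableZl measurableT M
    (integrableD measurableT (integrable_norm i1) (integrable_norm i2))).
Qed.

Let multiplier_cos s : `|s| < e -> multiplier (fun x => cos (s * x)).
Proof.
move=> se; apply: (multiplier_series
    (c := fun n => (~~ odd n)%:R * (-1) ^+ n./2 / n`!%:R)) => //.
- move=> k; rewrite normrM normfV (ger0_norm (ler0n _ _)).
  rewrite ler_piMl ?invr_ge0// normrM normrX normrN1 expr1n mulr1.
  by case: (odd k); rewrite /= ?normr0 ?normr1.
- move=> x; have h : series (cos_coeff x) @ \oo --> cos x.
    by rewrite cos.unlock; exact: (@is_cvg_series_cos_coeff R x).
  rewrite [X in X @ _ --> _](_ : _ = series (cos_coeff x)); first exact: h.
  apply/funext => n; rewrite /series/=; apply: eq_bigr => k _.
  by rewrite /cos_coeff/= mulrAC.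
- split; last by exists 1 => x; exact: cos_max.
  apply: continuous_measurable_fun => x.
  by apply: continuous_comp; [exact: mulrl_continuous|exact: continuous_cos].
Qed.

Let multiplier_sin s : `|s| < e -> multiplier (fun x => sin (s * x)).
Proof.
move=> se; apply: (multiplier_series
    (c := fun n => (odd n)%:R * (-1) ^+ n.-1./2 / n`!%:R)) => //.
- move=> k; rewrite normrM normfV (ger0_norm (ler0n _ _)).
  rewrite ler_piMl ?invr_ge0// normrM normrX normrN1 expr1n mulr1.
  by case: (odd k); rewrite /= ?normr0 ?normr1.
- move=> x; have h : series (sin_coeff x) @ \oo --> sin x.
    by rewrite sin.unlock; exact: (@is_cvg_series_sin_coeff R x).
  rewrite [X in X @ _ --> _](_ : _ = series (sin_coeff x)); first exact: h.
  apply/funext => n; rewrite /series/=; apply: eq_bigr => k _.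
  by rewrite /sin_coeff/= mulrAC.
- split; last by exists 1 => x; exact: sin_max.
  apply: continuous_measurable_fun => x.
  by apply: continuous_comp; [exact: mulrl_continuous|exact: continuous_sin].
Qed.

(** The Newton-Schulz iteration for the sign: on [-1, 1] the points 1 and -1 attract everything
    except 0. Being a polynomial, it turns multipliers into multipliers. *)
Let smooth (u : R) := (3 * u - u ^+ 3) / 2.

(** With v an iterate, 1 - smooth v = (1 - v) (2 - v - v^2) / 2, and the last factor, halved, is at
    most 1 - u / 2 because v >= u. *)
Let smooth_iter_gt0 (u : R) : 0 < u <= 1 ->
  forall n, u <= iter n smooth u <= 1 /\ 1 - iter n smooth u <= (1 - u / 2) ^+ n.
Proof.
move=> /andP[u0 u1]; elim=> [|n [/andP[IH1 IH2] IH3]].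
  by rewrite /= lexx u1 expr0; split=> //; lra.
rewrite iterS; set v := iter n smooth u in IH1 IH2 IH3 *.
have v0 : 0 < v by exact: lt_le_trans IH1.
have v2 : v ^+ 2 <= 1 by rewrite expr_le1// ltW.
have h1 : v <= smooth v.
  rewrite /smooth -subr_ge0 (_ : _ - v = v * (1 - v ^+ 2) / 2); last by field.
  by rewrite divr_ge0// mulr_ge0 ?(ltW v0)// subr_ge0.
have h2 : 1 - smooth v = (1 - v) * ((2 - v - v ^+ 2) / 2).
  by rewrite /smooth; field.
have v20 : 0 <= v ^+ 2 by rewrite sqr_ge0.
split; first rewrite (le_trans IH1 h1)/=.
  by rewrite -subr_ge0 h2 mulr_ge0//; lra.
rewrite h2 [leRHS]exprSr ler_pM//; lra.
Qed.

Let cvg_smooth_iter (u : R) : `|u| <= 1 -> iter n smooth u @[n --> \oo] --> Num.sg u.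
Proof.
have pos (v : R) : 0 < v <= 1 -> iter n smooth v @[n --> \oo] --> (1 : R).
  move=> v01; have H := smooth_iter_gt0 v01; case/andP: v01 => v0 v1.
  apply: (@squeeze_cvgr _ _ _ _ (fun n => 1 - (1 - v / 2) ^+ n) (cst 1)).
  - near=> n; have [/andP[_ h1] h2] := H n.
    by rewrite h1 andbT lerBlDr -lerBlDl.
  - rewrite -[X in _ --> X]subr0; apply: cvgB; first exact: cvg_cst.
    by apply: cvg_expr; rewrite ger0_norm; lra.
  - exact: cvg_cst.
have iterN n v : iter n smooth (- v) = - iter n smooth v.
  elim: n v => // n IH v; rewrite !iterS IH /smooth.
  by rewrite -[(- _) ^+ 3]/((- _) ^+ 3) exprNn; field.
move=> u1; have [u0|u0|->] := ltgtP u 0.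
- rewrite ltr0_sg//.
  have -> : (fun n => iter n smooth u) = (fun n => - iter n smooth (- u)).
    by apply/funext => n; rewrite iterN opprK.
  by apply: cvgN; apply: pos; rewrite oppr_gt0 u0/= -(ltr0_norm u0).
- by rewrite gtr0_sg//; apply: pos; rewrite u0/= -(gtr0_norm u0).
- rewrite sgr0; have -> : (fun n => iter n smooth 0) = cst 0; last exact: cvg_cst.
  by apply/funext; elim => // n IH; rewrite iterS IH /smooth /= expr0n/= mulr0 subr0 mul0r.
Unshelve. all: by end_near. Qed.

Let smooth_iter_bound (u : R) n : `|u| <= 1 -> `|iter n smooth u| <= 1.
Proof.
move=> u1; elim: n => // n; rewrite iterS; set v := iter n smooth u => v1.
have [va vb] : -1 <= v /\ v <= 1 by apply/andP; rewrite -ler_norml.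
rewrite ler_norml; apply/andP; split.
  rewrite -subr_ge0 (_ : _ - - 1 = (v + 1) ^+ 2 * (2 - v) / 2); last by rewrite /smooth; field.
  by rewrite divr_ge0// mulr_ge0 ?sqr_ge0//; lra.
rewrite -subr_ge0 (_ : 1 - _ = (1 - v) ^+ 2 * (2 + v) / 2); last by rewrite /smooth; field.
by rewrite divr_ge0// mulr_ge0 ?sqr_ge0//; lra.
Qed.

Let multiplier_sg_sin s a : `|s| < e -> multiplier (fun x => Num.sg (sin (s * (x - a)))).
Proof.
move=> se.
have ms : multiplier (fun x => sin (s * (x - a))).
  have -> : (fun x => sin (s * (x - a))) = fun x =>
      cos (s * a) * sin (s * x) + (- sin (s * a)) * cos (s * x).
    by apply/funext => x; rewrite mulrBr sinB; ring.
  apply: multiplierD; apply: multiplierZ; [exact: multiplier_sin|exact: multiplier_cos].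
apply: (@multiplier_lim (fun n x => iter n smooth (sin (s * (x - a)))) _ 1).
- elim=> // n IH.
  have -> : (fun x => iter n.+1 smooth (sin (s * (x - a)))) = fun x =>
     3 / 2 * iter n smooth (sin (s * (x - a))) + (- 2^-1) *
     (iter n smooth (sin (s * (x - a))) * (iter n smooth (sin (s * (x - a))) *
     iter n smooth (sin (s * (x - a))))).
    by apply/funext => x; rewrite iterS /smooth; field.
  apply: multiplierD; first exact: multiplierZ.
  by apply/multiplierZ/multiplierM => //; exact: multiplierM.
- by move=> x; apply: cvg_smooth_iter; exact: sin_max.
- by move=> n x; apply: smooth_iter_bound; exact: sin_max.
Qed.

Let sg_sin_small (y s : R) : 0 < s -> s * `|y| < pi -> Num.sg (sin (s * y)) = Num.sg y.
Proof.
move=> s0 sy; have [y0|y0|->] := ltgtP y 0; last by rewrite mulr0 sin0.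
  rewrite -[y]opprK mulrN sinN !sgrN; congr (- _).
  have y0' : 0 < - y by rewrite oppr_gt0.
  have h : 0 < sin (s * - y) by rewrite sin_gt0_pi// mulr_gt0//= -(ltr0_norm y0).
  by rewrite (gtr0_sg h) (ltr0_sg y0) opprK.
rewrite !gtr0_sg// sin_gt0_pi// mulr_gt0//=.
by rewrite -(gtr0_norm y0).
Qed.

(** As long as s |x - a| < pi, the sine of s (x - a) has the sign of x - a; letting s tend to 0
    reaches every x. *)
Let multiplier_sg a : multiplier (fun x => Num.sg (x - a)).
Proof.
pose s n : R := e / 2 * n.+1%:R^-1.
have s0 n : 0 < s n by rewrite mulr_gt0 ?divr_gt0// invr_gt0.
apply: (@multiplier_lim (fun n x => Num.sg (sin (s n * (x - a)))) _ 1).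
- move=> n; apply: multiplier_sg_sin; rewrite gtr0_norm//.
  apply: (@le_lt_trans _ _ (e / 2)); last by rewrite ltr_pdivrMr// ltr_pMr// ltr1n.
  by rewrite ler_piMr ?divr_ge0 ?(ltW e0)// invf_le1// ler1n.
- move=> x; have s_lim : s n * `|x - a| @[n --> \oo] --> (0 : R).
    rewrite -(mul0r `|x - a|); apply: cvgM; last exact: cvg_cst.
    rewrite -(mulr0 (e / 2)); apply: cvgM; first exact: cvg_cst.
    exact: cvg_harmonic.
  apply: cvg_near_cst; near=> n; apply: sg_sin_small => //.
  near: n; exact: (cvgr_lt 0 s_lim pi (pi_gt0 R)).
- by move=> n x; rewrite normr_sg; case: (_ != 0).
Unshelve. all: by end_near. Qed.

Let multiplier_gt a : multiplier (fun x => (a < x)%R%:R).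
Proof.
have : multiplier (fun x => 2 * (a < x)%R%:R - 1).
  (* The jump is moved to the right by 1/(n+1), so that the limit is -1, not 0, at x = a. *)
  apply: (@multiplier_lim (fun n x => Num.sg (x - (a + n.+1%:R^-1))) _ 1) => //.
  - move=> x; apply: cvg_near_cst; have [ax|xa] := ltP a x.
      have -> : 2 * true%:R - 1 = 1 :> R by rewrite mulr1 -{1}[2]/(1 + 1) addrK.
      near=> n; rewrite gtr0_sg ?subr_gt0//.
      rewrite -ltrBrDl; near: n.
      apply: (cvgr_lt 0 (@cvg_harmonic R) (x - a)); by rewrite subr_gt0.
    near=> n; rewrite mulr0 sub0r ltr0_sg// subr_lt0 (le_lt_trans xa)// ltrDl.
    by rewrite invr_gt0.
  - by move=> n x; rewrite normr_sg; case: (_ != 0).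
move=> h; have : multiplier (fun x => 2^-1 * ((2 * (a < x)%R%:R - 1) + cst 1 x)).
  by apply: multiplierZ; exact: multiplierD.
by congr multiplier; apply/funext => x /=; rewrite subrK mulKf.
Unshelve. all: by end_near. Qed.

(** The constant 1 has the same moments for both measures, so indicators of half-open intervals,
    being multipliers, have the same integrals. These intervals are stable under intersection,
    generate the Borel sets and exhaust the line. *)
Lemma laplace_inj A : measurable A -> m1 A = m2 A.
Proof.
have e0' : `|0 : R| < e by rewrite normr0.
have same1 : same_moments (cst 1).
  split; first by case: multiplier1.
  move=> n; have [i1 i2] := moment_integrable n e0'.
  have E : (fun x : R => (x ^+ n * expR (0 * x))%:E) = EFin \o (fun x => x ^+ n * cst 1 x).
    by apply/funext => x /=; rewrite mul0r expR0.
  split; rewrite -?E//.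
  have h := exp_moment_eq n e0'; have := congr1 EFin h.
  rewrite /exp_moment /Rintegral !fineK ?integrable_fin_num//.
  by under eq_integral do rewrite mul0r expR0; under [in RHS]eq_integral do rewrite mul0r expR0.
have m12 (a b : R) : m1 `]a, b]%classic = m2 `]a, b]%classic.
  have [ab|ba] := leP a b; last by rewrite set_itv_ge ?measure0// -leNgt bnd_simp ltW.
  have : multiplier (fun x => (a < x)%R%:R + (-1) * (b < x)%R%:R).
    by apply: multiplierD; [|apply: multiplierZ]; exact: multiplier_gt.
  move=> [_ /(_ _ same1)[_ /(_ 0%N)[_ _]]].
  have E (x : R) : (x ^+ 0 * (cst 1 x * ((a < x)%R%:R + -1 * (b < x)%R%:R)))%:E =
      (\1_(`]a, b]%classic) x)%:E :> \bar R.
    rewrite expr0 !mul1r mulN1r indicE; congr EFin.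
    have -> : (x \in `]a, b]%classic) = (a < x <= b) by rewrite mem_setE in_itv.
    rewrite leNgt; have [bx|] := ltP b x; first by rewrite (le_lt_trans ab bx) subrr.
    by rewrite andbT subr0.
  under eq_integral do rewrite E; under [in X in _ = X -> _]eq_integral do rewrite E.
  by rewrite !integral_indic// !setIT.
have fin1 (B : set (measurableTypeR R)) : measurable B -> (m1 B < +oo)%E.
  move=> mB; apply: (@le_lt_trans _ _ (m1 setT)); first by rewrite le_measure// inE.
  have := laplace_lty e0'; rewrite /laplace.
  under eq_integral do rewrite mul0r expR0.
  by rewrite integral_cst// mul1e.
move=> mA; have H := @measure_unique _ R (measurableTypeR R) (@ocitv R)
  (fun n => `](- n%:R)%R, n%:R]%classic) erefl (@ocitvI R).
apply: (H _ _ m1 m2) => //.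
- by move=> n; exact: is_ocitv.
- rewrite -subTset => x _; exists (Num.truncn `|x|).+1 => //=.
  have := Num.Theory.truncnS_gt `|x|; rewrite ltr_norml in_itv/= => /andP[-> /ltW ->]//.
- by move=> _ [[a b] _ <-]; exact: m12.
- by move=> n; apply: fin1.
Qed.

End laplace_uniqueness.

(** * Borel measurability and the two categories of sample spaces *)

Lemma continuous_borel (X Y : ptopologicalType) (f : X -> Y) : continuous f ->
  measurable_fun setT (f : borel X -> borel Y).
Proof.
move=> cf; apply: (@measurability _ _ (borel X) (borel Y) setT f (@open Y) erefl).
move=> _ [B oB <-]; rewrite setTI; apply: sub_sigma_algebra.
by apply: open_comp => // x _; exact: cf.
Qed.

Section borel_measurability.
Context {R : realType}.

(** [measurableTypeR R] is generated by intervals, [borel R] by open sets; Lebesgue measure lives on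
    the first and sample spaces use the second. *)
Lemma borelP (A : set R) :
  measurable (A : set (borel R)) <-> measurable (A : set (measurableTypeR R)).
Proof.
split=> [|mA]; first exact: borel_line_measurable.
move: mA; rewrite RGenOpens.measurableE; apply: smallest_sub.
  exact: (@sigma_algebra_measurable _ (borel R)).
by move=> _ [a [b ->]]; apply: sub_sigma_algebra; exact: interval_open.
Qed.

Lemma measurable_fun_borel d (X : measurableType d) (f : X -> R) :
  measurable_fun setT (f : X -> borel R) <->
  measurable_fun setT (f : X -> measurableTypeR R).
Proof.
by split=> mf _ Y /borelP mY; exact: mf.
Qed.

Lemma continuous_coord m n (i : 'I_m) (j : 'I_n) :
  continuous (fun M : 'M[R]_(m, n) => M i j).
Proof. exact: coord_continuous. Qed.

End borel_measurability.

Section category_facts.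
Context {R : realType} (c : category) (X : sampleSpace R).
Hypothesis cX : in_category c X.

Lemma ok_stat_measurable n (T : X -> 'rV[R]_n) (i : 'I_n) : ok_stat X T ->
  measurable_fun setT (fun x => T x 0 i).
Proof.
case: cX T => [Y _ _|d Y] T /= okT.
  apply/measurable_fun_borel; apply: (@continuous_borel Y R) => x.
  exact: (continuous_comp (okT x) (@continuous_coord _ _ _ 0 i _)).
apply/measurable_fun_borel.
exact: (measurable_comp measurableT _ (@continuous_borel 'rV[R]_n R _ (@continuous_coord _ _ _ 0 i)) okT).
Qed.

Lemma ok_stat_comp m n (T : X -> 'rV[R]_m) (f : 'rV[R]_m -> 'rV[R]_n) :
  continuous f -> ok_stat X T -> ok_stat X (f \o T).
Proof.
case: cX T => [Y _ _|d Y] T /= cf okT.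
  by move=> x; exact: (continuous_comp (okT x) (cf _)).
exact: (measurable_comp measurableT _ (continuous_borel cf) okT).
Qed.

Lemma ok_stat_cst n (v : 'rV[R]_n) : ok_stat X (fun _ => v).
Proof.
case: cX => [Y _ _|d Y] /=; first by move=> x; exact: cst_continuous.
exact: measurable_cst.
Qed.

End category_facts.

(* Locked: otherwise unification compares cumulants by unfolding integrals. *)
HB.lock Definition cgf (R : realType) d (X : measurableType d)
  (mu : {measure set X -> \bar R}) (t : X -> R) (h : R) : R := ln (fine (laplace mu t h)).

Lemma cgfE (R : realType) d (X : measurableType d) (mu : {measure set X -> \bar R})
  (t : X -> R) (h : R) : cgf mu t h = ln (fine (laplace mu t h)).
Proof. by rewrite cgf.unlock. Qed.

(** * Exponential tilts of a probability measure *)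

Section tilting.
Context {R : realType} d (X : measurableType d).
Implicit Types (nu : probability X R) (t : X -> R).

(* [nu] is the member with natural parameter [h], relative to [nu0], of the
   exponential family generated by [nu0] and the statistic [t]. *)
Definition tilt nu0 t h nu :=
  (laplace nu0 t h < +oo)%E /\ forall A, measurable A ->
    nu A = (\int[nu0]_(x in A) (expR (h * t x - cgf nu0 t h))%:E)%E.

Lemma laplace_gt0 nu t h : measurable_fun setT t -> (0 < laplace nu t h)%E.
Proof.
move=> mt; rewrite lt0e laplace_ge0 andbT; apply/negP => /eqP L0.
have mE : measurable_fun setT (fun x => (expR (h * t x))%:E).
  by apply/measurable_EFinP; exact: measurable_expR_lin.
have : (\int[nu]_x `|(expR (h * t x))%:E| = 0)%E.
  by rewrite -L0; apply: eq_integral => x _; rewrite gee0_abs// lee_fin expR_ge0.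
move/(ae_eq_integral_abs nu measurableT mE) => [N [mN N0 sN]].
have : (nu setT <= nu N)%E.
  apply: le_measure; rewrite ?inE//; move=> x _; apply: sN => /= /(_ I) [].
  by move/eqP; rewrite expR_eq0.
by rewrite probability_setT N0 leNgt lte01.
Qed.

Lemma fine_laplace_gt0 nu t h : measurable_fun setT t -> (laplace nu t h < +oo)%E ->
  0 < fine (laplace nu t h).
Proof. by move=> mt fh; rewrite fine_gt0// laplace_gt0. Qed.

Lemma laplace0 nu t : laplace nu t 0 = 1%E.
Proof.
rewrite /laplace; under eq_integral do rewrite mul0r expR0.
by rewrite integral_cst// mul1e [LHS]probability_setT.
Qed.

Lemma tilt0 nu0 t nu : tilt nu0 t 0 nu -> forall A, measurable A -> nu A = nu0 A.
Proof.
move=> [_ nuE] A mA; rewrite nuE// cgfE laplace0/= ln1.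
under eq_integral do rewrite mul0r subrr expR0.
by rewrite integral_cst// mul1e.
Qed.

Lemma measurable_tilt t h k : measurable_fun setT t ->
  measurable_fun setT (fun x => expR (h * t x - k)).
Proof.
by move=> mt; apply: measurableT_comp => //; apply: measurable_funB => //;
  exact: measurable_funM.
Qed.

Lemma tilt_affine_ae nu0 t t' h h' nu : measurable_fun setT t -> measurable_fun setT t' ->
  tilt nu0 t h nu -> tilt nu0 t' h' nu ->
  {ae nu0, forall x, h * t x - cgf nu0 t h = h' * t' x - cgf nu0 t' h'}.
Proof.
move=> mt mt' [_ nuE] [_ nuE'].
have iE : nu0.-integrable setT (fun x => (expR (h * t x - cgf nu0 t h))%:E).
  apply/integrableP; split; first by apply/measurable_EFinP; exact: measurable_tilt.
  under eq_integral do rewrite gee0_abs ?lee_fin ?expR_ge0//.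
  by rewrite -nuE// [ltLHS]probability_setT ltry.
have := @integral_ae_eq _ _ _ nu0 setT measurableT
  (fun x => (expR (h' * t' x - cgf nu0 t' h'))%:E) _ iE.
move=> /(_ _)[].
- by apply/measurable_EFinP; exact: measurable_tilt.
- move=> E _ mE; exact: etrans (esym (nuE E mE)) (nuE' E mE).
move=> N [mN N0 sN]; exists N; split => // x /= nx; apply: sN => /= xx; apply: nx.
by case: (xx I) => /expR_inj.
Qed.

Section affine.
Variables (nu0 : probability X R) (t t' : X -> R) (a b : R).
Hypotheses (mt : measurable_fun setT t) (mt' : measurable_fun setT t').
Hypothesis t'E : {ae nu0, forall x, t' x = a * t x + b}.

Lemma laplace_affine h : laplace nu0 t' h = ((expR (h * b))%:E * laplace nu0 t (a * h))%E.
Proof.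
rewrite /laplace -ge0_integralZl//.
- apply: ge0_ae_eq_integral => //.
  + by apply/measurable_EFinP; exact: measurable_expR_lin.
  + apply: emeasurable_funM => //; apply/measurable_EFinP; exact: measurable_expR_lin.
  apply: filterS t'E => x -> _; rewrite -EFinM -expRD; congr (expR _)%:E; ring.
- by apply/measurable_EFinP; exact: measurable_expR_lin.
Qed.

Lemma laplace_affine_lty h : (laplace nu0 t' h < +oo)%E <-> (laplace nu0 t (a * h) < +oo)%E.
Proof.
rewrite laplace_affine; case: (laplace nu0 t (a * h)) (laplace_gt0 nu0 (a * h) mt).
- by move=> r _; rewrite -EFinM !ltry.
- by move=> _; rewrite gt0_muley ?lte_fin ?expR_gt0//.
- by [].
Qed.

Lemma cgf_affine h : (laplace nu0 t (a * h) < +oo)%E ->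
  cgf nu0 t' h = cgf nu0 t (a * h) + h * b.
Proof.
move=> fh; rewrite !cgfE laplace_affine [in LHS](laplaceK fh) -EFinM/=.
by rewrite lnM ?posrE ?expR_gt0 ?fine_laplace_gt0// expRK addrC.
Qed.

Lemma tilt_affine h nu : tilt nu0 t' h nu <-> tilt nu0 t (a * h) nu.
Proof.
suff E (A : set X) : (laplace nu0 t (a * h) < +oo)%E -> measurable A ->
    (\int[nu0]_(x in A) (expR (h * t' x - cgf nu0 t' h))%:E =
     \int[nu0]_(x in A) (expR (a * h * t x - cgf nu0 t (a * h)))%:E)%E.
  split=> -[h1 h2].
    have h1' := (laplace_affine_lty h).1 h1.
    split; [exact: h1'|move=> A mA; exact: etrans (h2 A mA) (E A h1' mA)].
  split; first exact: (laplace_affine_lty h).2 h1.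
  move=> A mA; exact: etrans (h2 A mA) (esym (E A h1 mA)).
move=> fh mA; apply: ge0_ae_eq_integral => //.
- by apply/measurable_EFinP/measurable_funTS; exact: measurable_tilt.
- by apply/measurable_EFinP/measurable_funTS; exact: measurable_tilt.
apply: filterS t'E => x -> _; rewrite cgf_affine//.
by move: (cgf _ _ _) => u; congr (expR _)%:E; ring.
Qed.

End affine.

(** For an almost surely constant statistic the exponential cancels against its normalizer, and
    every tilt would be [nu0] itself. *)
Lemma tilt_not_cst nu0 t h nu A m : measurable_fun setT t -> tilt nu0 t h nu ->
  measurable A -> nu A <> nu0 A -> ~ {ae nu0, forall x, t x = m}.
Proof.
move=> mt th mA + tm; apply.
have tE : {ae nu0, forall x, t x = 0 * t x + m}.
  by apply: filterS tm => x ->; rewrite mul0r add0r.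
have := (tilt_affine mt mt tE h nu).1 th; rewrite mul0r => /tilt0; exact.
Qed.

End tilting.

(** * Realizations of order one, seen from a member as base point *)

Section order_one_realization.
Context {R : realType} (X : sampleSpace R).
Implicit Types (mu : {measure set X -> \bar R}) (nu : probability X R).

Definition coord (T : X -> 'rV[R]_1) (x : X) : R := T x 0 0.

Lemma scalar_mx11 (th : 'cV[R]_1) : th = (th 0 0)%:M.
Proof. exact: mx11_scalar. Qed.

Variables (T : X -> 'rV[R]_1).
Hypothesis mt : measurable_fun setT (coord T).

Lemma partition_functionE mu (h : R) : partition_function T mu h%:M = laplace mu (coord T) h.
Proof.
by apply: eq_integral => x _; rewrite /pairing mxE big_ord1 mxE eqxx mulr1n mulrC.
Qed.

Lemma log_normalizerE mu (h : R) : log_normalizer T mu h%:M = cgf mu (coord T) h.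
Proof. by rewrite /log_normalizer partition_functionE cgfE. Qed.

Lemma exp_formE mu (h : R) nu : exp_form T mu h%:M nu <->
  (laplace mu (coord T) h < +oo)%E /\ forall A, measurable A ->
    nu A = (\int[mu]_(x in A) (expR (h * coord T x - cgf mu (coord T) h))%:E)%E.
Proof.
rewrite /exp_form /natural_domain/= partition_functionE log_normalizerE.
by under eq_forall => A do under eq_integral do
  rewrite /pairing mxE big_ord1 mxE eqxx mulr1n mulrC.
Qed.

Section base_point.
Variables (mu : {measure set X -> \bar R}) (th0 : R) (nu0 : probability X R).
Hypothesis nu0E : exp_form T mu th0%:M nu0.

Let dens0 A : measurable A ->
  nu0 A = (\int[mu]_(x in A) (expR (th0 * coord T x - cgf mu (coord T) th0))%:E)%E.
Proof. by move: nu0E => /exp_formE[_]; exact. Qed.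

(** The member [nu0] has density exp (th0 t - cgf th0) against [mu]; taking it as base measure
    translates the parameter by [th0] and divides by the normalizer. *)
Lemma laplace_base h : laplace nu0 (coord T) h =
  ((expR (- cgf mu (coord T) th0))%:E * laplace mu (coord T) (th0 + h))%E.
Proof.
rewrite /laplace (@ge0_integral_density _ _ _ mu nu0 _ _ _ dens0 setT)//.
- rewrite -ge0_integralZl; last 4 first.
  + exact: measurableT.
  + by apply/measurable_EFinP; exact: measurable_expR_lin.
  + by move=> x _; rewrite lee_fin expR_ge0.
  + by rewrite lee_fin expR_ge0.
  + apply: eq_integral => x _; rewrite -!EFinM -!expRD.
    move: (cgf _ _ _) => u; congr (expR _)%:E; ring.
- exact: measurable_tilt.
- by apply/measurable_EFinP; exact: measurable_expR_lin.
Qed.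

Lemma laplace_base_lty h :
  (laplace nu0 (coord T) h < +oo)%E <-> (laplace mu (coord T) (th0 + h) < +oo)%E.
Proof.
have := laplace_gt0 nu0 h mt; rewrite laplace_base.
case: (laplace mu (coord T) (th0 + h)).
- by move=> r _; rewrite -EFinM !ltry.
- by rewrite gt0_muley ?lte_fin ?expR_gt0//.
- by rewrite gt0_muleNy ?lte_fin ?expR_gt0//.
Qed.

Lemma cgf_base h : (laplace mu (coord T) (th0 + h) < +oo)%E ->
  cgf nu0 (coord T) h = cgf mu (coord T) (th0 + h) - cgf mu (coord T) th0.
Proof.
move=> fh; have := fine_laplace_gt0 mt ((laplace_base_lty h).2 fh).
rewrite (cgfE nu0) [X in _ = X - _]cgfE laplace_base (laplaceK fh) -EFinM/= => h1.
have h2 : 0 < fine (laplace mu (coord T) (th0 + h)).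
  by move: h1; rewrite pmulr_rgt0 ?expR_gt0.
by rewrite lnM ?posrE ?expR_gt0// expRK addrC.
Qed.

(** Replaces the arbitrary base measure of a realization by a probability measure, for which
    transforms are positive and the cumulant generating function vanishes at 0. *)
Lemma exp_form_tilt h nu : exp_form T mu (th0 + h)%:M nu <-> tilt nu0 (coord T) h nu.
Proof.
suff E (A : set X) : (laplace mu (coord T) (th0 + h) < +oo)%E -> measurable A ->
    (\int[nu0]_(x in A) (expR (h * coord T x - cgf nu0 (coord T) h))%:E =
     \int[mu]_(x in A) (expR ((th0 + h) * coord T x - cgf mu (coord T) (th0 + h)))%:E)%E.
  split=> [/exp_formE|] -[h1 h2].
  - split; first exact: (laplace_base_lty h).2 h1.
    move=> A mA; exact: etrans (h2 A mA) (esym (E A h1 mA)).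
  - have h1' := (laplace_base_lty h).1 h1; apply/exp_formE; split; first exact: h1'.
    move=> A mA; exact: etrans (h2 A mA) (E A h1' mA).
move=> fh mA; rewrite (@ge0_integral_density _ _ _ mu nu0 _ _ _ dens0)//.
- apply: eq_integral => x _; rewrite -EFinM -expRD cgf_base//.
  move: (cgf _ _ _) (cgf _ _ _) => u v; congr (expR _)%:E; ring.
- exact: measurable_tilt.
- by apply/measurable_EFinP/measurable_funTS; exact: measurable_tilt.
Qed.

End base_point.
End order_one_realization.

Lemma continuous_scalar_mx1 (R : realType) : continuous (fun x : R => x%:M : 'M[R]_1).
Proof.
have -> : (fun x : R => x%:M : 'M[R]_1) = (fun x => x *: (1%:M : 'M[R]_1)).
  by apply/funext => x; rewrite scalemx1.
by move=> x; apply: cvgZr_tmp; exact: cvg_id.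
Qed.

Lemma continuous_affine_mx1 (R : realType) (a b : R) :
  continuous (fun v : 'M[R]_1 => a *: v + b%:M).
Proof.
move=> v.
have h1 : (a *: w : 'M[R]_1) @[w --> v] --> (a *: v : 'M[R]_1).
  exact: scaler_continuous.
have h2 : (b%:M : 'M[R]_1) @[_ --> v] --> (b%:M : 'M[R]_1).
  exact: (@cst_continuous _ _ (b%:M : 'M[R]_1) v).
exact: (@cvgD R 'M[R]_1 _ _ (nbhs_filter v) _ _ _ _ h1 h2).
Qed.

Section order_one_family.
Context {R : realType} (c : category) (X : sampleSpace R).
Hypothesis cX : in_category c X.
Implicit Types (P : set (probability X R)) (mu : {measure set X -> \bar R})
  (T : X -> 'rV[R]_1) (nu : probability X R).

Definition two_members P := exists nu1 nu2, [/\ P nu1, P nu2 &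
  exists2 A : set X, measurable A & nu1 A <> nu2 A].

Lemma coord_measurable T : ok_stat X T -> measurable_fun setT (coord T).
Proof. exact: (ok_stat_measurable cX). Qed.

(* A one-element family is realized in dimension 0 by its element. *)
Lemma order_one_two_members P : exponential_family P -> has_order P 1 -> two_members P.
Proof.
move=> [[nu0 Pnu0] okP _] [T [mu [_ minT]]]; apply: contrapT => no2.
have same nu : P nu -> forall A, measurable A -> nu A = nu0 A.
  move=> Pnu A mA; apply: contrapT => ne; apply: no2.
  by exists nu, nu0; split => //; exists A.
suff : realization (fun _ : X => 0 : 'rV[R]_0) P nu0 by move=> /minT.
split; [exact: ok_stat_cst cX _ _|exact: okP|].
move=> nu Pnu; exists 0.
have Z1 : partition_function (fun _ : X => 0 : 'rV[R]_0) nu0 0 = 1%E.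
  rewrite /partition_function; under eq_integral do rewrite /pairing mulmx0 mxE expR0.
  by rewrite integral_cst// mul1e [LHS]probability_setT.
split; first by rewrite /natural_domain/= Z1 ltry.
move=> A mA; rewrite /log_normalizer Z1/= ln1.
under eq_integral do rewrite /pairing mulmx0 mxE subr0 expR0.
by rewrite integral_cst// mul1e same.
Qed.

Lemma realization_coord P T mu nu : realization T P mu -> P nu ->
  exists th, exp_form T mu th%:M nu.
Proof.
by move=> [_ _ /(_ nu)] /[apply] -[th]; rewrite (scalar_mx11 th) => ?; exists (th 0 0).
Qed.

Lemma two_members_other P nu0 : two_members P -> exists2 nu, P nu &
  exists2 A : set X, measurable A & nu A <> nu0 A.
Proof.
move=> [nu1 [nu2 [P1 P2 [A mA ne]]]].
have [e1|e1] := pselect (nu1 A = nu0 A); last by exists nu1 => //; exists A.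
by exists nu2 => //; exists A => // e2; apply: ne; rewrite e1 e2.
Qed.

(** Since [mu] is an arbitrary measure, positivity has to come from the member: its total mass 1 is
    the transform of [mu] at [th] times a positive number. *)
Lemma exp_form_laplace_gt0 T mu th nu : measurable_fun setT (coord T) ->
  exp_form T mu th%:M nu -> 0 < fine (laplace mu (coord T) th).
Proof.
move=> mt e; have := laplace_base mt e 0; rewrite addr0 laplace0.
have [fth _] := (exp_formE T mu th nu).1 e.
rewrite (laplaceK fth) -EFinM => -[] E.
have : 0 < expR (- cgf mu (coord T) th) * fine (laplace mu (coord T) th) by rewrite -E.
by rewrite pmulr_rgt0 ?expR_gt0.
Qed.

Lemma natural_domainE T mu (h : R) : measurable_fun setT (coord T) ->
  natural_domain T mu h%:M <-> (laplace mu (coord T) h < +oo)%E.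
Proof. by move=> mt; rewrite /natural_domain/= partition_functionE. Qed.

Lemma natural_parameter P T mu (th : R) : regular_via P T mu ->
  (laplace mu (coord T) th < +oo)%E -> exists2 nu, P nu & exp_form T mu th%:M nu.
Proof.
move=> [[[oT _ _] _] eqP _] fh.
by have := (natural_domainE mu th (coord_measurable oT)).2 fh; rewrite -eqP.
Qed.

(* The affine relation is read off from the logarithm of a density between two
   members. *)
Lemma realization_affine P T mu T' mu' nu0 th0 th0' : two_members P -> P nu0 ->
  realization T P mu -> realization T' P mu' ->
  exp_form T mu th0%:M nu0 -> exp_form T' mu' th0'%:M nu0 ->
  exists a b, a != 0 /\ {ae nu0, forall x, coord T' x = a * coord T x + b}.
Proof.
move=> P2 P0 rT rT' e0 e0'; have [oT _ _] := rT; have [oT' _ _] := rT'.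
have mt := coord_measurable oT; have mt' := coord_measurable oT'.
have [nu Pnu [A mA ne]] := two_members_other nu0 P2.
have [th] := realization_coord rT Pnu; rewrite -[th](subrKC th0).
move=> /((exp_form_tilt mt e0 _ _).1) th1.
have [th'] := realization_coord rT' Pnu; rewrite -[th'](subrKC th0').
move=> /((exp_form_tilt mt' e0' _ _).1) th2.
set h := th - th0 in th1; set h' := th' - th0' in th2.
have h_neq0 : h != 0 by apply/eqP => h0; apply: ne; move: th1; rewrite h0 => /tilt0; exact.
have h'_neq0 : h' != 0 by apply/eqP => h0; apply: ne; move: th2; rewrite h0 => /tilt0; exact.
exists (h / h'), ((cgf nu0 (coord T') h' - cgf nu0 (coord T) h) / h').
split; first by rewrite mulf_neq0 ?invr_eq0.
apply: filterS (tilt_affine_ae mt mt' th1 th2) => x.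
move: (cgf _ _ _) (cgf _ _ _) => u v E.
have -> : coord T' x = (h * coord T x - v + u) / h' by rewrite E subrK mulrC mulKf.
by field.
Qed.

(** Regularity and constancy of the curvature are each assumed for some minimal realization; this
    brings them to the same one. Finiteness of the transform is invariant under affine changes of
    the statistic, so the natural domains correspond under an affine map. *)
Lemma regular_via_transfer P T mu T' mu' : two_members P -> regular_via P T mu ->
  minimal_realization P T' mu' -> regular_via P T' mu'.
Proof.
move=> P2 rv mr'; have [mr eqP oP] := rv; have [rT _] := mr; have [rT' _] := mr'.
have [nu0 [_ [P0 _ _]]] := P2.
have [oT _ _] := rT; have [oT' _ _] := rT'.
have mt := coord_measurable oT; have mt' := coord_measurable oT'.
have [th0 e0] := realization_coord rT P0; have [th0' e0'] := realization_coord rT' P0.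
have [a [b [a0 t'E]]] := realization_affine P2 P0 rT rT' e0 e0'.
(* The law with parameter th0' + h for T' has parameter th0 + a h for T. *)
pose f (th : 'cV[R]_1) : 'cV[R]_1 := (th0 + a * (th 0 0 - th0'))%:M.
have natE th : natural_domain T' mu' th <-> natural_domain T mu (f th).
  have h1 := natural_domainE mu' (th 0 0) mt'.
  rewrite -scalar_mx11 in h1; apply: (iff_trans h1).
  have h2 := laplace_base_lty mt' e0' (th 0 0 - th0').
  rewrite subrKC in h2; apply: (iff_trans (iff_sym h2)).
  apply: (iff_trans (laplace_affine_lty mt mt' t'E _)).
  apply: (iff_trans (laplace_base_lty mt e0 _)).
  exact: (iff_sym (natural_domainE mu _ mt)).
have parE : parameter_set T' P mu' = natural_domain T' mu'.
  apply/seteqP; split=> [th [nu _ [h _]] //|th nth].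
  have := (natE th).1 nth; rewrite -eqP => -[nu Pnu e1].
  have h1 := (exp_form_tilt mt e0 _ _).1 e1.
  have h2 := (tilt_affine mt mt' t'E _ _).2 h1.
  have := (exp_form_tilt mt' e0' _ _).2 h2.
  by rewrite subrKC -scalar_mx11 => h3; exists nu.
split => //; rewrite parE.
have -> : natural_domain T' mu' = f @^-1` natural_domain T mu.
  by apply/seteqP; split => th h; [exact: (natE th).1 h|exact: (natE th).2 h].
apply: open_comp; last by rewrite -eqP.
move=> th _; rewrite /f; apply: (@continuous_comp _ _ _ (fun th : 'cV[R]_1 => th 0 0)
   (fun x : R => (th0 + a * (x - th0'))%:M : 'cV[R]_1)).
  exact: coord_continuous.
apply: (@continuous_comp _ _ _ (fun x : R => th0 + a * (x - th0'))
  (fun x : R => x%:M : 'cV[R]_1)).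
  by apply: cvgD; [exact: cvg_cst|apply: cvgM; [exact: cvg_cst|
    apply: cvgB; [exact: cvg_id|exact: cvg_cst]]].
exact: continuous_scalar_mx1.
Qed.

(** The parameter becomes th / a, and the constant factor exp (th b / a) is absorbed by the
    normalizer, so the base measure remains [mu]. *)
Lemma affine_realization P T mu a b : a != 0 -> minimal_realization P T mu ->
  minimal_realization P (fun x => a *: T x + b%:M) mu.
Proof.
move=> a0 [rT minT]; split; last exact: minT.
have [oT oM _] := rT.
pose T' : X -> 'rV[R]_1 := fun x => a *: T x + b%:M.
have oT' : ok_stat X T'.
  have := @ok_stat_comp R c X cX 1 1 T (fun v => a *: v + b%:M).
  move=> /(_ _ oT); apply; exact: continuous_affine_mx1.
have mt := coord_measurable oT; have mt' := coord_measurable oT'.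
split; [exact: oT'|exact: oM|move=> nu Pnu]; have [th eth] := realization_coord rT Pnu.
have coordE x : coord T' x = a * coord T x + b.
  by rewrite /coord /T' !mxE eqxx mulr1n.
exists (th / a)%:M.
have [fth nuE] := (exp_formE T mu th nu).1 eth.
have Z0 := exp_form_laplace_gt0 mt eth.
have lE : laplace mu (coord T') (th / a) = ((expR (th / a * b))%:E * laplace mu (coord T) th)%E.
  rewrite /laplace -ge0_integralZl; last 4 first.
  - exact: measurableT.
  - by apply/measurable_EFinP; exact: measurable_expR_lin.
  - by move=> x _; rewrite lee_fin expR_ge0.
  - by rewrite lee_fin expR_ge0.
  apply: eq_integral => x _; rewrite -EFinM -expRD coordE.
  by congr (expR _)%:E; field.
have cE : cgf mu (coord T') (th / a) = th / a * b + cgf mu (coord T) th.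
  rewrite !cgfE lE (laplaceK fth) -EFinM/= lnM ?posrE ?expR_gt0 ?expRK//.
apply/exp_formE; split; first by rewrite lE (laplaceK fth) -EFinM ltry.
move=> A mA; apply: (etrans (nuE A mA)); apply: eq_integral => x _.
rewrite cE coordE; move: (cgf _ _ _) => u; congr (expR _)%:E; by field.
Qed.

End order_one_family.

(** * Cumulants and constant Hessian sectional curvature *)

Section cumulants.
Context {R : realType} d (X : measurableType d).
Variables (mu : {measure set X -> \bar R}) (t : X -> R) (a b : R).
Hypothesis mt : measurable_fun setT t.
Hypothesis Zfin : forall h, a < h < b -> (laplace mu t h < +oo)%E.
Hypothesis Zpos : forall h, a < h < b -> 0 < fine (laplace mu t h).

Local Notation F := (exp_moment mu t).

Let is_derive_F n h : a < h < b -> is_derive h 1 (F n) (F n.+1 h).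
Proof.
move=> /andP[ah hb].
apply: (@is_derive_exp_moment _ _ _ _ _ mt n ((a + h) / 2) ((h + b) / 2)).
- by apply: Zfin; lra.
- by apply: Zfin; lra.
- by lra.
Qed.

Let F0_gt0 h : a < h < b -> 0 < F 0 h.
Proof. by move=> hab; rewrite -fine_laplace Zpos. Qed.

Definition ratio n h := F n h / F 0 h.

Let is_derive_ratio n h : a < h < b ->
  is_derive h 1 (ratio n) (ratio n.+1 h - ratio n h * ratio 1 h).
Proof.
move=> hab; have h1 := is_derive_F n hab; have h2 := is_derive_F 0 hab.
have F0 : F 0 h != 0 by rewrite gt_eqF// F0_gt0.
have h3 := is_derive_inv_comp h2 F0.
apply: (is_derive_eq (is_deriveM h1 h3)).
by rewrite /ratio /GRing.scale/=; field.
Qed.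

(** Mean and variance of the tilted law, as explicit polynomials in normalized moments. In this form
    the first four derivatives of [cgf] follow from the single rule [is_derive_ratio]. *)
Definition cgf1 h := ratio 1 h.
Definition cgf2 h := ratio 2 h - ratio 1 h ^+ 2.
Let cgf3 h := ratio 3 h - 3 * ratio 1 h * ratio 2 h + 2 * ratio 1 h ^+ 3.
Let cgf4 h := ratio 4 h - ratio 3 h * ratio 1 h
  - 3 * (cgf2 h * ratio 2 h + ratio 1 h * (ratio 3 h - ratio 2 h * ratio 1 h))
  + 6 * ratio 1 h ^+ 2 * cgf2 h.

Lemma is_derive_cgf h : a < h < b -> is_derive h 1 (cgf mu t) (cgf1 h).
Proof.
move=> hab; have h1 := is_derive_F 0 hab.
have -> : cgf mu t = fun h => ln (F 0 h).
  by apply/funext => y; rewrite cgfE fine_laplace.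
exact: (is_derive_eq (is_derive_ln_comp h1 (F0_gt0 hab))).
Qed.

Lemma is_derive_cgf1 h : a < h < b -> is_derive h 1 cgf1 (cgf2 h).
Proof.
move=> hab; apply: (is_derive_eq (is_derive_ratio 1 hab)).
by rewrite /cgf2 expr2.
Qed.

Let is_derive_cgf2 h : a < h < b -> is_derive h 1 cgf2 (cgf3 h).
Proof.
move=> hab; have h1 := is_derive_ratio 1 hab; have h2 := is_derive_ratio 2 hab.
apply: is_derive_eq; rewrite /GRing.scale/= /cgf3; ring.
Qed.

Let is_derive_cgf3 h : a < h < b -> is_derive h 1 cgf3 (cgf4 h).
Proof.
move=> hab; have h1 := is_derive_ratio 1 hab; have h2 := is_derive_ratio 2 hab.
have h3 := is_derive_ratio 3 hab.
apply: is_derive_eq; rewrite /GRing.scale/= /cgf4 /cgf2; ring.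
Qed.

Lemma near_itvoo h : a < h < b -> \forall y \near h, a < y < b.
Proof.
move=> hab; have : h \in `]a, b[ by rewrite in_itv.
by move=> /near_in_itvoo; apply: filterS => y; rewrite in_itv.
Qed.

Lemma derive1_cgf h : a < h < b -> (cgf mu t)^`()%classic h = cgf1 h.
Proof. by move=> /is_derive_cgf/is_derive_derive1. Qed.

Lemma derive2_cgf h : a < h < b -> (cgf mu t)^`(2)%classic h = cgf2 h.
Proof.
move=> hab; apply: near_is_derive_derive2.
  by apply: filterS (near_itvoo hab) => y; exact: is_derive_cgf.
by apply: filterS (near_itvoo hab) => y; exact: is_derive_cgf1.
Qed.

(* With V the variance as a function of the mean, [(log g)' = V' o mean], so a
   constant [(log g)'' / g] says that V'' is constant. *)
Lemma quadratic_variance c :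
  (forall h, a < h < b -> 0 < cgf2 h) ->
  (forall h, a < h < b ->
    ((fun s => ln ((cgf mu t)^`(2)%classic s))^`(2))%classic h
      / (2 * (cgf mu t)^`(2)%classic h) = c) ->
  exists p q, forall h, a < h < b -> cgf2 h = c * cgf1 h ^+ 2 + p * cgf1 h + q.
Proof.
move=> g0 hc; have [ab|ba] := ltP a b; last first.
  by exists 0, 0 => h /andP[h1 h2]; have := lt_trans h1 h2; rewrite ltNge ba.
(* L is (log g)'. The hypothesis reads L' = 2 c g, and g is the derivative of the mean, so L - 2 c
   (mean) is constant; the equation g' = L g is then integrated once more. *)
pose L h := cgf3 h / cgf2 h.
have dL h : a < h < b -> is_derive h 1 L (2 * c * cgf2 h).
  move=> hab; have g_neq0 : cgf2 h != 0 by rewrite gt_eqF// g0.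
  have h2 := is_derive_cgf2 hab; have h3 := is_derive_cgf3 hab.
  have dL0 y : a < y < b -> is_derive (y : R) 1 (fun s => ln (cgf2 s)) (L y).
    by move=> yab; exact: is_derive_ln_comp (is_derive_cgf2 yab) (g0 _ yab).
  have dL1 y : a < y < b -> is_derive (y : R) 1 L (cgf4 y / cgf2 y - L y ^+ 2).
    move=> yab; have gy : cgf2 y != 0 by rewrite gt_eqF// g0.
    have k1 := is_derive_cgf3 yab; have k2 := is_derive_inv_comp (is_derive_cgf2 yab) gy.
    apply: (is_derive_eq (is_deriveM k1 k2)).
    by rewrite /L /GRing.scale/=; field.
  apply: (is_derive_eq (dL1 _ hab)).
  have gE : (cgf mu t)^`(2)%classic h = cgf2 h by exact: derive2_cgf.
  have : ((fun s => ln ((cgf mu t)^`(2)%classic s))^`(2))%classic h =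
      cgf4 h / cgf2 h - L h ^+ 2.
    apply: (@near_is_derive_derive2 _ _ L (fun y => cgf4 y / cgf2 y - L y ^+ 2)); last first.
      by apply: filterS (near_itvoo hab) => y; exact: dL1.
    near=> y; have yab : a < y < b by near: y; exact: near_itvoo.
    apply: near_eq_is_derive (dL0 y yab).
    by apply: filterS (near_itvoo yab) => z zab; rewrite derive2_cgf.
  move=> <-; rewrite -(hc _ hab) gE; field.
  by rewrite g_neq0.
pose m := (a + b) / 2; have mab : a < m < b by rewrite /m; lra.
pose p := L m - 2 * c * cgf1 m.
have LE h : a < h < b -> L h = 2 * c * cgf1 h + p.
  move=> hab; have ex y : a < y < b -> is_derive (y : R) 1 (fun h => L h - 2 * c * cgf1 h) 0.
    move=> yab; have k1 := dL _ yab; have k2 := is_derive_cgf1 yab.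
    by apply: is_derive_eq; rewrite /GRing.scale/=; ring.
  by have := is_derive_eq_const ex hab mab; rewrite -/p => <-; ring.
pose q := cgf2 m - c * cgf1 m ^+ 2 - p * cgf1 m.
exists p, q => h hab.
have ex y : a < y < b -> is_derive (y : R) 1 (fun h => cgf2 h - c * cgf1 h ^+ 2 - p * cgf1 h) 0.
  move=> yab; have k1 := is_derive_cgf2 yab; have k2 := is_derive_cgf1 yab.
  apply: is_derive_eq; rewrite /GRing.scale/=.
  have gy : cgf2 y != 0 by rewrite gt_eqF// g0.
  have -> : cgf3 y = L y * cgf2 y by rewrite /L divfK.
  by rewrite LE//; ring.
by have := is_derive_eq_const ex hab mab; rewrite -/q => <-; ring.
Unshelve. all: by end_near. Qed.

End cumulants.


(** The image measure with its change of variables formula, packed so that the measurability proof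
    stays out of sight in later statements. *)
Lemma exists_pushforward {R : realType} d1 d2 (X : measurableType d1)
    (Y : measurableType d2) (f : X -> Y) (m : {measure set X -> \bar R}) :
  measurable_fun setT f ->
  exists2 m' : {measure set Y -> \bar R}, (forall A, m' A = m (f @^-1` A)) &
    forall (g : Y -> \bar R) (D : set Y), measurable D -> measurable_fun setT g ->
      (forall y, (0 <= g y)%E) ->
      (\int[m']_(y in D) g y = \int[m]_(x in f @^-1` D) g (f x))%E.
Proof.
move=> mf.
exists (measure_function_pushforward__canonical__measure_function_Measure m mf) => // g D mD mg g0.
by rewrite (ge0_integral_pushforward mf)//; exact: measurable_funTS.
Qed.

Section mean_variance.
Context {R : realType} d (X : measurableType d).
Variables (mu : {measure set X -> \bar R}) (t : X -> R) (a b th : R).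
Hypothesis mt : measurable_fun setT t.
Hypotheses (Za : (laplace mu t a < +oo)%E) (Zb : (laplace mu t b < +oo)%E).
Hypotheses (ath : a < th < b) (Zth : 0 < fine (laplace mu t th)).
Variable nu : probability X R.
Hypothesis nuE : forall A, measurable A ->
  nu A = (\int[mu]_(x in A) (expR (th * t x - cgf mu t th))%:E)%E.

Let integrable_moment n :
  mu.-integrable setT (fun x => (t x ^+ n * expR (th * t x))%:E).
Proof. exact: (exp_moment_integrable mt n Za Zb ath). Qed.

Let integral_moment n :
  (\int[mu]_x (t x ^+ n * expR (th * t x))%:E = (exp_moment mu t n th)%:E)%E.
Proof. by rewrite fineK// integrable_fin_num. Qed.

Let expR_cgf : expR (- cgf mu t th) = (exp_moment mu t 0 th)^-1.
Proof. by rewrite expRN cgfE lnK ?posrE// fine_laplace. Qed.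

Let F0_neq0 : exp_moment mu t 0 th != 0.
Proof. by rewrite -fine_laplace gt_eqF. Qed.

Let integral_nu (g : X -> R) : measurable_fun setT g ->
  (\int[nu]_x (g x)%:E = \int[mu]_x (g x * expR (th * t x - cgf mu t th))%:E)%E.
Proof.
move=> mg; apply: (integral_density _ _ nuE mg); first exact: measurable_tilt.
by move=> x; exact: expR_ge0.
Qed.

Lemma tilted_mean : expectation nu t = (cgf1 mu t th)%:E.
Proof.
rewrite unlock integral_nu//.
under eq_integral do rewrite expRD expR_cgf mulrA EFinM.
rewrite integralZr//; last by have := integrable_moment 1; under eq_fun do rewrite expr1.
by have := integral_moment 1; under eq_integral do rewrite expr1; move=> ->.
Qed.

Let centered_integral m : (\int[nu]_x ((t x - m) ^+ 2)%:E =
  ((exp_moment mu t 2 th - 2 * m * exp_moment mu t 1 th + m ^+ 2 * exp_moment mu t 0 th)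
    / exp_moment mu t 0 th)%:E)%E.
Proof.
rewrite integral_nu; last by apply: measurable_funX; exact: measurable_funB.
have E x : ((t x - m) ^+ 2 * expR (th * t x - cgf mu t th))%:E =
    ((exp_moment mu t 0 th)^-1%:E * (((t x ^+ 2 * expR (th * t x))%:E +
     (- (2 * m))%:E * (t x ^+ 1 * expR (th * t x))%:E) +
     (m ^+ 2)%:E * (t x ^+ 0 * expR (th * t x))%:E))%E.
  by rewrite expRD expR_cgf; apply: (congr1 EFin); ring.
under eq_integral do rewrite E.
have i1 := integrableZl measurableT (- (2 * m)) (integrable_moment 1).
have i0 := integrableZl measurableT (m ^+ 2) (integrable_moment 0).
have i2 := integrableD measurableT (integrable_moment 2) i1.
rewrite integralZl//; last exact: integrableD.
rewrite integralD// integralD// !integralZl// !integral_moment.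
by apply: (congr1 EFin); ring.
Qed.

Lemma tilted_square : (\int[nu]_x ((t x - cgf1 mu t th) ^+ 2)%:E = (cgf2 mu t th)%:E)%E.
Proof.
by rewrite centered_integral; congr EFin; rewrite /cgf1 /cgf2 /ratio; field.
Qed.

Lemma tilted_variance : variance nu t = (cgf2 mu t th)%:E.
Proof.
rewrite /variance unlock tilted_mean/= unlock -tilted_square.
by apply: eq_integral => x _; rewrite expr2.
Qed.

Lemma cgf2_eq0 : cgf2 mu t th <= 0 -> {ae nu, forall x, t x = cgf1 mu t th}.
Proof.
move=> V0; have V : (\int[nu]_x `|((t x - cgf1 mu t th) ^+ 2)%:E| = 0)%E.
  apply/eqP; rewrite eq_le integral_ge0// andbT.
  under eq_integral do rewrite gee0_abs ?lee_fin ?sqr_ge0//.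
  by rewrite tilted_square lee_fin.
have mE : measurable_fun setT (fun x => ((t x - cgf1 mu t th) ^+ 2)%:E).
  by apply/measurable_EFinP; apply: measurable_funX; exact: measurable_funB.
move/(ae_eq_integral_abs nu measurableT mE): V; apply: filterS => x /(_ I)[].
by move/eqP; rewrite sqrf_eq0 subr_eq0 => /eqP.
Qed.

End mean_variance.

(* The difference of the means solves a linear equation [d' = (c (k1 + k2) + p)' d]
   in which the k's are the cumulants. *)
Lemma cumulant_unique {R : realType} (k1 k2 m1 m2 : R -> R) (c p q e : R) :
  (forall h : R, - e < h < e -> is_derive h 1 k1 (m1 h)) ->
  (forall h : R, - e < h < e -> is_derive h 1 k2 (m2 h)) ->
  (forall h : R, - e < h < e -> is_derive h 1 m1 (c * m1 h ^+ 2 + p * m1 h + q)) ->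
  (forall h : R, - e < h < e -> is_derive h 1 m2 (c * m2 h ^+ 2 + p * m2 h + q)) ->
  k1 0 = k2 0 -> m1 0 = m2 0 -> forall h, - e < h < e -> m1 h = m2 h /\ k1 h = k2 h.
Proof.
move=> dk1 dk2 dm1 dm2 k0 m0.
pose E (k : R) := expR (- (c * (k1 k + k2 k) + p * k)).
have zero h : - e < h < e -> - e < 0 < e by move=> /andP[h1 h2]; rewrite oppr_lt0; lra.
have dm k : - e < k < e -> m1 k = m2 k.
  move=> ke; have ex y : - e < y < e -> is_derive (y : R) 1 (fun k => (m1 k - m2 k) * E k) 0.
    move=> ye; have h1 := dk1 _ ye; have h2 := dk2 _ ye.
    have l1 := dm1 _ ye; have l2 := dm2 _ ye.
    have dE : is_derive (y : R) 1 E (- (c * (m1 y + m2 y) + p) * E y).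
      apply: is_derive_expR_comp; apply: is_derive_eq.
      by rewrite /GRing.scale/=; ring.
    apply: is_derive_eq; rewrite /GRing.scale/=; ring.
  have := is_derive_eq_const ex ke (zero _ ke).
  rewrite m0 subrr mul0r => /eqP; rewrite mulf_eq0 subr_eq0 => /orP[/eqP//|].
  by rewrite expR_eq0.
move=> h he; split; first exact: dm.
have ex y : - e < y < e -> is_derive (y : R) 1 (fun k => k1 k - k2 k) 0.
  move=> ye; have h1 := dk1 _ ye; have h2 := dk2 _ ye.
  by apply: is_derive_eq; rewrite dm// subrr.
have := is_derive_eq_const ex he (zero _ he).
by rewrite k0 subrr => /eqP; rewrite subr_eq0 => /eqP.
Qed.

(** * Laws determined by a quadratic variance function and a mean *)

Section cgf_uniqueness.
Context {R : realType} d1 (X1 : measurableType d1) d2 (X2 : measurableType d2).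
Variables (nu1 : probability X1 R) (nu2 : probability X2 R).
Variables (t1 : X1 -> R) (t2 : X2 -> R) (c p q e : R).
Hypotheses (mt1 : measurable_fun setT t1) (mt2 : measurable_fun setT t2).
Hypotheses (e0 : 0 < e).
Hypothesis Z1 : forall h, - e < h < e -> (laplace nu1 t1 h < +oo)%E.
Hypothesis Z2 : forall h, - e < h < e -> (laplace nu2 t2 h < +oo)%E.
Hypothesis V1 : forall h, - e < h < e ->
  cgf2 nu1 t1 h = c * cgf1 nu1 t1 h ^+ 2 + p * cgf1 nu1 t1 h + q.
Hypothesis V2 : forall h, - e < h < e ->
  cgf2 nu2 t2 h = c * cgf1 nu2 t2 h ^+ 2 + p * cgf1 nu2 t2 h + q.
Hypothesis m12 : cgf1 nu1 t1 0 = cgf1 nu2 t2 0.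

Lemma laplace_eq_of_variance h : - e < h < e -> laplace nu1 t1 h = laplace nu2 t2 h.
Proof.
have P1 k : - e < k < e -> 0 < fine (laplace nu1 t1 k).
  by move=> ke; rewrite fine_laplace_gt0// Z1.
have P2 k : - e < k < e -> 0 < fine (laplace nu2 t2 k).
  by move=> ke; rewrite fine_laplace_gt0// Z2.
move=> he; have [] := @cumulant_unique R (cgf nu1 t1) (cgf nu2 t2) (cgf1 nu1 t1) (cgf1 nu2 t2)
  c p q e _ _ _ _ _ m12 h he.
- by move=> k ke; have := is_derive_cgf mt1 Z1 P1 ke.
- by move=> k ke; have := is_derive_cgf mt2 Z2 P2 ke.
- by move=> k ke; rewrite -V1//; have := is_derive_cgf1 mt1 Z1 P1 ke.
- by move=> k ke; rewrite -V2//; have := is_derive_cgf1 mt2 Z2 P2 ke.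
- by rewrite !cgfE !laplace0.
rewrite !cgfE => _ /ln_inj; rewrite !posrE P1// P2// => /(_ isT isT) E12.
by rewrite (laplaceK (Z1 he)) (laplaceK (Z2 he)) E12.
Qed.

Lemma law_eq_of_variance (A : set (measurableTypeR R)) : measurable A ->
  nu1 (t1 @^-1` A) = nu2 (t2 @^-1` A).
Proof.
have mexp h : measurable_fun setT (fun y : measurableTypeR R => (expR (h * y))%:E).
  by apply/measurable_EFinP; apply: measurable_expR_lin; exact: measurable_id.
have exp0 h (y : measurableTypeR R) : (0 <= (expR (h * y))%:E)%E.
  by rewrite lee_fin expR_ge0.
have [l1 l1E I1] :=
  @exists_pushforward R _ _ X1 (measurableTypeR R) t1 nu1 mt1.
have [l2 l2E I2] :=
  @exists_pushforward R _ _ X2 (measurableTypeR R) t2 nu2 mt2.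
have L1 h : laplace l1 id h = laplace nu1 t1 h.
  by rewrite /laplace (I1 _ _ measurableT (mexp h) (exp0 h)).
have L2 h : laplace l2 id h = laplace nu2 t2 h.
  by rewrite /laplace (I2 _ _ measurableT (mexp h) (exp0 h)).
move=> mA; rewrite -l1E -l2E; apply: (@laplace_inj R l1 l2 e e0 _ _ A mA).
- by move=> h; rewrite ltr_norml => he; rewrite L1; exact: Z1.
- by move=> h; rewrite ltr_norml => he; rewrite L1 L2; exact: laplace_eq_of_variance.
Qed.

End cgf_uniqueness.

Section quadratic_variance_at.
Context {R : realType}.

(** The coefficients of the variance function on a neighbourhood of [th]. Finiteness and positivity
    of the transform are included because [mu] is an arbitrary measure. *)
Definition variance_at d (X : measurableType d) (mu : {measure set X -> \bar R})
    (t : X -> R) (th c p q : R) :=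
  exists2 e, 0 < e & forall h, th - e < h < th + e ->
    [/\ (laplace mu t h < +oo)%E, 0 < fine (laplace mu t h) &
        cgf2 mu t h = c * cgf1 mu t h ^+ 2 + p * cgf1 mu t h + q].

(** A change of statistic and a change of base measure both have the effect cgf' (h) = cgf (a h + u)
    + b h + v. The mean y becomes a y + b, the variance is multiplied by a^2, and the new
    coefficients are those of a^2 V((y - b) / a). *)
Lemma variance_at_change d (X : measurableType d) (mu : {measure set X -> \bar R})
    (t : X -> R) d' (X' : measurableType d') (mu' : {measure set X' -> \bar R})
    (t' : X' -> R) (th c p q a b u v : R) :
  measurable_fun setT t -> measurable_fun setT t' -> a != 0 ->
  (forall h, (laplace mu t (a * h + u) < +oo)%E -> 0 < fine (laplace mu t (a * h + u)) ->
    [/\ (laplace mu' t' h < +oo)%E, 0 < fine (laplace mu' t' h) &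
        cgf mu' t' h = cgf mu t (a * h + u) + b * h + v]) ->
  variance_at mu t (a * th + u) c p q ->
  cgf1 mu' t' th = a * cgf1 mu t (a * th + u) + b /\
  variance_at mu' t' th c (a * p - 2 * c * b) (a ^+ 2 * q - a * b * p + c * b ^+ 2).
Proof.
move=> mt mt' a0 H [e e0 V].
pose f := e / `|a|.
have a0' : 0 < `|a| by rewrite normr_gt0.
have f0 : 0 < f by rewrite divr_gt0.
have near h : th - f < h < th + f -> a * th + u - e < a * h + u < a * th + u + e.
  move=> hf; have : `|h - th| < f by rewrite ltr_norml; lra.
  rewrite /f ltr_pdivlMr// -normrM mulrBl ltr_norml mulrC [th * _]mulrC; lra.
have Z1 h : th - f < h < th + f -> (laplace mu' t' h < +oo)%E.
  by move=> /near/V[h1 h2 _]; have [] := H _ h1 h2.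
have P1 h : th - f < h < th + f -> 0 < fine (laplace mu' t' h).
  by move=> /near/V[h1 h2 _]; have [] := H _ h1 h2.
have cE h : th - f < h < th + f -> cgf mu' t' h = cgf mu t (a * h + u) + b * h + v.
  by move=> /near/V[h1 h2 _]; have [] := H _ h1 h2.
have Z2 h : a * th + u - e < h < a * th + u + e -> (laplace mu t h < +oo)%E by move=> /V[].
have P2 h : a * th + u - e < h < a * th + u + e -> 0 < fine (laplace mu t h) by move=> /V[].
have dlin k h : is_derive (h : R) 1 (fun h => k * h) k.
  by apply: is_derive_eq; rewrite /GRing.scale/= mulr1.
have daff h : is_derive (h : R) 1 (fun h => a * h + u) a.
  apply: (is_derive_eq (is_deriveD (dlin a h) (is_derive_cst u _ _))).
  by rewrite addr0.
have c1E h : th - f < h < th + f -> cgf1 mu' t' h = a * cgf1 mu t (a * h + u) + b.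
  move=> hf; have := is_derive_cgf mt' Z1 P1 hf => -[_ <-].
  have k1 := is_derive_cgf mt Z2 P2 (near _ hf).
  have k2 := @is_derive1_comp R (cgf mu t) (fun h => a * h + u) _ _ _ k1 (daff h).
  have k3 : is_derive (h : R) 1 (fun h => cgf mu t (a * h + u) + b * h + v)
      (cgf1 mu t (a * h + u) * a + b).
    have k4 := is_deriveD (is_deriveD k2 (dlin b h)) (is_derive_cst v h 1).
    by apply: (is_derive_eq k4); rewrite addr0.
  rewrite [a * _]mulrC; have [_ <-] := k3; apply: near_eq_derive.
  by apply: filterS (near_itvoo hf) => y; exact: cE.
have c2E h : th - f < h < th + f -> cgf2 mu' t' h = a ^+ 2 * cgf2 mu t (a * h + u).
  move=> hf; have := is_derive_cgf1 mt' Z1 P1 hf => -[_ <-].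
  have k1 := is_derive_cgf1 mt Z2 P2 (near _ hf).
  have k2 := @is_derive1_comp R (cgf1 mu t) (fun h => a * h + u) _ _ _ k1 (daff h).
  have k3 : is_derive (h : R) 1 (fun h => a * cgf1 mu t (a * h + u) + b)
      (a ^+ 2 * cgf2 mu t (a * h + u)).
    by apply: is_derive_eq; rewrite /GRing.scale/=; ring.
  have [_ <-] := k3; apply: near_eq_derive.
  by apply: filterS (near_itvoo hf) => y; exact: c1E.
split; first by apply: c1E; lra.
exists f => // h hf; split; [exact: Z1|exact: P1|].
have [_ _ E] := V _ (near _ hf).
by rewrite c2E// E c1E//; ring.
Qed.

Lemma variance_at_affine d (X : measurableType d) (mu : {measure set X -> \bar R})
    (t t' : X -> R) (th c p q a b : R) :
  measurable_fun setT t -> measurable_fun setT t' -> a != 0 ->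
  (forall x, t' x = a * t x + b) -> variance_at mu t (a * th) c p q ->
  cgf1 mu t' th = a * cgf1 mu t (a * th) + b /\
  variance_at mu t' th c (a * p - 2 * c * b) (a ^+ 2 * q - a * b * p + c * b ^+ 2).
Proof.
move=> mt mt' a0 t'E; rewrite -[a * th]addr0.
apply: (@variance_at_change _ _ _ _ _ _ _ _ _ _ _ _ _ _ _ 0) => // h.
rewrite addr0 => h1 h2.
have lE : laplace mu t' h = ((expR (h * b))%:E * laplace mu t (a * h))%E.
  rewrite /laplace -ge0_integralZl; last 4 first.
  - exact: measurableT.
  - by apply/measurable_EFinP; exact: measurable_expR_lin.
  - by move=> x _; rewrite lee_fin expR_ge0.
  - by rewrite lee_fin expR_ge0.
  apply: eq_integral => x _; rewrite -EFinM -expRD t'E.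
  by congr (expR _)%:E; ring.
rewrite !cgfE lE (laplaceK h1) -EFinM ltry/=; split=> //.
  by rewrite mulr_gt0// expR_gt0.
by rewrite lnM ?posrE ?expR_gt0// expRK addr0 addrC [h * b]mulrC.
Qed.

Lemma variance_at_base (X : sampleSpace R) (T : X -> 'rV[R]_1) mu th0 nu0 c p q :
  measurable_fun setT (coord T) -> exp_form T mu th0%:M nu0 ->
  variance_at mu (coord T) th0 c p q ->
  cgf1 nu0 (coord T) 0 = cgf1 mu (coord T) th0 /\ variance_at nu0 (coord T) 0 c p q.
Proof.
move=> mt e0 V.
have change h : (laplace mu (coord T) (1 * h + th0) < +oo)%E ->
    0 < fine (laplace mu (coord T) (1 * h + th0)) ->
    [/\ (laplace nu0 (coord T) h < +oo)%E, 0 < fine (laplace nu0 (coord T) h) &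
      cgf nu0 (coord T) h = cgf mu (coord T) (1 * h + th0) + 0 * h + - cgf mu (coord T) th0].
  rewrite mul1r addrC => h1 h2.
  have h3 := (laplace_base_lty mt e0 h).2 h1.
  split; [exact: h3|exact: fine_laplace_gt0|].
  by rewrite mul0r addr0 (cgf_base mt e0).
have V' : variance_at mu (coord T) (1 * 0 + th0) c p q by rewrite mulr0 add0r.
have [m v] := variance_at_change mt mt (oner_neq0 _) change V'.
move: m v; rewrite mulr0 add0r !mul1r mulr0 addr0 subr0 !mul0r !(mulr0, expr0n, expr1n, mul1r, subr0, addr0)/=.
by move=> ? ?; split.
Qed.

End quadratic_variance_at.

(** * From equal variance functions to equivalence of families *)

Section matching.
Context {R : realType} (c : category).

(** Density and normalizer of a tilt depend only on the law of the statistic. So once one pair of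
    members has the same law, the tilts by the same h have the same law, and regularity of the
    second family makes its tilt a member. *)
Lemma pushforward_laws_sub (X1 X2 : sampleSpace R) P1 T1 mu1 th1 nu1 P2 T2 mu2 th2 nu2 :
  in_category c X1 -> in_category c X2 ->
  realization (X := X1) T1 P1 mu1 -> regular_via (X := X2) P2 T2 mu2 ->
  exp_form T1 mu1 th1%:M nu1 -> exp_form T2 mu2 th2%:M nu2 ->
  (forall A : set (measurableTypeR R), measurable A ->
     nu1 (coord T1 @^-1` A) = nu2 (coord T2 @^-1` A)) ->
  pushforward_laws T1 P1 `<=` pushforward_laws T2 P2.
Proof.
move=> cX1 cX2 r1 rv2 e1 e2 L.
have [oT1 _ _] := r1; have mt1 := coord_measurable cX1 oT1.
have [[[oT2 _ _] _] _ _] := rv2; have mt2 := coord_measurable cX2 oT2.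
have [l1 l1E I1] := @exists_pushforward R _ _ X1 (measurableTypeR R) (coord T1) nu1 mt1.
have [l2 l2E I2] := @exists_pushforward R _ _ X2 (measurableTypeR R) (coord T2) nu2 mt2.
have I12 (g : measurableTypeR R -> \bar R) D : measurable D -> measurable_fun setT g ->
    (forall y, (0 <= g y)%E) -> (\int[nu1]_(x in coord T1 @^-1` D) g (coord T1 x) =
      \int[nu2]_(x in coord T2 @^-1` D) g (coord T2 x))%E.
  move=> mD mg g0; rewrite -(I1 g D mD mg g0) -(I2 g D mD mg g0).
  by apply: eq_measure_integral => A mA _; rewrite l1E l2E; exact: L.
move=> _ [nu Pnu <-]; have [th] := realization_coord r1 Pnu; rewrite -[th](subrKC th1).
move=> /((exp_form_tilt mt1 e1 _ _).1); set h := th - th1 => -[fh nuE].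
have lapE : laplace nu1 (coord T1) h = laplace nu2 (coord T2) h.
  apply: (I12 (fun y => (expR (h * y))%:E) setT measurableT).
  - by apply/measurable_EFinP; apply: measurable_expR_lin; exact: measurable_id.
  - by move=> y; rewrite lee_fin expR_ge0.
have fh2 : (laplace nu2 (coord T2) h < +oo)%E by rewrite -lapE.
have [nu' Pnu' e'] := natural_parameter cX2 rv2 ((laplace_base_lty mt2 e2 h).1 fh2).
have [_ nu'E] := (exp_form_tilt mt2 e2 _ _).1 e'.
exists nu' => //; apply/funext => B; rewrite /pushforward.
set B' := (fun x : R => x%:M : 'rV[R]_1) @^-1` (set_val B : set 'rV[R]_1).
have mB' : measurable (B' : set (measurableTypeR R)).
  apply/borelP; have /= mB := set_valP B.
  by have := @continuous_borel _ _ _ (@continuous_scalar_mx1 R) measurableT _ mB; rewrite setTI.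
have preE (X : sampleSpace R) (T : X -> 'rV[R]_1) : T @^-1` (set_val B) = coord T @^-1` B'.
  by apply/seteqP; split=> x; rewrite /B' /coord/= -scalar_mx11.
have mpre (X : sampleSpace R) (T : X -> 'rV[R]_1) : measurable_fun setT (coord T) ->
    measurable (coord T @^-1` B').
  by move=> /(_ measurableT _ mB'); rewrite setTI.
apply: etrans (congr1 nu' (preE _ T2)) _; apply: etrans (nu'E _ (mpre _ _ mt2)) _.
apply: esym; apply: etrans (congr1 nu (preE _ T1)) _; apply: etrans (nuE _ (mpre _ _ mt1)) _.
have -> : cgf nu1 (coord T1) h = cgf nu2 (coord T2) h by rewrite !cgfE lapE.
apply: (I12 (fun y => (expR (h * y - cgf nu2 (coord T2) h))%:E) B' mB').
- by apply/measurable_EFinP; apply: measurable_tilt; exact: measurable_id.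
- by move=> y; rewrite lee_fin expR_ge0.
Qed.

(** Zero variance would make the statistic almost surely constant, and then no member could differ
    from the one at [h]. *)
Lemma cgf2_gt0 (X : sampleSpace R) P T mu a b h : in_category c X ->
  two_members P -> regular_via (X := X) P T mu ->
  (forall h, a < h < b -> (laplace mu (coord T) h < +oo)%E) -> a < h < b ->
  0 < cgf2 mu (coord T) h.
Proof.
move=> cX P2 rv fin hab; have [[rT _] _ _] := rv.
have [oT _ _] := rT; have mt := coord_measurable cX oT.
have [nu Pnu eh] := natural_parameter cX rv (fin h hab).
have [_ nuE] := (exp_formE T mu h nu).1 eh.
have [nu' Pnu' [A mA ne]] := two_members_other nu P2.
have [th'] := realization_coord rT Pnu'; rewrite -[th'](subrKC h).
move=> /((exp_form_tilt mt eh _ _).1) tl.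
rewrite ltNge; apply/negP => V0.
apply: (tilt_not_cst (m := cgf1 mu (coord T) h) mt tl mA ne).
apply: (@cgf2_eq0 R _ X mu (coord T) ((a + h) / 2) ((h + b) / 2) h) => //.
- by apply: fin; lra.
- by apply: fin; lra.
- by lra.
- exact: exp_form_laplace_gt0 mt eh.
Qed.

(** After replacing T1 by a T1 + b, both sides have the same variance function and the same mean at
    their base points, which determines the law of the statistic. *)
Lemma equivalent_of_variance (X1 X2 : sampleSpace R) P1 T1 mu1 th1 P2 T2 mu2 th2 k p q a b :
  in_category c X1 -> in_category c X2 -> two_members P1 ->
  regular_via (X := X1) P1 T1 mu1 -> regular_via (X := X2) P2 T2 mu2 -> a != 0 ->
  variance_at mu1 (coord T1) th1 k p q ->
  variance_at mu2 (coord T2) th2 k (a * p - 2 * k * b) (a ^+ 2 * q - a * b * p + k * b ^+ 2) ->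
  cgf1 mu2 (coord T2) th2 = a * cgf1 mu1 (coord T1) th1 + b ->
  equivalent P1 P2.
Proof.
move=> cX1 cX2 P12 rv1 rv2 a0 V1 V2 m2.
have [mr1 _ _] := rv1; have [[oT1 _ _] _] := mr1; have mt1 := coord_measurable cX1 oT1.
have [[rT2 _] _ _] := rv2; have [oT2 _ _] := rT2; have mt2 := coord_measurable cX2 oT2.
pose T1' : X1 -> 'rV[R]_1 := fun x => a *: T1 x + b%:M.
have mr1' : minimal_realization P1 T1' mu1 := affine_realization cX1 b a0 mr1.
have rv1' := regular_via_transfer cX1 P12 rv1 mr1'.
have [rT1' _] := mr1'; have [oT1' _ _] := rT1'; have mt1' := coord_measurable cX1 oT1'.
have t1E x : coord T1' x = a * coord T1 x + b by rewrite /coord /T1' !mxE eqxx mulr1n.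
have aK : a * (th1 / a) = th1 by rewrite mulrC divfK.
have [] := @variance_at_affine R _ X1 mu1 (coord T1) (coord T1') (th1 / a) k p q a b mt1 mt1' a0 t1E.
  by rewrite aK.
rewrite aK -m2 => m1 V1'.
have f1 : (laplace mu1 (coord T1') (th1 / a) < +oo)%E.
  by have [e e0 /(_ (th1 / a))[]] := V1'; first lra.
have f2 : (laplace mu2 (coord T2) th2 < +oo)%E.
  by have [e e0 /(_ th2)[]] := V2; first lra.
have [nu1 Pnu1 e1] := natural_parameter cX1 rv1' f1.
have [nu2 Pnu2 e2] := natural_parameter cX2 rv2 f2.
have [m1' [d1 d10 W1]] := variance_at_base mt1' e1 V1'.
have [m2' [d2 d20 W2]] := variance_at_base mt2 e2 V2.
have law A := @law_eq_of_variance R _ X1 _ X2 nu1 nu2 (coord T1') (coord T2) k _ _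
  (Num.min d1 d2) mt1' mt2 _ _ _ _ _ _ A.
have {}law (A : set (measurableTypeR R)) : measurable A ->
    nu1 (coord T1' @^-1` A) = nu2 (coord T2 @^-1` A).
  have min1 h : - Num.min d1 d2 < h < Num.min d1 d2 -> 0 - d1 < h < 0 + d1.
    by rewrite -ltr_norml lt_min !ltr_norml; lra.
  have min2 h : - Num.min d1 d2 < h < Num.min d1 d2 -> 0 - d2 < h < 0 + d2.
    by rewrite -ltr_norml lt_min !ltr_norml; lra.
  apply: law.
  - by rewrite lt_min d10.
  - by move=> h /min1/W1[].
  - by move=> h /min2/W2[].
  - by move=> h /min1/W1[_ _ ->].
  - by move=> h /min2/W2[_ _ ->].
  - by rewrite m1' m2' m1.
exists 1%N, T1', mu1, T2, mu2; split; [exact: mr1'|by case: rv2|].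
apply/seteqP; split.
  exact: (pushforward_laws_sub cX1 cX2 rT1' rv2 e1 e2 law).
by apply: (pushforward_laws_sub cX2 cX1 rT2 rv1' e2 e1) => A /law.
Qed.

End matching.

(** * Improper integrals on the half-line *)

Section half_line.
Context {R : realType}.
Local Notation lam := (@lebesgue_measure R).
Local Notation pos := ([set` `]0, +oo[] : set R).

(** The ends have logarithms - n and n: a single sequence approaches both ends of the half-line, and
    integrands written in terms of ln t are easy to evaluate there. *)
Let exhaust (n : nat) : set R := [set` `[expR (- n%:R), expR n%:R]].

Let exhaust_bigcup : \bigcup_n exhaust n = pos.
Proof.
apply/seteqP; split=> [x [n _]|x].
  by rewrite /exhaust/= !in_itv/= andbT => /andP[/(lt_le_trans (expR_gt0 _))].
rewrite /= in_itv/= andbT => x0; have [n nx] : exists n, `|ln x| <= n%:R.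
  by exists (Num.truncn `|ln x|).+1; apply/ltW/truncnS_gt.
exists n => //; rewrite /exhaust/= in_itv/= -[x]lnK ?posrE// !ler_expR.
by rewrite -ler_norml.
Qed.

Let exhaust_homo : {homo exhaust : n m / (n <= m)%N >-> (n <= m)%O}.
Proof.
move=> n m nm; apply/subsetPset => x; rewrite /exhaust/= !in_itv/= => /andP[h1 h2].
apply/andP; split; [apply: le_trans h1|apply: (le_trans h2)];
  by rewrite ler_expR ?lerN2 ler_nat.
Qed.

Let mexhaust n : measurable (exhaust n). Proof. exact: measurable_itv. Qed.

Let exhaust_pos n : exhaust n `<=` pos.
Proof. by rewrite -exhaust_bigcup; exact: bigcup_sup. Qed.

Let cvg_exhaust_ge0 (f : R -> \bar R) : measurable_fun pos f ->
  (forall x, 0 < x -> (0 <= f x)%E) ->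
  (\int[lam]_(x in exhaust n) f x @[n --> \oo] --> \int[lam]_(x in pos) f x)%E.
Proof.
move=> mf f0; rewrite -exhaust_bigcup; apply: ge0_nondecreasing_set_cvg_integral => //.
  by move=> n; apply: measurable_funS mf => //; exact: measurable_itv.
by move=> n x /exhaust_pos; rewrite /= in_itv/= andbT => /f0.
Qed.

Let cvg_exhaust (f : R -> R) : lam.-integrable pos (EFin \o f) ->
  (\int[lam]_(x in exhaust n) (f x)%:E @[n --> \oo] --> \int[lam]_(x in pos) (f x)%:E)%E.
Proof.
move=> fi; have mf := measurable_int _ fi.
rewrite [X in _ --> X]integralE; under eq_fun do rewrite integralE.
apply: cvgeB.
- rewrite fin_num_adde_defl// fin_numN; apply: integrable_neg_fin_num => //; exact: measurable_itv.
- by apply: cvg_exhaust_ge0 => //; exact: measurable_funepos.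
- by apply: cvg_exhaust_ge0 => //; exact: measurable_funeneg.
Qed.

Section fundamental_theorem.
Variables (F f : R -> R) (l l' : R).
Hypothesis dF : forall x : R, 0 < x -> is_derive x 1 F (f x).
Hypothesis cf : forall x : R, 0 < x -> {for x, continuous f}.
Hypothesis Fy : F (expR n%:R) @[n --> \oo] --> l.
Hypothesis F0 : F (expR (- n%:R)) @[n --> \oo] --> l'.

Let integral_exhaust n : (\int[lam]_(x in exhaust n.+1) (f x)%:E =
  (F (expR n.+1%:R) - F (expR (- n.+1%:R)))%:E)%E.
Proof.
have xpos (x : R) : expR (- n.+1%:R) <= x -> 0 < x by apply: lt_le_trans; exact: expR_gt0.
have cF (x : R) : 0 < x -> {for x, continuous F}.
  move=> x0; apply: differentiable_continuous; apply/derivable1_diffP.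
  by have [] := dF x0.
have eN : expR (- n.+1%:R) < expR n.+1%:R :> R.
  by rewrite ltr_expR (@lt_trans _ _ 0)// ?oppr_lt0 ltr0n.
rewrite (continuous_FTC2 (F := F) eN).
- by [].
- apply: continuous_in_subspaceT => x; rewrite inE/= in_itv/= => /andP[/xpos x0 _].
  exact: cf.
- split.
  + by move=> x; rewrite in_itv/= => /andP[/ltW/xpos x0 _]; have [] := dF x0.
  + by apply: cvg_at_right_filter; exact/cF/xpos.
  + by apply: cvg_at_left_filter; exact/cF/xpos/ltW.
- by move=> x; rewrite in_itv/= => /andP[/ltW/xpos x0 _]; exact: is_derive_derive1 (dF x0).
Qed.

Let cvg_integral_exhaust :
  (\int[lam]_(x in exhaust n) (f x)%:E @[n --> \oo] --> (l - l')%:E)%E.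
Proof.
rewrite -cvg_shiftS/=; under eq_fun do rewrite integral_exhaust.
apply: cvg_EFin; first exact: nearW.
have -> : fine \o (fun n => (F (expR n.+1%:R) - F (expR (- n.+1%:R)))%:E) =
    (fun n => F (expR n.+1%:R) - F (expR (- n.+1%:R))) by [].
apply: cvgB.
  by have := Fy; rewrite -cvg_shiftS.
by have := F0; rewrite -cvg_shiftS.
Qed.

Let mf : measurable_fun pos f.
Proof.
apply: open_continuous_measurable_fun; first exact: interval_open.
by move=> x; rewrite inE/= in_itv/= andbT; exact: cf.
Qed.

Lemma ge0_integral_pos : (forall x, 0 < x -> 0 <= f x) ->
  (\int[lam]_(x in pos) (f x)%:E = (l - l')%:E)%E.
Proof.
move=> f0; apply: (cvg_unique _ _ cvg_integral_exhaust) => //.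
by apply: cvg_exhaust_ge0; [exact/measurable_EFinP|move=> x /f0; rewrite lee_fin].
Qed.

Lemma integral_pos : lam.-integrable pos (EFin \o f) ->
  (\int[lam]_(x in pos) (f x)%:E = (l - l')%:E)%E.
Proof.
by move=> fi; apply: (cvg_unique _ (cvg_exhaust fi) cvg_integral_exhaust).
Qed.

End fundamental_theorem.

(** c times the image of Lebesgue measure under x -> c x gives each half-open interval its length,
    so it is Lebesgue measure. *)
Lemma ge0_integral_scale (c : R) (f : R -> \bar R) : 0 < c -> measurable_fun setT f ->
  (forall x, (0 <= f x)%E) ->
  (\int[lam]_(x in pos) f x = c%:E * \int[lam]_(x in pos) f (c * x)%R)%E.
Proof.
move=> c0 mf f0; pose k : {nonneg R} := NngNum (ltW c0).
have mc : measurable_fun setT (fun x : measurableTypeR R => (c * x : measurableTypeR R)).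
  by apply: measurable_funM => //; exact: measurable_cst.
have [m mE mI] := exists_pushforward lam mc.
have lamE (A : set (measurableTypeR R)) : measurable A -> lam A = mscale k m A.
  move=> mA; apply: lebesgue_measure_unique mA => _ [[a b]] _ <-.
  change (lam [set` `]a, b]] = (c%:E * m [set` `]a, b]])%E); rewrite mE.
  have -> : (fun x => c * x) @^-1` [set` `]a, b]] = [set` `]a / c, b / c]].
    by apply/seteqP; split=> x /=; rewrite !in_itv/= ltr_pdivrMr// ler_pdivlMr// mulrC.
  have h1 : lam [set` `]a / c, b / c]] = (if (a / c < b / c)%R then (b / c - a / c)%:E else 0)%E.
    by have := lebesgue_measure_itv `]a / c, b / c]; rewrite /= lte_fin => ->.
  have h2 : lam [set` `]a, b]] = (if (a < b)%R then (b - a)%:E else 0)%E.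
    by have := lebesgue_measure_itv `]a, b]; rewrite /= lte_fin => ->.
  apply: etrans h2 (etrans _ (congr1 (fun z => (c%:E * z)%E) (esym h1))).
  rewrite ltr_pM2r ?invr_gt0//.
  case: ifPn => _; last by rewrite mule0.
  by rewrite -EFinM; congr EFin; field; rewrite gt_eqF.
have -> : (\int[lam]_(x in pos) f x = \int[mscale k m]_(x in pos) f x)%E.
  by apply: eq_measure_integral => A mA _; exact: lamE.
rewrite ge0_integral_mscale//; last exact: measurable_funTS.
congr (_ * _)%E; rewrite mI//.
congr (integral _ _ _); apply/seteqP; split=> x /=; rewrite !in_itv/= !andbT.
  by rewrite pmulr_rgt0.
by move=> x0; rewrite mulr_gt0.
Qed.

End half_line.

Lemma cvgn0_le_norm {R : realType} (f g : nat -> R) : (forall n, `|f n| <= g n) ->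
  g n @[n --> \oo] --> 0 -> f n @[n --> \oo] --> 0.
Proof.
move=> fg g0; have gN : - g n @[n --> \oo] --> 0 by rewrite -oppr0; exact: cvgN.
apply: (squeeze_cvgr _ gN g0); apply: nearW => n.
by rewrite -ler_norml.
Qed.

(** * Gamma integrals with complex argument, in real terms *)

Section gamma_integrals.
Context {R : realType}.
Local Notation lam := (@lebesgue_measure R).
Local Notation pos := ([set` `]0, +oo[] : set R).
Implicit Types a y t : R.

(** The integrand of Gamma for t > 0, as one exponential: products and substitutions become linear
    identities between exponents. *)
Definition gamma_weight a t := expR ((a - 1) * ln t - t).

Lemma gamma_weightE a t : 0 < t -> t `^ (a - 1) * expR (- t) = gamma_weight a t.
Proof. by move=> t0; rewrite /gamma_weight expRD /powR gt_eqF. Qed.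

Lemma gamma_weight_shift a t : 0 < t -> t * gamma_weight a t = gamma_weight (a + 1) t.
Proof.
move=> t0; rewrite /gamma_weight -[t in LHS]lnK ?posrE// -expRD lnK ?posrE//.
by congr expR; ring.
Qed.

(** The integrand of a product of two Gamma integrals after replacing the second variable by s t.
    For fixed t it is a Gamma integrand of parameter 2 a in the variable s (1 + t). *)
Lemma gamma_weight_scale a s t : 0 < s -> 0 < t ->
  gamma_weight a s * (s * gamma_weight a (s * t)) =
  expR ((a - 1) * ln t) * (gamma_weight (2 * a) (s * (1 + t)) * ((1 + t) * expR (- (2 * a) * ln (1 + t)))).
Proof.
move=> s0 t0; have t1 : 0 < 1 + t by rewrite addr_gt0.
have lnD (u v : R) : 0 < u -> u * expR v = expR (ln u + v).
  by move=> u0; rewrite expRD lnK.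
rewrite mulrCA [in RHS]mulrCA [X in _ = _ * X]mulrCA [in RHS]mulrCA /gamma_weight.
rewrite lnM ?posrE// [ln (s * (1 + t))]lnM ?posrE// (lnD (1 + t))// -!expRD (lnD s)//.
by congr expR; ring.
Qed.

Lemma measurable_gamma_weight a : measurable_fun setT (gamma_weight a).
Proof.
apply: measurableT_comp => //; apply: measurable_funB => //.
by apply: measurable_funM => //; exact: measurable_ln.
Qed.

Let is_derive_ln_lin a y t : 0 < t ->
  is_derive t 1 (fun u => a * ln u - y * u) (a / t - y).
Proof.
move=> t0; have h := is_derive1_ln t0.
by apply: is_derive_eq; rewrite /GRing.scale/= mulr1.
Qed.

(** The tangent of the logarithm at k, multiplied by k. *)
Let ln_le (k u : R) : 0 < k -> 0 < u -> k * ln u <= u - k + k * ln k.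
Proof.
move=> k0 u0; have := @le_ln1Dx R (u / k - 1).
have <- : u / k = 1 + (u / k - 1) by ring.
rewrite ln_div ?posrE// => H.
have {}H : ln u - ln k <= u / k - 1 by apply: H; have := divr_gt0 u0 k0; lra.
rewrite -(ler_pM2l k0) in H.
move: H; have -> : k * (ln u - ln k) = k * ln u - k * ln k by ring.
have -> : k * (u / k - 1) = u - k by field; rewrite gt_eqF.
lra.
Qed.

(** The tangent bound at k = a + 1 gives e^(-t) <= C (1 + t)^(-a-1); the resulting majorant has an
    elementary antiderivative. *)
Let gamma_weight_dom a t : 0 < a -> 0 < t -> gamma_weight a t <=
  expR (1 + (a + 1) * ln (a + 1)) * expR ((a - 1) * ln t - (a + 1) * ln (1 + t)).
Proof.
move=> a0 t0; rewrite /gamma_weight -expRD ler_expR.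
have := @ln_le (a + 1) (1 + t); lra.
Qed.

Let cvg_expR_lin a : 0 < a -> expR (- (a * n%:R)) @[n --> \oo] --> (0 : R).
Proof.
move=> a0; have h : (fun n : nat => a * n%:R) @ \oo --> +oo.
  apply/cvgryPge => M; near=> n.
  rewrite mulrC -ler_pdivrMr//; near: n.
  exists (Num.truncn `|M / a|).+1 => // n /= Mn.
  apply: le_trans (ler_norm _) _; apply/ltW/(lt_le_trans (truncnS_gt _)).
  by rewrite ler_nat.
have := @cvgr_expR R; move=> /(cvg_comp _ _ h); exact.
Unshelve. all: by end_near. Qed.

(** t^(a-1) (1 + t)^(-a-1) is the derivative of (t / (1 + t))^a / a, which runs from 0 to 1 / a. *)
Let dominating_integrable a : 0 < a ->
  lam.-integrable pos (EFin \o (fun t => expR ((a - 1) * ln t - (a + 1) * ln (1 + t)))).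
Proof.
move=> a0.
have mg : measurable_fun setT (fun t => expR ((a - 1) * ln t - (a + 1) * ln (1 + t))).
  apply: measurableT_comp => //; apply: measurable_funB.
    by apply: measurable_funM => //; exact: measurable_ln.
  apply: measurable_funM => //; apply: measurableT_comp; first exact: measurable_ln.
  exact: measurable_funD.
apply/integrableP; split; first exact/measurable_EFinP/measurable_funTS.
under eq_integral do rewrite /= ger0_norm ?expR_ge0//.
suff -> : (\int[lam]_(x in pos) (expR ((a - 1) * ln x - (a + 1) * ln (1 + x)))%:E =
    (a^-1 - 0)%:E)%E by rewrite ltry.
apply: (@ge0_integral_pos R (fun t => a^-1 * expR (a * ln t - a * ln (1 + t)))
  (fun t => expR ((a - 1) * ln t - (a + 1) * ln (1 + t))) a^-1 0).
- move=> x x0; have x1 : 0 < 1 + x by rewrite addr_gt0.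
  have h1 := is_derive1_ln x0.
  have h2 : is_derive x 1 (fun t => ln (1 + t)) (1 / (1 + x)).
    apply: is_derive_ln_comp => //; apply: is_derive_eq; by rewrite add0r.
  have h3 : is_derive x 1 (fun t => a * ln t - a * ln (1 + t)) (a / x - a / (1 + x)).
    by apply: is_derive_eq; rewrite /GRing.scale/= mul1r.
  have h4 := is_derive_expR_comp h3.
  apply: is_derive_eq; rewrite /GRing.scale/= mulrA.
  have -> : a^-1 * (a / x - a / (1 + x)) = expR (- ln x - ln (1 + x)).
    rewrite expRD !expRN !lnK ?posrE//; field; rewrite !gt_eqF//.
  by rewrite -expRD; congr expR; ring.
- move=> x x0; have x1 : 0 < 1 + x by rewrite addr_gt0.
  apply: continuous_comp; last exact: continuous_expR.
  apply: cvgB; apply: cvgM; try exact: cvg_cst; first exact: continuous_ln.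
  apply: continuous_comp; last exact: continuous_ln.
  by apply: cvgD; [exact: cvg_cst|exact: cvg_id].
- have E n : a * ln (expR n%:R) - a * ln (1 + expR n%:R) = - (a * ln (1 + expR (- n%:R))) :> R.
    rewrite (_ : 1 + expR n%:R = expR n%:R * (1 + expR (- n%:R))); last first.
      by rewrite mulrDr mulr1 -expRD subrr expR0 addrC.
    by rewrite lnM ?posrE ?addr_gt0 ?expR_gt0// expRK; ring.
  have -> : (fun n : nat => a^-1 * expR (a * ln (expR n%:R) - a * ln (1 + expR n%:R))) =
      (fun n => a^-1 * expR (- (a * ln (1 + expR (- n%:R))))) by apply/funext => n; rewrite E.
  have h0 : (1 + expR (- n%:R) : R) @[n --> \oo] --> (1 + 0 : R).
    by apply: cvgD; [exact: cvg_cst|exact: cvgn_expR].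
  have h1 : ln (1 + expR (- n%:R) : R) @[n --> \oo] --> ln (1 + 0 : R).
    by apply: continuous_cvg h0; apply: continuous_ln; rewrite addr0.
  have h2 : expR (- (a * ln (1 + expR (- n%:R)))) @[n --> \oo] --> expR (- (a * ln (1 + 0))).
    apply: continuous_cvg; first exact: continuous_expR.
    by apply: cvgN; apply: cvgM h1; exact: cvg_cst.
  have := cvgM (cvg_cst a^-1) h2.
  by rewrite addr0 ln1 mulr0 oppr0 expR0 mulr1; exact.
- have h1 : expR (a * ln (expR (- n%:R)) - a * ln (1 + expR (- n%:R))) @[n --> \oo] --> (0 : R).
    apply: (squeeze_cvgr _ (cvg_cst 0) (cvg_expR_lin a0)).
    apply: nearW => n; rewrite expR_ge0/= ler_expR expRK.
    by rewrite mulrN gerBl mulr_ge0 ?(ltW a0)// ln_ge0// lerDl expR_ge0.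
  have := cvgM (cvg_cst a^-1) h1.
  by rewrite mulr0; exact.
- by move=> x _; rewrite expR_ge0.
Qed.

Lemma integrable_gamma_weight a : 0 < a -> lam.-integrable pos (EFin \o gamma_weight a).
Proof.
move=> a0; have mpos : measurable (pos : set (measurableTypeR R)) by exact: measurable_itv.
have := integrableZl mpos (expR (1 + (a + 1) * ln (a + 1))) (dominating_integrable a0).
apply: le_integrable => //.
  by apply/measurable_EFinP/measurable_funTS; exact: measurable_gamma_weight.
move=> t; rewrite /= in_itv/= andbT => t0.
by rewrite lee_fin ger0_norm ?expR_ge0// ger0_norm ?mulr_ge0 ?expR_ge0// gamma_weight_dom.
Qed.

Section bounded_factor.
Variables (a y : R) (u v : R -> R).
Hypotheses (a0 : 0 < a) (du : forall x : R, is_derive x 1 u (v x)).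
Hypotheses (cv : continuous v) (bu : forall x, `|u x| <= 1) (bv : forall x, `|v x| <= 1).

Lemma integrable_gamma_weightM (c : R) (w : R -> R) : 0 < c -> continuous w ->
  (forall x, `|w x| <= 1) ->
  lam.-integrable pos (EFin \o (fun t => gamma_weight c t * w (y * ln t))).
Proof.
move=> c0 cw bw; have mpos : measurable (pos : set (measurableTypeR R)) by exact: measurable_itv.
have := integrable_gamma_weight c0; apply: le_integrable => //.
  apply/measurable_EFinP/measurable_funTS; apply: measurable_funM.
    exact: measurable_gamma_weight.
  apply: measurableT_comp; first exact: continuous_measurable_fun.
  by apply: measurable_funM => //; exact: measurable_ln.
move=> t _; rewrite lee_fin normrM ler_piMr//; exact: bw.
Qed.

Let cu : continuous u.
Proof. by move=> x; apply: differentiable_continuous; apply/derivable1_diffP; have [] := du x. Qed.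

(** Integration of the derivative of t^a e^(-t) u(y ln t), which vanishes at both ends. With u = cos
    and u = sin this yields the real and imaginary parts of Gamma(z + 1) = z Gamma(z) for z = a + i
    y. *)
Lemma gamma_weight_rec :
  \int[lam]_(t in pos) (gamma_weight (a + 1) t * u (y * ln t)) =
  a * \int[lam]_(t in pos) (gamma_weight a t * u (y * ln t)) +
  y * \int[lam]_(t in pos) (gamma_weight a t * v (y * ln t)).
Proof.
have mpos : measurable (pos : set (measurableTypeR R)) by exact: measurable_itv.
have a1 : 0 < a + 1 by rewrite addr_gt0.
have i1 := integrable_gamma_weightM a1 cu bu.
have i2 := integrable_gamma_weightM a0 cu bu.
have i3 := integrable_gamma_weightM a0 cv bv.
have i23 := integrableD mpos (integrableZl mpos a i2) (integrableZl mpos y i3).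
have i4 := integrableB mpos i23 i1.
have E : (fun x => (a%:E * (gamma_weight a x * u (y * ln x))%:E +
      y%:E * (gamma_weight a x * v (y * ln x))%:E -
      (gamma_weight (a + 1) x * u (y * ln x))%:E)%E) =
    EFin \o (fun t => gamma_weight a t * (a * u (y * ln t) + y * v (y * ln t)) -
      gamma_weight (a + 1) t * u (y * ln t)).
  by apply/funext => t /=; apply: (congr1 EFin); ring.
have : (\int[lam]_(t in pos) (gamma_weight a t * (a * u (y * ln t) + y * v (y * ln t)) -
      gamma_weight (a + 1) t * u (y * ln t))%:E = (0 - 0)%:E)%E.
  apply: (@integral_pos R (fun t => expR (a * ln t - t) * u (y * ln t))
    (fun t => gamma_weight a t * (a * u (y * ln t) + y * v (y * ln t)) -
      gamma_weight (a + 1) t * u (y * ln t)) 0 0).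
  - move=> t t0; have h1 := is_derive1_ln t0.
    have h2 : is_derive t 1 (fun t => a * ln t - t) (a / t - 1).
      by apply: is_derive_eq; rewrite /GRing.scale/=.
    have h3 : is_derive t 1 (fun t => y * ln t) (y / t).
      by apply: is_derive_eq; rewrite /GRing.scale/=.
    have h4 := is_derive_expR_comp h2.
    have h5 := @is_derive1_comp R u (fun t => y * ln t) t _ _ (du (y * ln t)) h3.
    apply: (is_derive_eq (is_deriveM h4 h5)); rewrite /GRing.scale/= -gamma_weight_shift//.
    have -> : expR (a * ln t - t) = t * gamma_weight a t.
      by rewrite gamma_weight_shift// /gamma_weight addrK.
    by field; rewrite gt_eqF.
  - move=> t t0.
    have k1 c : {for t, continuous (gamma_weight c)}.
      apply: continuous_comp; last exact: continuous_expR.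
      apply: cvgB; last exact: cvg_id.
      by apply: cvgM; [exact: cvg_cst|exact: continuous_ln].
    have k2 (w : R -> R) : continuous w -> {for t, continuous (fun t => w (y * ln t))}.
      move=> cw; apply: (@continuous_comp _ _ _ (fun t => y * ln t) w); last exact: cw.
      by apply: cvgM; [exact: cvg_cst|exact: continuous_ln].
    apply: cvgB; last by apply: cvgM; [exact: k1|exact: (k2 u)].
    apply: cvgM; first exact: k1.
    by apply: cvgD; apply: cvgM; try exact: cvg_cst; exact: k2.
  - have h : expR ((a + 1) * ln (a + 1)) * expR (- n%:R) @[n --> \oo] --> (0 : R).
      rewrite -[X in _ --> X](mulr0 (expR ((a + 1) * ln (a + 1)))).
      by apply: cvgM; [exact: cvg_cst|exact: cvgn_expR].
    apply: cvgn0_le_norm h => n; rewrite normrM (ger0_norm (expR_ge0 _)).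
    apply: le_trans (_ : expR (a * ln (expR n%:R) - expR n%:R) <= _); first by rewrite ler_piMr ?expR_ge0.
    rewrite -expRD ler_expR.
    by have := ln_le a1 (expR_gt0 n%:R); rewrite expRK; lra.
  - apply: cvgn0_le_norm (cvg_expR_lin a0) => n; rewrite normrM (ger0_norm (expR_ge0 _)).
    apply: le_trans (_ : expR (a * ln (expR (- n%:R)) - expR (- n%:R)) <= _); first by rewrite ler_piMr ?expR_ge0.
    by rewrite ler_expR expRK mulrN gerDl oppr_le0 expR_ge0.
  - by rewrite -E.
rewrite subrr => H.
have : \int[lam]_(t in pos) (gamma_weight a t * (a * u (y * ln t) + y * v (y * ln t)) -
      gamma_weight (a + 1) t * u (y * ln t)) = 0 by rewrite /Rintegral H.
rewrite RintegralB//; last first.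
  by apply: eq_integrable i23 => // t _; rewrite /= -!EFinM -EFinD; congr EFin; ring.
move/eqP; rewrite subr_eq0 => /eqP <-.
under eq_Rintegral do rewrite mulrDr mulrCA [_ * (y * _)]mulrCA.
rewrite RintegralD ?RintegralZl//.
- by apply: eq_integrable (integrableZl mpos a i2) => // t _; rewrite /= EFinM.
- by apply: eq_integrable (integrableZl mpos y i3) => // t _; rewrite /= EFinM.
Qed.

End bounded_factor.

Definition gamma_cos a y := \int[lam]_(t in pos) (gamma_weight a t * cos (y * ln t)).
Definition gamma_sin a y := \int[lam]_(t in pos) (gamma_weight a t * sin (y * ln t)).

Lemma cGammaE a y : cGamma (a +i* y)%C = (gamma_cos a y +i* gamma_sin a y)%C.
Proof.
by rewrite /cGamma /=; congr Complex; apply: eq_Rintegral => t;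
  rewrite inE/= in_itv/= andbT => /gamma_weightE ->.
Qed.

Lemma GammaE a : Gamma a = gamma_cos a 0.
Proof.
apply: eq_Rintegral => t; rewrite inE/= in_itv/= andbT => /gamma_weightE ->.
by rewrite mul0r cos0 mulr1.
Qed.

Lemma gamma_cosN a y : gamma_cos a (- y) = gamma_cos a y.
Proof. by apply: eq_Rintegral => t _; rewrite mulNr cosN. Qed.

Let cos_bound x : `|cos x| <= 1 :> R.
Proof. by rewrite ler_norml cos_geN1 cos_le1. Qed.

Let sin_bound x : `|sin x| <= 1 :> R.
Proof. by rewrite ler_norml sin_geN1 sin_le1. Qed.

Let Rintegral_sinN a y : 0 < a ->
  \int[lam]_(t in pos) (gamma_weight a t * - sin (y * ln t)) = - gamma_sin a y.
Proof.
move=> a0; rewrite -mulN1r /gamma_sin -RintegralZl//.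
- by apply: eq_Rintegral => t _; rewrite mulN1r mulrN.
- by apply: integrable_gamma_weightM => //; exact: continuous_sin.
Qed.

Lemma gamma_sinN a y : 0 < a -> gamma_sin a (- y) = - gamma_sin a y.
Proof.
by move=> a0; rewrite -Rintegral_sinN//; apply: eq_Rintegral => t _; rewrite mulNr sinN.
Qed.

Lemma gamma_cos_rec a y : 0 < a ->
  gamma_cos (a + 1) y = a * gamma_cos a y - y * gamma_sin a y.
Proof.
move=> a0; rewrite /gamma_cos (@gamma_weight_rec a y cos (fun x => - sin x))//.
- by rewrite Rintegral_sinN// mulrN.
- by move=> x; apply: cvgN; exact: continuous_sin.
- by move=> x; rewrite normrN.
Qed.

Lemma gamma_sin_rec a y : 0 < a ->
  gamma_sin (a + 1) y = a * gamma_sin a y + y * gamma_cos a y.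
Proof.
move=> a0; rewrite /gamma_sin (@gamma_weight_rec a y sin cos)//.
exact: continuous_cos.
Qed.

(** This is |Gamma(a + i y)|^2; its recurrence has the factor |a + i y|^2. *)
Definition gamma_square a y := gamma_cos a y ^+ 2 + gamma_sin a y ^+ 2.

Lemma gamma_square_rec a y : 0 < a ->
  gamma_square (a + 1) y = (a ^+ 2 + y ^+ 2) * gamma_square a y.
Proof. by move=> a0; rewrite /gamma_square gamma_cos_rec// gamma_sin_rec//; ring. Qed.

Lemma Gamma_rec a : 0 < a -> Gamma (a + 1) = a * Gamma a.
Proof. by move=> a0; rewrite !GammaE gamma_cos_rec// mul0r subr0. Qed.

Lemma integral_gamma_weight a : 0 < a ->
  (\int[lam]_(t in pos) (gamma_weight a t)%:E = (Gamma a)%:E)%E.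
Proof.
move=> a0; rewrite GammaE /gamma_cos /Rintegral fineK.
  by apply: eq_integral => t _; rewrite mul0r cos0 mulr1.
apply: integrable_fin_num; first exact: measurable_itv.
apply: eq_integrable (integrable_gamma_weight a0); first exact: measurable_itv.
by move=> t _; rewrite /= mul0r cos0 mulr1.
Qed.

Lemma Gamma_gt0 a : 0 < a -> 0 < Gamma a.
Proof.
move=> a0; rewrite -lte_fin -integral_gamma_weight//.
(* On [1, 2] one has 0 <= ln t <= 1 and t <= 2, so the integrand is at least m there. *)
pose m := expR (- `|a - 1| - 2).
have mpos : measurable (pos : set (measurableTypeR R)) by exact: measurable_itv.
pose D : set (measurableTypeR R) := [set` `[1, 2]].
have m12 : measurable D by exact: measurable_itv.
have mg E : measurable_fun E (EFin \o gamma_weight a).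
  by apply/measurable_EFinP/measurable_funTS; exact: measurable_gamma_weight.
suff : (m%:E <= \int[lam]_(t in pos) (gamma_weight a t)%:E)%E.
  by apply: lt_le_trans; rewrite lte_fin expR_gt0.
have h1 : (\int[lam]_(t in D) (gamma_weight a t)%:E <=
    \int[lam]_(t in pos) (gamma_weight a t)%:E)%E.
  apply: ge0_subset_integral; [exact: m12|exact: mpos|exact: mg| |].
    by move=> t _; rewrite lee_fin expR_ge0.
  by move=> t; rewrite /D /= !in_itv/= andbT => /andP[t1 _]; lra.
apply: le_trans h1.
have -> : m%:E = (\int[lam]_(t in D) (cst m%:E) t)%E.
  have h : lam D = 1%E.
    have := @lebesgue_measure_itv R `[1, 2]; rewrite /= lte_fin => ->.
    by rewrite ifT; [congr EFin; ring|lra].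
  apply: esym; apply: etrans (integral_cst _ m12 _) _.
  by apply: etrans (congr1 (fun z => m%:E * z)%E h) _; rewrite mule1.
apply: ge0_le_integral => //.
- by move=> t _; rewrite lee_fin expR_ge0.
- exact: mg.
- move=> t; rewrite /D /= in_itv/= => /andP[t1 t2]; rewrite lee_fin ler_expR.
  have l0 := ln_ge0 t1; have := @ln_le 1 t; rewrite ln1 => l1.
  have : `|(a - 1) * ln t| <= `|a - 1|.
    rewrite normrM ler_piMr// ger0_norm//.
    have := l1 ltr01; lra.
  by rewrite ler_norml => /andP[h _]; lra.
Qed.

End gamma_integrals.

(** * The weight of the NEF-GHS family *)

Section ghs_weight_gamma.
Context {R : realType}.
Implicit Types r x : R.

Let half_complex r x : ((r +i* x)%C / 2 : R[i]) = ((r / 2) +i* (x / 2))%C.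
Proof.
have E : (2 : R[i]) = (2 : R)%:C%C by rewrite rmorph_nat.
have n2 : (2 : R[i]) != 0 by rewrite pnatr_eq0.
apply: (mulIf n2); rewrite divfK//; apply/eqP.
by rewrite eq_complex E /= !mulr0 subr0 add0r !divfK ?pnatr_eq0// !eqxx.
Qed.

Lemma ghs_complex_weightE r x : 0 < r ->
  ghs_complex_weight r x = (gamma_square (r / 2) (x / 2) / Gamma r)%:C%C.
Proof.
move=> r0; rewrite /ghs_complex_weight !half_complex mulNr !cGammaE gamma_cosN.
rewrite gamma_sinN ?divr_gt0// fmorph_div; congr (_ / _); apply/eqP.
rewrite eq_complex /= /gamma_square; apply/andP; split; apply/eqP; ring.
Qed.

Lemma ghs_weightE r x : 0 < r -> ghs_weight r x = gamma_square (r / 2) (x / 2) / Gamma r.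
Proof. by move=> r0; rewrite /ghs_weight ghs_complex_weightE. Qed.

Lemma ghs_complex_weight_norm r x : 0 < r ->
  ghs_complex_weight r x = `|cGamma ((r +i* x)%C / 2)| ^+ 2 / (Gamma r)%:C%C.
Proof.
move=> r0; rewrite ghs_complex_weightE// half_complex cGammaE fmorph_div; congr (_ / _).
rewrite normc_def -rmorphXn /= sqr_sqrtr// addr_ge0 ?sqr_ge0//.
Qed.

Lemma ghs_weight_ge0 r x : 0 < r -> 0 <= ghs_weight r x.
Proof.
by move=> r0; rewrite ghs_weightE// divr_ge0 ?(ltW (Gamma_gt0 r0))// addr_ge0 ?sqr_ge0.
Qed.

Lemma ghs_weightN r x : 0 < r -> ghs_weight r (- x) = ghs_weight r x.
Proof.
move=> r0; rewrite !ghs_weightE// /gamma_square mulNr gamma_cosN gamma_sinN ?divr_gt0//.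
by rewrite sqrrN.
Qed.

(** |Gamma(z + 1)|^2 = |z|^2 |Gamma(z)|^2 for z = (r + i x) / 2, with |z|^2 = (r^2 + x^2) / 4, while
    Gamma(r + 2) = r (r + 1) Gamma(r) in the denominator. *)
Lemma ghs_weight_rec r x : 0 < r ->
  ghs_weight (r + 2) x = (r ^+ 2 + x ^+ 2) / (4 * r * (r + 1)) * ghs_weight r x.
Proof.
move=> r0; have r2 : 0 < r / 2 by rewrite divr_gt0.
rewrite !ghs_weightE ?addr_gt0//.
have -> : (r + 2) / 2 = r / 2 + 1 by field.
have -> : r + 2 = (r + 1) + 1 by ring.
rewrite gamma_square_rec// !Gamma_rec ?addr_gt0//.
by field; rewrite !gt_eqF ?Gamma_gt0 ?addr_gt0.
Qed.

End ghs_weight_gamma.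

Section real_integrands.
Context {R : realType} d (X : measurableType d) (m : {measure set X -> \bar R}).
Variables (D : set X) (f g : X -> R) (k : R).
Hypotheses (mD : measurable D) (mf : measurable_fun setT f) (mg : measurable_fun setT g).
Hypotheses (f0 : forall x, D x -> 0 <= f x) (g0 : forall x, D x -> 0 <= g x) (k0 : 0 <= k).

Lemma ge0_integralM_EFin :
  (\int[m]_(x in D) (k * f x)%:E = k%:E * \int[m]_(x in D) (f x)%:E)%E.
Proof.
by rewrite -ge0_integralZl//; exact/measurable_funTS/measurable_EFinP.
Qed.

Lemma ge0_integralD_EFin :
  (\int[m]_(x in D) (f x + g x)%:E =
   \int[m]_(x in D) (f x)%:E + \int[m]_(x in D) (g x)%:E)%E.
Proof.
under eq_integral do rewrite EFinD.
by rewrite ge0_integralD//; first [exact/measurable_funTS/measurable_EFinP|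
  move=> x /f0; rewrite lee_fin|move=> x /g0; rewrite lee_fin].
Qed.

End real_integrands.

Section iterated_integrals.
Context {R : realType} d1 d2 (X : measurableType d1) (Y : measurableType d2).
Variables (m1 : {sigma_finite_measure set X -> \bar R}).
Variables (m2 : {sigma_finite_measure set Y -> \bar R}).
Variables (A : set X) (B : set Y) (f : X -> Y -> R).
Hypotheses (mA : measurable A) (mB : measurable B).
Hypothesis mf : measurable_fun setT (fun z => f z.1 z.2).
Hypothesis f0 : forall x y, A x -> B y -> 0 <= f x y.

Let g := (fun z : X * Y => (f z.1 z.2)%:E) \_ (A `*` B).

Let mg : measurable_fun setT g.
Proof.
apply/(measurable_restrictT _ _).1; first exact: measurableX.
by apply/measurable_funTS/measurable_EFinP.
Qed.

Let g0 z : (0 <= g z)%E.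
Proof. by apply: erestrict_ge0 => -[x y] [/= Ax By]; rewrite lee_fin f0. Qed.

Let inner1 x : A x -> (\int[m2]_y g (x, y) = \int[m2]_(y in B) (f x y)%:E)%E.
Proof.
move=> Ax; rewrite [RHS]integral_mkcond; apply: eq_integral => y _.
rewrite /g !patchE; congr (if _ then _ else _).
by apply/idP/idP; rewrite !inE; [case|split].
Qed.

Let inner2 y : B y -> (\int[m1]_x g (x, y) = \int[m1]_(x in A) (f x y)%:E)%E.
Proof.
move=> By; rewrite [RHS]integral_mkcond; apply: eq_integral => x _.
rewrite /g !patchE; congr (if _ then _ else _).
by apply/idP/idP; rewrite !inE; [case|split].
Qed.

(** Tonelli for the extension of f by 0, since f is known to be nonnegative on A x B only. *)
Lemma ge0_exchange_integral :
  (\int[m1]_(x in A) \int[m2]_(y in B) (f x y)%:E =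
   \int[m2]_(y in B) \int[m1]_(x in A) (f x y)%:E)%E.
Proof.
have := fubini_tonelli (m1 := m1) (m2 := m2) g mg g0; congr (_ = _).
  rewrite [RHS]integral_mkcond; apply: eq_integral => x _; rewrite [RHS]patchE.
  case: ifPn; rewrite ?inE ?notin_setE => Ax; first exact: inner1.
  apply: etrans _ (integral0 m2 setT); apply: eq_integral => y _.
  by rewrite /g patchE memNset// => -[].
rewrite [RHS]integral_mkcond; apply: eq_integral => y _; rewrite [RHS]patchE.
case: ifPn; rewrite ?inE ?notin_setE => By; first exact: inner2.
apply: etrans _ (integral0 m1 setT); apply: eq_integral => x _.
by rewrite /g patchE memNset// => -[].
Qed.

Lemma measurable_fun_ge0_integral : A = setT ->
  measurable_fun setT (fun x => \int[m2]_(y in B) (f x y)%:E)%E.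
Proof.
move=> AT; have -> : (fun x => \int[m2]_(y in B) (f x y)%:E)%E = fubini_F m2 g.
  by apply/funext => x; rewrite /fubini_F inner1// AT.
exact: measurable_fun_fubini_tonelli_F.
Qed.

End iterated_integrals.

(** * The total mass of the weight *)

Section ghs_weight_integral.
Context {R : realType} (r : R).
Hypothesis r0 : 0 < r.
Local Notation lam := (@lebesgue_measure R).
Local Notation pos := ([set` `]0, +oo[] : set R).

Let a : R := r / 2.
Let a0 : 0 < a. Proof. by rewrite divr_gt0. Qed.

Let mpos : measurable (pos : set (measurableTypeR R)). Proof. exact: measurable_itv. Qed.

(** Here a = r / 2, so this is t^(a-1) (1 + t)^(-2a). Against t^(i x / 2) it integrates to Euler's
    B(a + i x / 2, a - i x / 2), which is the weight at x. *)
Definition beta_weight (t : R) : R := expR ((a - 1) * ln t - r * ln (1 + t)).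

Let cos1_ge0 (x : R) : 0 <= 1 + cos x.
Proof. by rewrite -lerBlDl sub0r cos_geN1. Qed.

Let bcos (x : R) : `|cos x| <= 1.
Proof. by rewrite ler_norml cos_geN1 cos_le1. Qed.

Let bsin (x : R) : `|sin x| <= 1.
Proof. by rewrite ler_norml sin_geN1 sin_le1. Qed.

Let mcos : measurable_fun setT (@cos R).
Proof. by apply: continuous_measurable_fun; exact: continuous_cos. Qed.

Let i1 : lam.-integrable pos (EFin \o gamma_weight a).
Proof. exact: integrable_gamma_weight. Qed.

Let icos y : lam.-integrable pos (EFin \o (fun t => gamma_weight a t * cos (y * ln t))).
Proof. by apply: integrable_gamma_weightM => //; exact: continuous_cos. Qed.

Let isin y : lam.-integrable pos (EFin \o (fun t => gamma_weight a t * sin (y * ln t))).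
Proof. by apply: integrable_gamma_weightM => //; exact: continuous_sin. Qed.

Let Icos y : (\int[lam]_(t in pos) (gamma_weight a t * cos (y * ln t))%:E =
  (gamma_cos a y)%:E)%E.
Proof. by rewrite /gamma_cos /Rintegral fineK; last (apply: integrable_fin_num; [exact: mpos|exact: icos]). Qed.

Let Isin y : (\int[lam]_(t in pos) (gamma_weight a t * sin (y * ln t))%:E =
  (gamma_sin a y)%:E)%E.
Proof. by rewrite /gamma_sin /Rintegral fineK; last (apply: integrable_fin_num; [exact: mpos|exact: isin]). Qed.

Let lincomb y (u v w : R) :
  (\int[lam]_(t in pos) (gamma_weight a t * (u + (v * cos (y * ln t) + w * sin (y * ln t))))%:E =
  (u * Gamma a + (v * gamma_cos a y + w * gamma_sin a y))%:E)%E.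
Proof.
have j1 := integrableZl mpos u i1; have j2 := integrableZl mpos v (icos y).
have j3 := integrableZl mpos w (isin y); have j4 := integrableD mpos j2 j3.
under eq_integral => t _.
  rewrite (_ : (_)%:E = u%:E * (gamma_weight a t)%:E +
    (v%:E * (gamma_weight a t * cos (y * ln t))%:E +
     w%:E * (gamma_weight a t * sin (y * ln t))%:E))%E; last first.
    by apply: (congr1 EFin); ring.
  over.
rewrite integralD// integralD// !integralZl//; [|exact: isin|exact: icos].
have -> : (u * Gamma a + (v * gamma_cos a y + w * gamma_sin a y))%:E =
  (u%:E * (Gamma a)%:E + (v%:E * (gamma_cos a y)%:E + w%:E * (gamma_sin a y)%:E))%E by [].
by congr (_ * _ + (_ * _ + _ * _))%E; [exact: integral_gamma_weight|exact: Icos|exact: Isin].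
Qed.

Let measurable_phase (u : R -> R) : measurable_fun setT u ->
  measurable_fun setT (fun t => 1 + cos (u t)).
Proof. by move=> mu; apply: measurable_funD => //; exact: measurableT_comp. Qed.

Let inner y s : (\int[lam]_(t in pos) (gamma_weight a t * (1 + cos (y * ln t - y * ln s)))%:E =
  (Gamma a + (cos (y * ln s) * gamma_cos a y + sin (y * ln s) * gamma_sin a y))%:E)%E.
Proof.
rewrite -[Gamma a]mul1r -lincomb; apply: eq_integral => t _.
by rewrite cosB; apply: (congr1 EFin); ring.
Qed.

Let measurable_lin y c : measurable_fun setT (fun t => y * ln t - c : R).
Proof. by apply: measurable_funB => //; apply: measurable_funM => //; exact: measurable_ln. Qed.

Let double_weight (y s t : R) := gamma_weight a s * (s * gamma_weight a (s * t)) * (1 + cos (y * ln t)).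

Let integral_F y : (\int[lam]_(s in pos) \int[lam]_(t in pos) (double_weight y s t)%:E =
  (Gamma a ^+ 2 + gamma_square a y)%:E)%E.
Proof.
have -> : Gamma a ^+ 2 + gamma_square a y = Gamma a * Gamma a +
    (gamma_cos a y * gamma_cos a y + gamma_sin a y * gamma_sin a y).
  by rewrite /gamma_square; ring.
rewrite -lincomb; apply: eq_integral => s; rewrite inE/= in_itv/= andbT => s0.
have -> : Gamma a + (gamma_cos a y * cos (y * ln s) + gamma_sin a y * sin (y * ln s)) =
  Gamma a + (cos (y * ln s) * gamma_cos a y + sin (y * ln s) * gamma_sin a y) by ring.
rewrite EFinM -inner.
have mG : measurable_fun setT
    (fun t => (gamma_weight a t * (1 + cos (y * ln t - y * ln s)))%:E).
  apply/measurable_EFinP; apply: measurable_funM; first exact: measurable_gamma_weight.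
  exact: measurable_phase.
have G0 t : (0 <= (gamma_weight a t * (1 + cos (y * ln t - y * ln s)))%:E)%E.
  by rewrite lee_fin mulr_ge0 ?expR_ge0.
have ms : measurable_fun setT (fun t : R => s * t) by exact: measurable_funM.
have mGs : measurable_fun setT
    (fun t => (gamma_weight a (s * t) * (1 + cos (y * ln (s * t) - y * ln s)))%:E).
  by apply: (measurableT_comp mG ms).
rewrite (ge0_integral_scale s0 mG G0) -[in RHS]ge0_integralZl//; last 2 first.
  by apply: measurable_funTS; exact: mGs.
  by rewrite lee_fin ltW.
rewrite -[in RHS]ge0_integralZl//.
- apply: eq_integral => t; rewrite inE/= in_itv/= andbT => t0.
  rewrite -!EFinM lnM ?posrE//; apply: (congr1 EFin); rewrite /double_weight.
  have -> : y * (ln s + ln t) - y * ln s = y * ln t by ring.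
  by ring.
- by apply: measurable_funTS; apply: emeasurable_funM.
- by move=> t _; rewrite mule_ge0// lee_fin ltW.
- by rewrite lee_fin expR_ge0.
Qed.

(* Write the product of the two gamma integrals as a double integral, substitute
   [t := s tau] and integrate with respect to [s] first. Adding 1 to the cosine
   makes all integrands nonnegative. *)
Lemma ghs_weight_beta x :
  (\int[lam]_(t in pos) (beta_weight t * (1 + cos (x / 2 * ln t)))%:E =
  (ghs_weight r x + ghs_weight r 0)%:E)%E.
Proof.
pose y := x / 2; have G0 : 0 < Gamma r by exact: Gamma_gt0.
have ra : r = 2 * a by rewrite /a; field.
have mF : measurable_fun setT (fun z : R * R => double_weight y z.1 z.2).
  apply: measurable_funM.
    apply: measurable_funM; first by apply: measurableT_comp => //; exact: measurable_gamma_weight.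
    apply: measurable_funM => //; apply: measurableT_comp; first exact: measurable_gamma_weight.
    by apply: measurable_funM.
  apply: (measurableT_comp (f := fun t => 1 + cos (y * ln t))) => //.
  apply: measurable_phase; apply: measurable_funM => //; exact: measurable_ln.
have F0 s t : pos s -> pos t -> 0 <= double_weight y s t.
  rewrite /= !in_itv/= !andbT => s0 t0.
  by rewrite mulr_ge0// mulr_ge0 ?expR_ge0// mulr_ge0 ?expR_ge0// ltW.
have := integral_F y; rewrite (ge0_exchange_integral _ _ mpos mpos mF F0) => E.
have {}E : (\int[lam]_(t in pos) (Gamma r * (beta_weight t * (1 + cos (y * ln t))))%:E =
    (Gamma a ^+ 2 + gamma_square a y)%:E)%E.
  rewrite -E; apply: eq_integral => t; rewrite inE/= in_itv/= andbT => t0.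
  have t1 : 0 < 1 + t by rewrite addr_gt0.
  pose G := gamma_weight r.
  have mG : measurable_fun setT (EFin \o G) by apply/measurable_EFinP; exact: measurable_gamma_weight.
  have mGs : measurable_fun setT (fun s => (G ((1 + t) * s))%:E).
    by apply: (measurableT_comp mG); exact: measurable_funM.
  have := integral_gamma_weight r0.
  rewrite (@ge0_integral_scale _ _ (EFin \o G) t1 mG); last by move=> s; rewrite lee_fin expR_ge0.
  pose k := expR ((a - 1) * ln t) * expR (- r * ln (1 + t)) * (1 + cos (y * ln t)).
  have k0 : 0 <= k by rewrite mulr_ge0// mulr_ge0 ?expR_ge0.
  move=> H; have -> : (Gamma r * (beta_weight t * (1 + cos (y * ln t))))%:E = (k%:E * (Gamma r)%:E)%E.
    rewrite -EFinM; apply: (congr1 EFin); rewrite /k -expRD /beta_weight.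
    by rewrite mulNr; ring.
  rewrite -H muleA -EFinM -ge0_integralZl//; last 3 first.
  - exact: measurable_funTS.
  - by move=> s _; rewrite lee_fin expR_ge0.
  - by rewrite lee_fin mulr_ge0// ltW.
  apply: eq_integral => s; rewrite inE/= in_itv/= andbT => s0.
  rewrite -EFinM; apply: (congr1 EFin); rewrite /double_weight gamma_weight_scale// -ra /G /k.
  by rewrite [s * (1 + t)]mulrC; ring.
have mB : measurable_fun setT (fun t => (beta_weight t * (1 + cos (y * ln t)))%:E).
  apply/measurable_EFinP; apply: measurable_funM.
    apply: measurableT_comp => //; apply: measurable_funB.
      by apply: measurable_funM => //; exact: measurable_ln.
    apply: measurable_funM => //; apply: measurableT_comp; first exact: measurable_ln.
    exact: measurable_funD.
  by apply: measurable_phase; apply: measurable_funM => //; exact: measurable_ln.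
have -> : (ghs_weight r x + ghs_weight r 0)%:E =
    ((Gamma r)^-1%:E * (Gamma a ^+ 2 + gamma_square a y)%:E)%E.
  rewrite !ghs_weightE// mul0r -EFinM; apply: (congr1 EFin).
  rewrite /gamma_square -/a -GammaE -/y.
  have -> : gamma_sin a 0 = 0.
    by have := gamma_sinN 0 a0; rewrite oppr0 => ?; lra.
  by field; rewrite gt_eqF.
rewrite -E; under [in RHS]eq_integral do rewrite EFinM.
rewrite ge0_integralZl//; last 3 first.
- exact: measurable_funTS.
- by move=> t _; rewrite lee_fin mulr_ge0 ?expR_ge0.
- by rewrite lee_fin ltW.
by rewrite muleA -EFinM mulVf ?gt_eqF// mul1e.
Qed.

Let measurable_beta : measurable_fun setT beta_weight.
Proof.
apply: measurableT_comp => //; apply: measurable_funB.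
  by apply: measurable_funM => //; exact: measurable_ln.
apply: measurable_funM => //; apply: measurableT_comp; first exact: measurable_ln.
exact: measurable_funD.
Qed.

(** Up to the constant [ghs_weight r 0], the weight is the integral over t of a nonnegative jointly
    measurable function. *)
Lemma measurable_ghs_weight : measurable_fun setT (ghs_weight r).
Proof.
have mK : measurable_fun setT
    (fun z : R * R => beta_weight z.2 * (1 + cos (z.1 / 2 * ln z.2))).
  have ml2 : measurable_fun setT (fun z : R * R => ln z.2).
    by apply: measurableT_comp => //; exact: measurable_ln.
  apply: measurable_funM.
    by apply: measurableT_comp => //; exact: measurable_beta.
  apply: (measurableT_comp (f := fun t => 1 + cos t)); first exact: measurable_phase.
  by apply: measurable_funM => //; apply: measurable_funM.
have K0 (x t : R) : setT x -> pos t -> 0 <= beta_weight t * (1 + cos (x / 2 * ln t)).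
  by move=> _ _; rewrite mulr_ge0 ?expR_ge0.
have := @measurable_fun_ge0_integral R _ _ (measurableTypeR R) _ lam setT pos
  (fun x t : R => beta_weight t * (1 + cos (x / 2 * ln t))) measurableT mpos mK K0 erefl.
under eq_fun do rewrite ghs_weight_beta.
move=> /measurable_EFinP mb.
have -> : ghs_weight r = (fun x => (ghs_weight r x + ghs_weight r 0) - ghs_weight r 0).
  by apply/funext => x; rewrite addrK.
exact: measurable_funB.
Qed.

Local Notation half := ([set` `[0, +oo[] : set R).

Let mhalf : measurable (half : set (measurableTypeR R)). Proof. exact: measurable_itv. Qed.

(** The factor exp (- e x) turns the cosine into the Poisson kernel e / (e^2 + L^2); the summand 1 /
    e belongs to the added 1. The antiderivative F is explicit. *)
Lemma integral_expR_cos (e L : R) : 0 < e ->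
  (\int[lam]_(x in half) (expR (- (e * x)) * (1 + cos (L * x)))%:E =
   (e^-1 + e / (e ^+ 2 + L ^+ 2))%:E)%E.
Proof.
move=> e0; have D0 : 0 < e ^+ 2 + L ^+ 2 by rewrite ltr_wpDr ?sqr_ge0 ?exprn_gt0.
pose f (x : R) := expR (- (e * x)) * (1 + cos (L * x)).
pose F (x : R) := expR (- (e * x)) *
  (- e^-1 + (L * sin (L * x) - e * cos (L * x)) / (e ^+ 2 + L ^+ 2)).
have dF (x : R) : is_derive x 1 F (f x).
  have h1 c : is_derive x 1 (fun y : R => c * y) c.
    by apply: is_derive_eq; rewrite /GRing.scale/= mulr1.
  have h2 : is_derive x 1 (fun y : R => expR (- (e * y))) (- e * expR (- (e * x))).
    by apply: is_derive_expR_comp; have := h1 e => h; exact: is_deriveN.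
  have h3 := @is_derive1_comp R sin (fun y => L * y) x _ _ (is_derive_sin _) (h1 L).
  have h4 := @is_derive1_comp R cos (fun y => L * y) x _ _ (is_derive_cos _) (h1 L).
  have h5 : is_derive x 1 (fun y : R => - e^-1 + (L * sin (L * y) - e * cos (L * y)) / (e ^+ 2 + L ^+ 2))
      ((L * (cos (L * x) * L) - e * (- sin (L * x) * L)) / (e ^+ 2 + L ^+ 2)).
    have k1 := is_deriveB (is_deriveZ L h3) (is_deriveZ e h4).
    have k2 := is_deriveM k1 (is_derive_cst (e ^+ 2 + L ^+ 2)^-1 x 1).
    have k3 := is_deriveD (is_derive_cst (- e^-1) x 1) k2.
    by apply: (is_derive_eq k3); rewrite /GRing.scale/= mulr0 !add0r mulrC.
  apply: (is_derive_eq (is_deriveM h2 h5)); rewrite /GRing.scale/= /f.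
  by field; rewrite !gt_eqF.
have cF : continuous F.
  by move=> x; apply: differentiable_continuous; apply/derivable1_diffP; have [] := dF x.
have cf : continuous f.
  move=> x; have ch c : {for x, continuous (fun y : R => c * y)}.
    by apply: cvgM; [exact: cvg_cst|exact: cvg_id].
  apply: cvgM.
    apply: (@continuous_comp _ _ _ (fun y => - (e * y)) expR); last exact: continuous_expR.
    by apply: cvgN; exact: ch.
  apply: cvgD; first exact: cvg_cst.
  by apply: (@continuous_comp _ _ _ (fun y => L * y) cos); [exact: ch|exact: continuous_cos].
rewrite (@ge0_continuous_FTC2y R f F 0 0).
- rewrite -EFinB; apply: (congr1 EFin); rewrite /F !mulr0 oppr0 expR0 sin0 cos0.
  by field; rewrite !gt_eqF.
- by move=> x _; rewrite mulr_ge0 ?expR_ge0.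
- exact: continuous_subspaceT.
- pose M := e^-1 + (`|L| + e) / (e ^+ 2 + L ^+ 2).
  have expy : expR (- (e * x)) * M @[x --> +oo] --> (0 : R).
    rewrite -[X in _ --> X](mul0r M); apply: cvgM; last exact: cvg_cst.
    have h : (e * x) @[x --> +oo] --> +oo by apply: gt0_cvgMry; [exact: e0|exact: cvg_id].
    by have := @cvgr_expR R; move=> /(cvg_comp _ _ h); exact.
  have expN : - (expR (- (e * x)) * M) @[x --> +oo] --> (0 : R).
    by rewrite -[X in _ --> X]oppr0; exact: cvgN.
  apply: (squeeze_cvgr _ expN expy); apply: nearW => x; rewrite -ler_norml.
  rewrite normrM (ger0_norm (expR_ge0 _)) ler_wpM2l ?expR_ge0//.
  apply: le_trans (ler_normD _ _) _; rewrite normrN gtr0_norm ?invr_gt0//.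
  rewrite lerD2l normrM normfV (gtr0_norm D0) ler_wpM2r ?invr_ge0 ?(ltW D0)//.
  apply: le_trans (ler_normB _ _) _; rewrite !normrM (gtr0_norm e0).
  by apply: lerD; rewrite ler_piMr// ?(ltW e0).
- by move=> x _; have [] := dF x.
- by apply: cvg_at_right_filter; exact: cF.
- by move=> x _; exact: is_derive_derive1 (dF x).
Qed.

Let kernel (e t : R) : R := e / (e ^+ 2 + (ln t / 2) ^+ 2).

Let kernel_ge0 e t : 0 < e -> 0 <= kernel e t.
Proof. by move=> e0; rewrite divr_ge0 ?(ltW e0)// addr_ge0 ?sqr_ge0. Qed.

(* Measurability of the inverse is read off from [expR (- ln u)]. *)
Let measurable_kernel e : 0 < e -> measurable_fun setT (kernel e).
Proof.
move=> e0; have -> : kernel e = fun t => e * expR (- ln (e ^+ 2 + (ln t / 2) ^+ 2)).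
  apply/funext => t; rewrite /kernel expRN lnK// posrE ltr_wpDr ?sqr_ge0 ?exprn_gt0//.
apply: measurable_funM => //; apply: measurableT_comp => //.
apply: measurableT_comp => //; apply: measurableT_comp; first exact: measurable_ln.
by apply: measurable_funD => //; apply: measurable_funX; apply: measurable_funM => //.
Qed.

Let beta_ge0 t : 0 <= beta_weight t. Proof. exact: expR_ge0. Qed.

Let measurable_beta_kernel e : 0 < e -> measurable_fun setT (fun t => beta_weight t * kernel e t).
Proof. by move=> e0; apply: measurable_funM; [exact: measurable_beta|exact: measurable_kernel]. Qed.

Let beta_kernel_ge0 e t : 0 < e -> 0 <= beta_weight t * kernel e t.
Proof. by move=> e0; rewrite mulr_ge0 ?kernel_ge0. Qed.

Let measurable_expRN e : measurable_fun setT (fun x : R => expR (- (e * x))).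
Proof.
by apply: measurableT_comp => //; apply: measurableT_comp => //; exact: measurable_funM.
Qed.

Let measurable_beta_cos (x : R) :
  measurable_fun setT (fun t => beta_weight t * (1 + cos (x / 2 * ln t))).
Proof.
apply: measurable_funM; first exact: measurable_beta.
by apply: measurable_phase; apply: measurable_funM => //; exact: measurable_ln.
Qed.

Let measurable_expRN_cos (e L : R) :
  measurable_fun setT (fun x : R => expR (- (e * x)) * (1 + cos (L * x))).
Proof.
apply: measurable_funM; first exact: measurable_expRN.
by apply: measurable_phase; exact: measurable_funM.
Qed.

(** Abel regularization of the mass of the weight: exchanging the integrals leaves the Beta density
    against a Poisson kernel in ln t / 2, which concentrates at t = 1 as e tends to 0. The
    contributions of the added 1 are finite and equal on both sides. *)
Lemma integral_expR_ghs_weight (e : R) : 0 < e ->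
  (\int[lam]_(x in half) (expR (- (e * x)) * ghs_weight r x)%:E =
   \int[lam]_(t in pos) (beta_weight t * kernel e t)%:E)%E.
Proof.
move=> e0; pose b := ghs_weight r.
have me := measurable_expRN e.
have mE : measurable_fun setT (fun z : R * R =>
    expR (- (e * z.1)) * (beta_weight z.2 * (1 + cos (z.1 / 2 * ln z.2)))).
  have m2 : measurable_fun setT (fun z : R * R => ln z.2).
    by apply: measurableT_comp => //; exact: measurable_ln.
  apply: measurable_funM; first exact: (measurableT_comp me).
  apply: measurable_funM; first by apply: measurableT_comp => //; exact: measurable_beta.
  apply: (measurableT_comp (f := fun t => 1 + cos t)); first exact: measurable_phase.
  by apply: measurable_funM => //; exact: measurable_funM.
have E0 (x t : R) : half x -> pos t ->
    0 <= expR (- (e * x)) * (beta_weight t * (1 + cos (x / 2 * ln t))).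
  by move=> _ _; rewrite !mulr_ge0 ?expR_ge0.
have H := ge0_exchange_integral lam lam mhalf mpos mE E0.
have mb := measurable_ghs_weight.
have b0 x : 0 <= b x := ghs_weight_ge0 x r0.
have ebx_ge0 x : 0 <= expR (- (e * x)) * b x by rewrite mulr_ge0 ?expR_ge0.
(* When the cosine is identically 1, the formulas with 1 + cos give twice the integrals needed for
   the cancellation. *)
have twice (D : set R) (f : R -> R) (z : R) : measurable (D : set (measurableTypeR R)) ->
    measurable_fun setT f -> (forall x, 0 <= f x) ->
    (\int[lam]_(x in D) (2 * f x)%:E = (2 * z)%:E)%E -> (\int[lam]_(x in D) (f x)%:E = z%:E)%E.
  move=> mD mf f0 h.
  have := ge0_integralM_EFin lam mD mf (fun x _ => f0 x) (ler0n R 2).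
  rewrite h => /(congr1 (fun u => (2^-1)%:E * u)%E).
  rewrite muleA -!EFinM mulrA mulVf ?pnatr_eq0; last by [].
  by rewrite mul1e mul1r => <-.
have b0E : (\int[lam]_(t in pos) (beta_weight t)%:E = (b 0)%:E)%E.
  apply: (twice _ _ _ mpos measurable_beta (fun t => expR_ge0 _)).
  have -> : 2 * b 0 = b 0 + b 0 by ring.
  rewrite -(ghs_weight_beta 0); apply: eq_integral => t _.
  by rewrite mul0r mul0r cos0 mulrC.
have eE : (\int[lam]_(x in half) (expR (- (e * x)))%:E = (e^-1)%:E)%E.
  apply: (twice _ _ _ mhalf me (fun t => expR_ge0 _)).
  have -> : 2 * e^-1 = e^-1 + e / (e ^+ 2 + 0 ^+ 2).
    by rewrite expr0n addr0; field; rewrite gt_eqF.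
  rewrite -(integral_expR_cos 0 e0); apply: eq_integral => t _.
  by rewrite mul0r cos0 mulrC.
have be0 x : 0 <= b 0 * expR (- (e * x)) by rewrite mulr_ge0 ?expR_ge0.
have meb : measurable_fun setT (fun x => expR (- (e * x)) * b x) by exact: measurable_funM.
have mbe : measurable_fun setT (fun x => b 0 * expR (- (e * x))) by exact: measurable_funM.
have mbx := measurable_beta_cos.
have bx0 (x t : R) : 0 <= beta_weight t * (1 + cos (x / 2 * ln t)).
  by rewrite mulr_ge0 ?expR_ge0.
have HL : (\int[lam]_(x in half) \int[lam]_(t in pos)
    (expR (- (e * x)) * (beta_weight t * (1 + cos (x / 2 * ln t))))%:E =
    \int[lam]_(x in half) (expR (- (e * x)) * b x)%:E + (b 0 * e^-1)%:E)%E.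
  rewrite EFinM -eE -(ge0_integralM_EFin lam mhalf me (fun x _ => expR_ge0 _) (b0 0)).
  rewrite -(ge0_integralD_EFin lam mhalf meb mbe (fun x _ => ebx_ge0 x) (fun x _ => be0 x)).
  apply: eq_integral => x _.
  rewrite (ge0_integralM_EFin lam mpos (mbx x) (fun t _ => bx0 x t) (expR_ge0 _)).
  rewrite ghs_weight_beta -EFinM; apply: (congr1 EFin); rewrite -/b; ring.
have HR : (\int[lam]_(t in pos) \int[lam]_(x in half)
    (expR (- (e * x)) * (beta_weight t * (1 + cos (x / 2 * ln t))))%:E =
    \int[lam]_(t in pos) (beta_weight t * kernel e t)%:E + (b 0 * e^-1)%:E)%E.
  have e'0 : 0 <= e^-1 by rewrite invr_ge0 ltW.
  have mbk := measurable_beta_kernel e0.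
  have mbc : measurable_fun setT (fun t => e^-1 * beta_weight t).
    by apply: measurable_funM; [exact: measurable_cst|exact: measurable_beta].
  have bk0 t := beta_kernel_ge0 t e0.
  have bc0 t : 0 <= e^-1 * beta_weight t by rewrite mulr_ge0 ?expR_ge0.
  rewrite [b 0 * _]mulrC EFinM -b0E.
  rewrite -(ge0_integralM_EFin lam mpos measurable_beta (fun x _ => beta_ge0 x) e'0).
  rewrite -(ge0_integralD_EFin lam mpos mbk mbc (fun x _ => bk0 x) (fun x _ => bc0 x)).
  apply: eq_integral => t _.
  have mec := measurable_expRN_cos e (ln t / 2).
  have ec0 (x : R) : 0 <= expR (- (e * x)) * (1 + cos (ln t / 2 * x)).
    by rewrite mulr_ge0 ?expR_ge0.
  transitivity ((beta_weight t)%:E *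
     \int[lam]_(x in half) (expR (- (e * x)) * (1 + cos (ln t / 2 * x)))%:E)%E.
    rewrite -(ge0_integralM_EFin lam mhalf mec (fun x _ => ec0 x) (beta_ge0 t)).
    apply: eq_integral => x _; apply: (congr1 EFin).
    have -> : x / 2 * ln t = ln t / 2 * x by ring.
    by ring.
  rewrite (integral_expR_cos _ e0) -EFinM; apply: (congr1 EFin); rewrite /kernel; ring.
move: H; rewrite HL HR => H.
have := congr1 (fun z => z - (b 0 * e^-1)%:E)%E H.
by rewrite !addeK.
Qed.

Section kernel_mass.
Variable e : R.
Hypothesis e0 : 0 < e.

Let G (t : R) := 2 * atan (ln t / (2 * e)).

Let dG (t : R) : 0 < t -> is_derive t 1 G (expR (- ln t) * kernel e t).
Proof.
move=> t0; have h1 := is_derive1_ln t0.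
have h2 : is_derive t 1 (fun t => ln t / (2 * e)) (t^-1 / (2 * e)).
  by apply: (is_derive_eq (is_deriveM h1 (is_derive_cst (2 * e)^-1 t 1)));
    rewrite /GRing.scale/= mulr0 add0r mulrC.
have h3 := @is_derive1_comp R (@atan R) (fun t => ln t / (2 * e)) t _ _ (is_derive1_atan _) h2.
have h4 := is_deriveZ 2 h3.
apply: (is_derive_eq h4); rewrite /GRing.scale/= /kernel expRN lnK//; field.
have p : 0 < e ^+ 2 + (ln t / 2) ^+ 2 by rewrite ltr_wpDr ?sqr_ge0 ?exprn_gt0.
rewrite !gt_eqF//.
  by apply: lt_le_trans (_ : 0 < 4 * (e ^+ 2 + (ln t / 2) ^+ 2)) _; [lra|lra].
Qed.

Let cG (t : R) : 0 < t -> {for t, continuous (fun t => expR (- ln t) * kernel e t)}.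
Proof.
move=> t0; have p : 0 < e ^+ 2 + (ln t / 2) ^+ 2 by rewrite ltr_wpDr ?sqr_ge0 ?exprn_gt0.
apply: cvgM.
  apply: (@continuous_comp _ _ _ (fun t => - ln t) expR); last exact: continuous_expR.
  by apply: cvgN; exact: continuous_ln.
apply: cvgM; first exact: cvg_cst.
apply: cvgV; first by rewrite gt_eqF.
apply: cvgD; first exact: cvg_cst.
apply: (@continuous_comp _ _ _ (fun t => ln t / 2) (fun x => x ^+ 2)); last exact: exprn_continuous.
by apply: cvgM; [exact: continuous_ln|exact: cvg_cst].
Qed.

(** Against dt / t, the kernel is a Cauchy density in ln t scaled to mass 2 pi, for every e. *)
Lemma kernel_mass : (\int[lam]_(t in pos) (expR (- ln t) * kernel e t)%:E = (2 * pi)%:E)%E.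
Proof.
have -> : 2 * pi = pi - (- pi) :> R by ring.
have h : (fun n : nat => n%:R / (2 * e)) @ \oo --> +oo.
  have k : 0 < (2 * e)^-1 by rewrite invr_gt0 mulr_gt0.
  exact: (cvg_comp _ _ (@cvgr_idn R) (gt0_cvgMly k cvg_id)).
have h2 : 2 * atan (n%:R / (2 * e)) @[n --> \oo] --> (2 * (pi / 2) : R).
  by apply: cvgM; [exact: cvg_cst|exact: (cvg_comp _ _ h (@cvgy_atan R))].
apply: (@ge0_integral_pos R G (fun t => expR (- ln t) * kernel e t) pi (- pi)).
- exact: dG.
- exact: cG.
- have -> : (fun n : nat => G (expR n%:R)) = (fun n => 2 * atan (n%:R / (2 * e))).
    by apply/funext => n; rewrite /G expRK.
  by rewrite (_ : pi = 2 * (pi / 2)) //; field.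
- have -> : (fun n : nat => G (expR (- n%:R))) = (fun n => - (2 * atan (n%:R / (2 * e)))).
    by apply/funext => n; rewrite /G expRK mulNr atanN mulrN.
  by apply: cvgN; rewrite (_ : pi = 2 * (pi / 2)) //; field.
- by move=> x x0; rewrite mulr_ge0 ?expR_ge0 ?kernel_ge0.
Qed.

Lemma kernel_mass_itv (A : R) : 0 < A ->
  (\int[lam]_(t in [set` `[expR (- A), expR A]]) (expR (- ln t) * kernel e t)%:E =
   (4 * atan (A / (2 * e)))%:E)%E.
Proof.
move=> A0; have xpos (x : R) : expR (- A) <= x -> 0 < x by apply: lt_le_trans; exact: expR_gt0.
have cGG (x : R) : 0 < x -> {for x, continuous G}.
  move=> x0; apply: differentiable_continuous; apply/derivable1_diffP.
  by have [] := dG x0.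
have AN : expR (- A) < expR A by rewrite ltr_expR; lra.
rewrite (@continuous_FTC2 R (fun t => expR (- ln t) * kernel e t) G _ _ AN).
- rewrite /G !expRK mulNr atanN -EFinB; apply: (congr1 EFin); ring.
- apply: continuous_in_subspaceT => x; rewrite inE/= in_itv/= => /andP[/xpos x0 _].
  exact: cG.
- split.
  + by move=> x; rewrite in_itv/= => /andP[/ltW/xpos x0 _]; have [] := dG x0.
  + by apply: cvg_at_right_filter; exact/cGG/xpos.
  + by apply: cvg_at_left_filter; exact/cGG/xpos/ltW.
- by move=> x; rewrite in_itv/= => /andP[/ltW/xpos x0 _]; exact: is_derive_derive1 (dG x0).
Qed.

End kernel_mass.

(** K = 2^(-r) is the value of t [beta_weight t] at t = 1. *)
Let K : R := expR (- (r * ln 2)).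

(** 4 t <= (1 + t)^2, so t^a (1 + t)^(-2a) is largest at t = 1. *)
Let beta_weight_le t : 0 < t -> beta_weight t <= K * expR (- ln t).
Proof.
move=> t0; have t1 : 0 < 1 + t by rewrite addr_gt0.
rewrite /K -expRD ler_expR.
have : ln (4 * t) <= ln ((1 + t) ^+ 2).
  rewrite ler_ln ?posrE ?exprn_gt0 ?mulr_gt0//.
  by rewrite -subr_ge0 (_ : _ - _ = (1 - t) ^+ 2) ?sqr_ge0//; ring.
rewrite lnXn// lnM ?posrE// (_ : 4 = 2 ^+ 2 :> R) ?lnXn//; last by ring.
rewrite !mulr2n => H; have := ler_wpM2l (ltW r0) H.
rewrite /a; move: (ln 2) (ln t) (ln (1 + t)) => u v w; lra.
Qed.

(** In the window |ln t| <= A, at most the factor exp (- r A / 2) is lost against the maximum. *)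
Let beta_weight_ge A t : expR (- A) <= t <= expR A ->
  K * expR (- (r * A / 2)) * expR (- ln t) <= beta_weight t.
Proof.
move=> /andP[At tA]; have t0 : 0 < t by apply: lt_le_trans At; exact: expR_gt0.
have t1 : 0 < 1 + t by rewrite addr_gt0.
have l1 : - A <= ln t by rewrite -(expRK (- A)) ler_ln ?posrE ?expR_gt0.
have l2 : ln t <= A by rewrite -(expRK A) ler_ln ?posrE ?expR_gt0.
rewrite /K -!expRD ler_expR.
have H : ln (1 + t) <= ln 2 + ln t / 2 + A / 2.
  have [t1'|/ltW t1'] := leP t 1.
    apply: (@le_trans _ _ (ln 2)); last lra.
    by rewrite ler_ln ?posrE//; lra.
  apply: (@le_trans _ _ (ln (2 * t))).
    by rewrite ler_ln ?posrE ?mulr_gt0//; lra.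
  by rewrite lnM ?posrE//; lra.
have := ler_wpM2l (ltW r0) H.
rewrite /a; move: (ln 2) (ln t) (ln (1 + t)) => u v w; lra.
Qed.

(** The regularized integrals lie below K times the full mass of the kernel, and above nearly K
    times its mass in a window around t = 1; monotone convergence removes the regularization. *)
Lemma integral_half_ghs_weight :
  (\int[lam]_(x in half) (ghs_weight r x)%:E = (2 * pi * K)%:E)%E.
Proof.
have mb := measurable_ghs_weight; have b0 x := ghs_weight_ge0 x r0.
have K0 : 0 <= K by exact: expR_ge0.
have mk e : 0 < e -> measurable_fun setT (fun t => expR (- ln t) * kernel e t).
  move=> e0; apply: measurable_funM; last exact: measurable_kernel.
  by apply: measurableT_comp => //; apply: measurableT_comp => //; exact: measurable_ln.
have k0 e t : 0 < e -> 0 <= expR (- ln t) * kernel e t.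
  by move=> e0; rewrite mulr_ge0 ?expR_ge0 ?kernel_ge0.
have upper e : 0 < e ->
    (\int[lam]_(x in half) (expR (- (e * x)) * ghs_weight r x)%:E <= (2 * pi * K)%:E)%E.
  move=> e0; rewrite integral_expR_ghs_weight// mulrC EFinM -(kernel_mass e0).
  rewrite -(ge0_integralM_EFin lam mpos (mk e e0) (fun t _ => k0 e t e0) K0).
  apply: ge0_le_integral.
  - exact: mpos.
  - by move=> t _; rewrite lee_fin beta_kernel_ge0.
  - by apply: measurable_funTS; apply/measurable_EFinP; exact: measurable_beta_kernel.
  - apply: measurable_funTS; apply/measurable_EFinP; apply: measurable_funM; first by [].
    exact: mk.
  - move=> t; rewrite /= in_itv/= andbT => t0.
    by rewrite lee_fin mulrA ler_wpM2r ?kernel_ge0 ?beta_weight_le.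
have lower e A : 0 < e -> 0 < A ->
    ((K * expR (- (r * A / 2)) * (4 * atan (A / (2 * e))))%:E <=
     \int[lam]_(x in half) (expR (- (e * x)) * ghs_weight r x)%:E)%E.
  move=> e0 A0; pose D : set R := [set` `[expR (- A), expR A]].
  have mD : measurable (D : set (measurableTypeR R)) by exact: measurable_itv.
  have KA0 : 0 <= K * expR (- (r * A / 2)) by rewrite mulr_ge0 ?expR_ge0.
  have Dpos : D `<=` pos.
    move=> t; rewrite /D/= !in_itv/= andbT => /andP[+ _].
    by apply: lt_le_trans; exact: expR_gt0.
  rewrite integral_expR_ghs_weight// EFinM -(kernel_mass_itv e0 A0).
  rewrite -(ge0_integralM_EFin lam mD (mk e e0) (fun t _ => k0 e t e0) KA0).
  have mbkE : measurable_fun pos (fun t => (beta_weight t * kernel e t)%:E).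
    by apply: measurable_funTS; apply/measurable_EFinP; exact: measurable_beta_kernel.
  have sub : (\int[lam]_(t in D) (beta_weight t * kernel e t)%:E <=
      \int[lam]_(t in pos) (beta_weight t * kernel e t)%:E)%E.
    apply: ge0_subset_integral; [exact: mD|exact: mpos|exact: mbkE| |exact: Dpos].
    by move=> t _; rewrite lee_fin beta_kernel_ge0.
  apply: le_trans sub; apply: ge0_le_integral.
  - exact: mD.
  - by move=> t _; rewrite lee_fin; exact: mulr_ge0 KA0 (k0 _ _ e0).
  - apply: measurable_funTS; apply/measurable_EFinP; apply: measurable_funM; first by [].
    exact: mk.
  - by apply: measurable_funS mbkE.
  - move=> t; rewrite /D/= in_itv/= => tA.
    by rewrite lee_fin mulrA ler_wpM2r ?kernel_ge0 ?beta_weight_ge.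
have le_full e : 0 < e ->
    (\int[lam]_(x in half) (expR (- (e * x)) * ghs_weight r x)%:E <=
     \int[lam]_(x in half) (ghs_weight r x)%:E)%E.
  move=> e0; apply: ge0_le_integral.
  - exact: mhalf.
  - by move=> x _; rewrite lee_fin mulr_ge0 ?expR_ge0.
  - apply: measurable_funTS; apply/measurable_EFinP.
    by apply: measurable_funM; [exact: measurable_expRN|exact: mb].
  - by apply: measurable_funTS; apply/measurable_EFinP.
  - move=> x; rewrite /= in_itv/= andbT => x0.
    by rewrite lee_fin ler_piMl// -expR0 ler_expR oppr_le0 mulr_ge0// ltW.
pose e (n : nat) : R := n.+1%:R^-1.
have e0 n : 0 < e n by rewrite invr_gt0.
have ecvg : e n @[n --> \oo] --> (0 : R) by exact: cvg_harmonic.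
pose g (n : nat) (x : R) := (expR (- (e n * x)) * ghs_weight r x)%:E.
have expcvg (x : R) : expR (- (e n * x)) @[n --> \oo] --> (1 : R).
  rewrite -[X in _ --> X]expR0; apply: continuous_cvg; first exact: continuous_expR.
  rewrite -[X in _ --> X]oppr0; apply: cvgN; rewrite -[X in _ --> X](mul0r x).
  by apply: cvgM => //; exact: cvg_cst.
have gcvg x : g n x @[n --> \oo] --> (ghs_weight r x)%:E.
  apply: cvg_EFin; first exact: nearW.
  have -> : fine \o g^~ x = fun n => expR (- (e n * x)) * ghs_weight r x by [].
  rewrite -[X in _ --> X](mul1r (ghs_weight r x)).
  by apply: cvgM; [exact: expcvg|exact: cvg_cst].
have mono := @cvg_monotone_convergence _ (measurableTypeR R) R lam half mhalf g _ _ _.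
have {}mono : (\int[lam]_(x in half) g n x @[n --> \oo] -->
    \int[lam]_(x in half) (ghs_weight r x)%:E)%E.
  have -> : (\int[lam]_(x in half) (ghs_weight r x)%:E = \int[lam]_(x in half) limn (g^~ x))%E.
    by apply: eq_integral => x _; rewrite (cvg_lim _ (gcvg x)).
  apply: mono.
  - move=> n; apply: measurable_funTS; apply/measurable_EFinP.
    by apply: measurable_funM; [exact: measurable_expRN|exact: mb].
  - by move=> n x _; rewrite lee_fin mulr_ge0 ?expR_ge0.
  - move=> x; rewrite /= in_itv/= andbT => x0 n m nm.
    rewrite lee_fin ler_wpM2r// ler_expR lerN2 ler_wpM2r//.
    by rewrite lef_pV2 ?posrE// ler_nat.
have le2 : (\int[lam]_(x in half) (ghs_weight r x)%:E <= (2 * pi * K)%:E)%E.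
  rewrite -(cvg_lim _ mono)//; apply: lime_le; first exact: cvgP mono.
  by apply: nearW => n; exact: upper.
have fin : (\int[lam]_(x in half) (ghs_weight r x)%:E)%E \is a fin_num.
  rewrite ge0_fin_numE; first exact: le_lt_trans le2 (ltry _).
  by apply: integral_ge0 => x _; rewrite lee_fin.
apply/eqP; rewrite eq_le le2/= -(fineK fin) lee_fin.
(* Lower bound for the regularization e_n^2 and the window A = e_n = 1/(n+1): the window shrinks to
   t = 1, yet A / (2 e_n^2) = (n + 1) / 2 tends to infinity, so it captures the whole mass of the
   kernel. *)
pose c n := K * expR (- (r * e n / 2)) * (4 * atan (n.+1%:R / 2)).
have ccvg : c n @[n --> \oo] --> 2 * pi * K.
  have -> : 2 * pi * K = K * 1 * (4 * (pi / 2)) by field.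
  apply: cvgM.
    apply: cvgM; first exact: cvg_cst.
    rewrite -[X in _ --> X]expR0; apply: continuous_cvg; first exact: continuous_expR.
    rewrite -[X in _ --> X]oppr0; apply: cvgN.
    have h : r * e n / 2 @[n --> \oo] --> r * 0 / 2.
      by apply: cvgM; [apply: cvgM => //; exact: cvg_cst|exact: cvg_cst].
    by rewrite mulr0 mul0r in h.
  apply: cvgM; first exact: cvg_cst.
  have h : (fun n : nat => n.+1%:R / 2 : R) @ \oo --> +oo.
    have k : 0 < 2^-1 :> R by rewrite invr_gt0.
    have h : (fun n : nat => n.+1%:R : R) @ \oo --> +oo.
      by have := @cvgr_idn R; rewrite -cvg_shiftS.
    exact: (cvg_comp _ _ h (gt0_cvgMly k cvg_id)).
  exact: (cvg_comp _ _ h (@cvgy_atan R)).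
rewrite -(cvg_lim _ ccvg)//; apply: limr_le; first exact: cvgP ccvg.
apply: nearW => n; rewrite -lee_fin fineK//.
have ee0 : 0 < e n ^+ 2 by rewrite exprn_gt0.
apply: le_trans (le_full _ ee0); apply: le_trans (lower _ (e n) ee0 (e0 n)).
rewrite /c (_ : e n / (2 * e n ^+ 2) = n.+1%:R / 2)// /e.
have := pnatr_eq0 R n.+1; move: (n.+1%:R : R) => z /= /negbT z0.
by field.
Qed.

End ghs_weight_integral.

Lemma is_derive_horner (R : realType) (p : {poly R}) (x : R) :
  is_derive x 1 (horner p) p^`().[x].
Proof.
by apply: DeriveDef; [exact: derivable_horner|rewrite -derive1E derivE].
Qed.

(** * Derivatives of the partition function of the NEF-GHS family *)

Section ghs_partition_derivatives.
Context {R : realType}.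
Implicit Types (r x : R) (k : nat).

Let quarter x := - (pi / 2) < x < pi / 2.

(** 4 pi (2 cos x)^(-r), the inverse of the normalizing factor of the density. *)
Definition ghs_partition r x : R := 4 * pi * expR (- (r * ln 2) - r * ln (cos x)).

(* [(p o tan) s] has derivative [((1 + X^2) p' + r X p) o tan) s] when
   [s = cos ^ (- r)]. *)
Fixpoint ghs_poly r k : {poly R} :=
  if k is k'.+1 then
    (1 + 'X ^+ 2) * (ghs_poly r k')^`() + r%:P * 'X * ghs_poly r k'
  else 1.

Definition ghs_derivative r k x := (ghs_poly r k).[tan x] * ghs_partition r x.

Let ghs_polyS r k : ghs_poly r k.+1 =
  (1 + 'X ^+ 2) * (ghs_poly r k)^`() + r%:P * 'X * ghs_poly r k.
Proof. by []. Qed.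

Lemma ghs_poly1 r : ghs_poly r 1 = r%:P * 'X.
Proof. by rewrite ghs_polyS /= -polyC1 derivC mulr0 add0r mulr1. Qed.

(** For s = cos^(-r) one has s'' = r (r + 1) cos^(-r-2) - r^2 s; this is the k-th derivative of that
    equation, in terms of the polynomials in tan. *)
Lemma ghs_poly_rec r k : ghs_poly r k.+2 =
  r%:P * (r%:P + 1) * (1 + 'X ^+ 2) * ghs_poly (r + 2) k - r%:P * r%:P * ghs_poly r k.
Proof.
elim: k => [|k IH].
  rewrite ghs_polyS ghs_poly1 derivM derivC derivX /=; ring.
have dX : (1 + 'X ^+ 2 : {poly R})^`() = 2 * 'X.
  by rewrite derivD derivXn -polyC1 derivC add0r /= mulr_natl.
have d1 : (r%:P + 1 : {poly R})^`() = 0 by rewrite derivD derivC -polyC1 derivC addr0.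
have c2 : (r + 2)%:P = r%:P + 2 :> {poly R} by rewrite polyCD polyCMn.
rewrite ghs_polyS IH [ghs_poly (r + 2) k.+1]ghs_polyS [ghs_poly r k.+1]ghs_polyS c2.
rewrite derivB !derivM !derivC d1 dX.
move: (ghs_poly (r + 2) k) (ghs_poly r k) => Q W; ring.
Qed.

Lemma cos_neq0 x : quarter x -> cos x != 0.
Proof. by move=> xq; rewrite gt_eqF// cos_gt0_pihalf. Qed.

Let tanE x : quarter x -> cos x ^- 2 = 1 + tan x ^+ 2.
Proof.
move=> xq; have c0 := cos_neq0 xq; have := cos2Dsin2 x.
rewrite /tan => E; apply: (mulIf (expf_neq0 2 c0)).
have -> : (1 + (sin x / cos x) ^+ 2) * cos x ^+ 2 = cos x ^+ 2 + sin x ^+ 2 by field.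
by rewrite E mulVf// expf_neq0.
Qed.

Let is_derive_ghs_partition r x : quarter x ->
  is_derive x 1 (ghs_partition r) (r * tan x * ghs_partition r x).
Proof.
move=> xq; have c0 : 0 < cos x by exact: cos_gt0_pihalf.
have h1 := is_derive_ln_comp (is_derive_cos x) c0.
have h2 := is_deriveB (is_derive_cst (- (r * ln 2)) x 1) (is_deriveZ r h1).
have h3 := is_deriveZ (4 * pi) (is_derive_expR_comp h2).
apply: (is_derive_eq h3); rewrite /GRing.scale/= /ghs_partition /tan.
by field; rewrite gt_eqF.
Qed.

Lemma is_derive_ghs_derivative r k x : quarter x ->
  is_derive x 1 (ghs_derivative r k) (ghs_derivative r k.+1 x).
Proof.
move=> xq; have ht := is_derive_tan (cos_neq0 xq).
have h1 := @is_derive1_comp R (horner (ghs_poly r k)) tan x _ _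
  (is_derive_horner (ghs_poly r k) (tan x)) ht.
apply: (is_derive_eq (is_deriveM h1 (is_derive_ghs_partition r xq))).
rewrite /ghs_derivative ghs_polyS tanE// /GRing.scale/=.
rewrite !(hornerD, hornerM, hornerC, hornerXn, hornerX); ring.
Qed.

(** The counterpart of x^2 b_r = 4 r (r + 1) b_(r+2) - r^2 b_r for the weight b_r: two derivatives
    correspond to a factor x^2 under the integral. *)
Lemma ghs_derivative_rec r k x : quarter x -> ghs_derivative r k.+2 x =
  4 * r * (r + 1) * ghs_derivative (r + 2) k x - r ^+ 2 * ghs_derivative r k x.
Proof.
move=> xq; rewrite /ghs_derivative ghs_poly_rec hornerD hornerN !(hornerD, hornerM, hornerC, hornerX).
rewrite -[tan x * tan x]expr2 -tanE//.
have -> : ghs_partition (r + 2) x = ghs_partition r x * (cos x ^- 2 / 4).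
  have c0 : 0 < cos x by exact: cos_gt0_pihalf.
  rewrite /ghs_partition.
  have -> : - ((r + 2) * ln 2) - (r + 2) * ln (cos x) =
      (- (r * ln 2) - r * ln (cos x)) + (- ln (cos x ^+ 2) - ln (2 ^+ 2)).
    by rewrite !lnXn// !mulr2n; ring.
  rewrite [X in 4 * pi * X]expRD [X in _ * (_ * X)]expRD mulrA; congr (_ * _).
  rewrite !expRN !lnK ?posrE ?exprn_gt0//.
  rewrite (_ : 2 ^+ 2 = 4 :> R); last by ring.
  by [].
have c0 := cos_neq0 xq; move: (ghs_partition r x) => u; by field.
Qed.

Lemma ghs_derivative_ge0 r k x : 0 <= r -> 0 <= x < pi / 2 -> 0 <= ghs_derivative r k x.
Proof.
move=> r0 /andP[x0 xq]; have p0 := @pi_gt0 R.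
have Pk i : 0 <= (ghs_poly r k)`_i.
  elim: k i => [|k IH] i; first by rewrite /= coef1; case: (i == 0%N).
  rewrite ghs_polyS mulrDl mul1r coefD coefD !addr_ge0//.
  - by rewrite coef_deriv mulrn_wge0.
  - by rewrite mulrC coefMXn; case: ifP => // _; rewrite coef_deriv mulrn_wge0.
  - by rewrite -mulrA coefCM mulr_ge0// coefXM; case: ifP.
rewrite /ghs_derivative mulr_ge0//; last first.
  by rewrite /ghs_partition !mulr_ge0 ?expR_ge0 ?(ltW p0).
rewrite horner_coef; apply: sumr_ge0 => i _; rewrite mulr_ge0 ?exprn_ge0//.
rewrite /tan divr_ge0//.
  by apply: sin_ge0_pi; lra.
by apply: cos_ge0_pihalf; lra.
Qed.

End ghs_partition_derivatives.

(** * The Laplace transform of the NEF-GHS weight *)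

Section fold.
Context {R : realType}.
Local Notation lam := (@lebesgue_measure R).
Local Notation half := ([set` `[0, +oo[] : set R).

Lemma ge0_integral_fold (f : R -> R) : measurable_fun setT f -> (forall x, 0 <= f x) ->
  (\int[lam]_x (f x)%:E = \int[lam]_(x in half) (f x + f (- x))%:E)%E.
Proof.
move=> mf f0; pose neg : set R := [set` `]-oo, 0[].
have mhalf : measurable (half : set (measurableTypeR R)) by exact: measurable_itv.
have mneg : measurable (neg : set (measurableTypeR R)) by exact: measurable_itv.
have mE : measurable_fun setT (EFin \o f) by exact/measurable_EFinP.
have mN : measurable_fun setT (fun x : R => f (- x)) by apply: measurableT_comp.
rewrite (ge0_integralD_EFin lam mhalf mf mN (fun x _ => f0 x) (fun x _ => f0 (- x))).
have -> : (\int[lam]_(x in half) (f (- x))%:E = \int[lam]_(x in neg) (f x)%:E)%E.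
  have := @ge0_integration_by_substitution0 R (fun x => (f (- x))%:E).
  move=> -> //; last 2 first.
  - exact/measurable_EFinP.
  - by move=> x; rewrite lee_fin.
  pose npos : set R := [set` `]-oo, 0]].
  transitivity (\int[lam]_(x in npos) (f x)%:E)%E.
    by apply: eq_integral => x _; rewrite opprK.
  by rewrite /neg -integral_itv_bndo_bndc//; exact: measurable_funTS.
have -> : [set: R] = half `|` neg.
  apply/seteqP; split=> x //= _; rewrite /neg/= !in_itv/= andbT.
  by case: (leP 0 x); [left|right].
rewrite ge0_integral_setU//.
- exact: measurable_funTS.
- by move=> x _; rewrite lee_fin.
- apply/disj_setPS => x [/=]; rewrite /neg/= !in_itv/= andbT => h1 h2.
  by have := le_lt_trans h1 h2; rewrite ltxx.
Qed.

End fold.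

Section ghs_laplace.
Context {R : realType} (r : R).
Hypothesis r0 : 0 < r.
Local Notation lam := (@lebesgue_measure R).
Local Notation half := ([set` `[0, +oo[] : set R).

Let mhalf : measurable (half : set (measurableTypeR R)). Proof. exact: measurable_itv. Qed.

(** The weight is even, so folding the line onto [0, +oo[ doubles the even moments and cancels the
    odd ones. *)
Let even (k : nat) : R := 1 + (- 1) ^+ k.

Let even_ge0 k : 0 <= even k.
Proof. by rewrite /even -signr_odd; case: (odd k); rewrite ?expr1 ?expr0 ?subrr// addr_ge0. Qed.

Let term_ge0 s k x : 0 < s -> half x -> 0 <= even k * x ^+ k * ghs_weight s x.
Proof.
rewrite /= in_itv/= andbT => s0 x0.
by rewrite mulr_ge0 ?ghs_weight_ge0// mulr_ge0 ?even_ge0 ?exprn_ge0.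
Qed.

Let measurable_term s k : 0 < s ->
  measurable_fun setT (fun x : R => even k * x ^+ k * ghs_weight s x).
Proof.
move=> s0; apply: measurable_funM; last exact: measurable_ghs_weight.
by apply: measurable_funM => //; exact: measurable_funX.
Qed.

Let pihalf0 : - (pi / 2) < (0 : R) < pi / 2.
Proof. by have := @pi_gt0 R; lra. Qed.

(** Both sides satisfy the same recurrence, which expresses k + 2 at s by k at s and at s + 2; hence
    the induction runs over all s at once. It starts from the total mass for k = 0 and from 0 = 0
    for k = 1. *)
Lemma ghs_moment k s : 0 < s ->
  (\int[lam]_(x in half) (even k * x ^+ k * ghs_weight s x)%:E =
   (ghs_derivative s k 0)%:E)%E.
Proof.
move: s; have [n] := ubnP k; elim: n k => // n IH [|[|k]] kn s s0.
- under eq_integral do rewrite expr0 mulr1.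
  have mb := measurable_ghs_weight s0.
  rewrite (ge0_integralM_EFin lam mhalf mb (fun x _ => ghs_weight_ge0 x s0) (even_ge0 0)).
  rewrite (integral_half_ghs_weight s0) -EFinM; apply: (congr1 EFin).
  rewrite /ghs_derivative /= -polyC1 hornerC /ghs_partition cos0 ln1 mulr0 subr0 /even expr0.
  by rewrite /=; ring.
- under eq_integral do rewrite /even expr1 subrr mul0r mul0r.
  rewrite integral0; apply: (congr1 EFin).
  by rewrite /ghs_derivative ghs_poly1 hornerM hornerX tan0 mulr0 mul0r.
rewrite (ghs_derivative_rec _ _ pihalf0).
have s2 : 0 < s + 2 by rewrite addr_gt0.
have c0 : 0 <= 4 * s * (s + 1) by rewrite !mulr_ge0 ?(ltW s0)// addr_ge0 ?(ltW s0).
have E1 := IH k (ltnW (ltnSE kn)) s s0.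
have E2 := IH k (ltnW (ltnSE kn)) (s + 2) s2.
have := ge0_integralM_EFin lam mhalf (measurable_term k s2) (fun x => @term_ge0 (s + 2) k x s2) c0.
rewrite E2 -EFinM => H2.
have := ge0_integralM_EFin lam mhalf (measurable_term k s0) (fun x => @term_ge0 s k x s0) (sqr_ge0 s).
rewrite E1 -EFinM => H1.
have m1 : measurable_fun setT (fun x : R => s ^+ 2 * (even k * x ^+ k * ghs_weight s x)).
  by apply: measurable_funM; [exact: measurable_cst|exact: measurable_term].
have p1 x : half x -> 0 <= s ^+ 2 * (even k * x ^+ k * ghs_weight s x).
  by move=> hx; rewrite mulr_ge0 ?sqr_ge0 ?term_ge0.
have := ge0_integralD_EFin lam mhalf (measurable_term k.+2 s0) m1
  (fun x => @term_ge0 s k.+2 x s0) p1.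
rewrite H1 => /(congr1 (fun z => z - (s ^+ 2 * ghs_derivative s k 0)%:E)%E).
rewrite addeK// => <-.
rewrite EFinB -H2; congr (_ - _)%E; apply: eq_integral => x _; apply: (congr1 EFin).
rewrite ghs_weight_rec// /even !exprS; field.
by rewrite !gt_eqF// addr_gt0.
Qed.

Let cosh_cvg y : 0 <= y -> taylor_poly even n y @[n --> \oo] --> expR y + expR (- y).
Proof.
move=> y0; pose f k (x : R) := expR x + (- 1) ^+ k * expR (- x).
have E : taylor_poly even = taylor_poly (fun k => f k 0).
  by congr taylor_poly; apply/funext => k; rewrite /f oppr0 expR0 mulr1.
have -> : expR y + expR (- y) = f 0%N y by rewrite /f expr0 mul1r.
rewrite E; apply: (@cvg_taylor_ge0 R f (y + 1)).
- move=> k x _; have h1 : is_derive x 1 (fun x : R => expR (- x)) (- expR (- x)).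
    rewrite -mulN1r; apply: is_derive_expR_comp; exact: is_deriveNid.
  apply: (is_derive_eq (is_deriveD (is_derive_expR x) (is_deriveZ ((- 1) ^+ k) h1))).
  by rewrite /f exprS /GRing.scale/=; ring.
- move=> k x /andP[x0 _]; rewrite /f -signr_odd; case: (odd k); rewrite ?expr0 ?expr1.
    by rewrite mulN1r subr_ge0 ler_expR; lra.
  by rewrite mul1r addr_ge0 ?expR_ge0.
- by lra.
Qed.

Let even_taylor_ge0 n y : 0 <= y -> 0 <= taylor_poly even n y.
Proof.
move=> y0; apply: sumr_ge0 => k _.
by rewrite divr_ge0// mulr_ge0 ?even_ge0 ?exprn_ge0.
Qed.

Let fold_expR th : (\int[lam]_x (expR (th * x) * ghs_weight r x)%:E =
  \int[lam]_(x in half) ((expR (th * x) + expR (- (th * x))) * ghs_weight r x)%:E)%E.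
Proof.
rewrite ge0_integral_fold.
- by apply: eq_integral => x _; rewrite ghs_weightN// mulrN mulrDl.
- apply: measurable_funM; last exact: measurable_ghs_weight.
  by apply: measurable_expR_lin; exact: measurable_id.
- by move=> x; rewrite mulr_ge0 ?expR_ge0 ?ghs_weight_ge0.
Qed.

Let integral_taylor n th : 0 <= th ->
  (\int[lam]_(x in half) (taylor_poly even n (th * x) * ghs_weight r x)%:E =
   (taylor_poly (fun k => ghs_derivative r k 0) n th)%:E)%E.
Proof.
move=> th0; elim: n => [|n IH].
  under eq_integral do rewrite /taylor_poly big_ord0 mul0r.
  by rewrite integral0 /taylor_poly big_ord0.
have c0 : 0 <= th ^+ n / n`!%:R by rewrite divr_ge0 ?exprn_ge0.
have mt : measurable_fun setT (fun x : R => taylor_poly even n (th * x) * ghs_weight r x).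
  apply: measurable_funM; last exact: measurable_ghs_weight.
  apply: (measurableT_comp (f := taylor_poly even n)); last exact: measurable_funM.
  apply: continuous_measurable_fun => x.
  apply: differentiable_continuous; apply/derivable1_diffP.
  by have [] := is_derive_taylor_poly even n x.
have mm : measurable_fun setT (fun x : R => th ^+ n / n`!%:R * (even n * x ^+ n * ghs_weight r x)).
  by apply: measurable_funM; [exact: measurable_cst|exact: measurable_term].
have t0 x : half x -> 0 <= taylor_poly even n (th * x) * ghs_weight r x.
  rewrite /= in_itv/= andbT => x0.
  by rewrite mulr_ge0 ?ghs_weight_ge0// even_taylor_ge0// mulr_ge0.
have m0 x : half x -> 0 <= th ^+ n / n`!%:R * (even n * x ^+ n * ghs_weight r x).
  by move=> hx; rewrite mulr_ge0 ?term_ge0.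
have H := ge0_integralM_EFin lam mhalf (measurable_term n r0) (fun x => @term_ge0 r n x r0) c0.
rewrite (ghs_moment n r0) -EFinM in H.
rewrite [taylor_poly (fun k => _) n.+1 th]big_ord_recr/= EFinD.
have -> : ghs_derivative r n 0 * th ^+ n / n`!%:R = th ^+ n / n`!%:R * ghs_derivative r n 0 by ring.
rewrite -H -[X in (X + _)%E]IH -(ge0_integralD_EFin lam mhalf mt mm t0 m0).
apply: eq_integral => x _; apply: (congr1 EFin).
by rewrite [taylor_poly even n.+1 _]big_ord_recr/= mulrDl exprMn; congr (_ + _); ring.
Qed.

(** The Taylor terms of exp (th x) + exp (- th x) are nonnegative on [0, +oo[, so monotone
    convergence sums the moments. The sum is the Taylor series of the partition function, convergent
    by absolute monotonicity. *)
Let laplace_nonneg th : 0 <= th < pi / 2 ->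
  (\int[lam]_x (expR (th * x) * ghs_weight r x)%:E = (ghs_partition r th)%:E)%E.
Proof.
move=> thq; have /andP[th0 _] := thq; rewrite fold_expR.
pose g n (x : R) := (taylor_poly even n (th * x) * ghs_weight r x)%:E.
have gcvg x : half x -> g n x @[n --> \oo] -->
    ((expR (th * x) + expR (- (th * x))) * ghs_weight r x)%:E.
  rewrite /= in_itv/= andbT => x0; apply: cvg_EFin; first exact: nearW.
  have -> : fine \o g^~ x = fun n => taylor_poly even n (th * x) * ghs_weight r x by [].
  apply: cvgM; last exact: cvg_cst.
  by apply: cosh_cvg; rewrite mulr_ge0.
have mono := @cvg_monotone_convergence _ (measurableTypeR R) R lam half mhalf g _ _ _.
have {}mono : (\int[lam]_(x in half) g n x @[n --> \oo] -->
    \int[lam]_(x in half) ((expR (th * x) + expR (- (th * x))) * ghs_weight r x)%:E)%E.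
  have -> : (\int[lam]_(x in half) ((expR (th * x) + expR (- (th * x))) * ghs_weight r x)%:E =
      \int[lam]_(x in half) limn (g^~ x))%E.
    by apply: eq_integral => x /set_mem hx; rewrite (cvg_lim _ (gcvg x hx)).
  apply: mono.
  - move=> n; apply: measurable_funTS; apply/measurable_EFinP.
    apply: measurable_funM; last exact: measurable_ghs_weight.
    apply: (measurableT_comp (f := taylor_poly even n)); last exact: measurable_funM.
    apply: continuous_measurable_fun => x.
    apply: differentiable_continuous; apply/derivable1_diffP.
    by have [] := is_derive_taylor_poly even n x.
  - move=> n x; rewrite /= in_itv/= andbT => x0; rewrite lee_fin.
    by rewrite mulr_ge0 ?ghs_weight_ge0// even_taylor_ge0// mulr_ge0.
  - move=> x; rewrite /= in_itv/= andbT => x0; apply/nondecreasing_seqP => n.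
    rewrite lee_fin ler_wpM2r ?ghs_weight_ge0// [leRHS]big_ord_recr/= lerDl.
    by rewrite divr_ge0// mulr_ge0 ?even_ge0// exprn_ge0// mulr_ge0.
rewrite -(cvg_lim _ mono)//; apply/cvg_lim => //.
under eq_fun do rewrite /g integral_taylor//.
apply: cvg_EFin; first exact: nearW.
have -> : ghs_partition r th = ghs_derivative r 0 th.
  by rewrite /ghs_derivative /= -polyC1 hornerC mul1r.
apply: (@cvg_taylor_ge0 R (ghs_derivative r) (pi / 2)) => //.
  move=> k x xq; apply: is_derive_ghs_derivative.
  by have := @pi_gt0 R; lra.
by move=> k x xq; apply: ghs_derivative_ge0 => //; exact: ltW.
Qed.

Let laplace_even th : (\int[lam]_x (expR (- th * x) * ghs_weight r x)%:E =
  \int[lam]_x (expR (th * x) * ghs_weight r x)%:E)%E.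
Proof.
by rewrite !fold_expR; apply: eq_integral => x _; rewrite mulNr opprK addrC.
Qed.

Lemma ghs_laplace th : - (pi / 2) < th < pi / 2 ->
  (\int[lam]_x (expR (th * x) * ghs_weight r x)%:E = (ghs_partition r th)%:E)%E.
Proof.
move=> thq; have [th0|th0] := leP 0 th; first by apply: laplace_nonneg; lra.
rewrite -laplace_even laplace_nonneg; last lra.
by rewrite /ghs_partition cosN.
Qed.

(** cosh (th x) increases with th >= 0, so a finite value I at th would bound the partition function
    on [0, pi/2[, where it is unbounded. *)
Let laplace_unbounded th : pi / 2 <= th ->
  (\int[lam]_x (expR (th * x) * ghs_weight r x)%:E = +oo)%E.
Proof.
move=> thq; have p0 := @pi_gt0 R.
have int0 : (0 <= \int[lam]_x (expR (th * x) * ghs_weight r x)%:E)%E.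
  by apply: integral_ge0 => x _; rewrite lee_fin mulr_ge0 ?expR_ge0 ?ghs_weight_ge0.
apply/eqP; rewrite -leye_eq leNgt; apply/negP => lty.
have fin : (\int[lam]_x (expR (th * x) * ghs_weight r x)%:E)%E \is a fin_num.
  by rewrite ge0_fin_numE.
pose I := fine (\int[lam]_x (expR (th * x) * ghs_weight r x)%:E)%E.
have mc t : measurable_fun setT (fun x : R => (expR (t * x) + expR (- (t * x))) * ghs_weight r x).
  apply: measurable_funM; last exact: measurable_ghs_weight.
  apply: measurable_funD; first by apply: measurable_expR_lin; exact: measurable_id.
  apply: measurableT_comp => //; apply: measurableT_comp => //; exact: measurable_funM.
have bound t : 0 <= t < pi / 2 -> ghs_partition r t <= I.
  move=> tq; rewrite -lee_fin /I fineK// -laplace_nonneg// !fold_expR.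
  apply: ge0_le_integral.
  - exact: mhalf.
  - move=> x _; rewrite lee_fin; apply: mulr_ge0; last exact: ghs_weight_ge0.
    by rewrite addr_ge0 ?expR_ge0.
  - by apply: measurable_funTS; apply/measurable_EFinP; exact: mc.
  - by apply: measurable_funTS; apply/measurable_EFinP; exact: mc.
  - move=> x; rewrite /= in_itv/= andbT => x0; rewrite lee_fin ler_wpM2r ?ghs_weight_ge0//.
    have tx : t * x <= th * x by apply: ler_wpM2r => //; lra.
    set u := t * x in tx *; set v := th * x in tx *.
    have u0 : 0 <= u by rewrite mulr_ge0//; lra.
    have e1 : 1 <= expR u by rewrite -expR0 ler_expR.
    have e2 : expR u <= expR v by rewrite ler_expR.
    rewrite !expRN -subr_ge0.
    have -> : expR v + (expR v)^-1 - (expR u + (expR u)^-1) =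
        (expR v - expR u) * (1 - (expR u * expR v)^-1).
      by field; rewrite !gt_eqF ?expR_gt0.
    rewrite mulr_ge0 ?subr_ge0// invf_le1 ?mulr_gt0 ?expR_gt0//.
    by apply: mulr_ege1 => //; exact: le_trans e1 e2.
pose K := 4 * pi * expR (- (r * ln 2)).
have K0 : 0 < K by rewrite !mulr_gt0 ?expR_gt0.
have I0 : 0 <= I by exact: fine_ge0.
(* At the t with cos t = exp (- M) the partition function is K exp (r M) = K exp (I / K), which
   exceeds I. *)
pose M := I / K / r; have M0 : 0 <= M by rewrite /M (divr_ge0 _ (ltW r0))// divr_ge0// ltW.
have M1 : expR (- M) <= 1 by rewrite -expR0 ler_expR oppr_le0.
have MM : -1 <= expR (- M) <= 1 by rewrite M1 andbT (le_trans _ (expR_ge0 _))// oppr_le0.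
have [/andP[t0 tpi] ct] := acos_def MM.
set t := acos (expR (- M)) in t0 tpi ct.
have tq : 0 <= t < pi / 2.
  rewrite t0/= ltNge; apply/negP => tge.
  have : 0 <= cos (pi - t) by apply: cos_ge0_pihalf; lra.
  rewrite cosB cospi sinpi mul0r addr0 mulN1r oppr_ge0 ct.
  by rewrite leNgt expR_gt0.
have := bound t tq; rewrite /ghs_partition ct expRK mulrN opprK expRD mulrA -/K.
rewrite -ler_pdivlMl// leNgt => /negP; apply.
have -> : K^-1 * I = r * M by rewrite /M; field; rewrite !gt_eqF.
by apply: lt_le_trans (expR_ge1Dx _); rewrite ltrDr.
Qed.

Lemma ghs_laplace_infinite th : ~~ (- (pi / 2) < th < pi / 2) ->
  (\int[lam]_x (expR (th * x) * ghs_weight r x)%:E = +oo)%E.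
Proof.
rewrite negb_and -!leNgt => /orP[h|]; last exact: laplace_unbounded.
by rewrite -laplace_even laplace_unbounded//; lra.
Qed.

End ghs_laplace.

(** * Discrete measures, binomial series and integrality of the number of trials *)

Section counting_integrals.
Context {R : realType}.

Lemma counting_set1 d (T : measurableType d) (a : T) : @counting T R [set a] = 1%E.
Proof.
rewrite /counting asboolT; last exact: finite_set1.
by rewrite fset_set1 finmap.cardfs1.
Qed.

Lemma integral_counting_set1 d (T : measurableType d) (a : T) (f : T -> \bar R) :
  measurable [set a] -> (\int[@counting T R]_(x in [set a]) f x = f a)%E.
Proof.
move=> ma; rewrite (eq_integral (cst (f a))); last by move=> x /set_mem ->.
rewrite integral_cst//; have := @counting_set1 d T a; rewrite /= => ->.
by rewrite mule1.
Qed.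

Lemma ge0_integral_counting d (T : measurableType d) (e : nat -> T) (f : T -> R) l :
  (forall k, measurable [set e k]) -> bijective e ->
  measurable_fun setT f -> (forall x, 0 <= f x) ->
  (\sum_(0 <= k < n) f (e k)) @[n --> \oo] --> l ->
  (\int[@counting T R]_x (f x)%:E = l%:E)%E.
Proof.
move=> me be mf f0 fl; have [e' e'K eK] := be.
have -> : [set: T] = \bigcup_k [set e k].
  by apply/seteqP; split=> // x _; exists (e' x) => //=; rewrite eK.
rewrite ge0_integral_bigcup//; last 3 first.
- by apply/measurable_EFinP; apply: measurable_funTS.
- by move=> x _; rewrite lee_fin.
- apply/trivIsetP => i j _ _ ij; apply/seteqP; split=> // x [/= -> /(can_inj e'K) E].
  by rewrite E eqxx in ij.
under eq_eseriesr do rewrite integral_counting_set1//.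
apply/cvg_lim => //; under eq_fun do rewrite sumEFin.
by apply: cvg_EFin; first exact: nearW.
Qed.

End counting_integrals.

Section falling_factorials.
Context {R : realType} (s : R).
Hypothesis s0 : 0 < s.

Let ff k : R := \prod_(i < k) (s - i%:R).

Let ffS k : ff k.+1 = ff k * (s - k%:R). Proof. by rewrite /ff big_ord_recr. Qed.

Definition gen_binomial k : R := ff k / k`!%:R.

Let gen_binomialS k : gen_binomial k.+1 = gen_binomial k * ((s - k%:R) / k.+1%:R).
Proof.
rewrite /gen_binomial ffS factS natrM invfM.
by move: (k.+1%:R^-1) (_`!%:R^-1) => u v; ring.
Qed.

(** The ratio of consecutive coefficients is (s - k) / (k + 1), of absolute value at most 1 as soon
    as k >= s. *)
Lemma gen_binomial_bound : exists2 M : R, 0 < M & forall k, `|gen_binomial k| <= M.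
Proof.
pose N := (Num.truncn s).+1; have sN : s < N%:R by exact: truncnS_gt.
pose M := \sum_(i < N.+1) `|gen_binomial i|.
have M0 : 0 < M.
  rewrite /M big_ord_recl ltr_wpDr ?sumr_ge0//.
  by rewrite /gen_binomial /ff big_ord0 fact0 divr1 normr1.
exists M => // k.
have [kN|Nk] := leqP k N.
  by rewrite /M (bigD1 (Ordinal (ltnSE kN : (k < N.+1)%N)))//= lerDl sumr_ge0.
have H j : `|gen_binomial (N + j)| <= M.
  elim: j => [|j IH].
    by rewrite addn0 /M (bigD1 (@ord_max N))//= lerDl sumr_ge0.
  rewrite addnS gen_binomialS normrM; apply: le_trans IH; rewrite ler_piMr//.
  rewrite normrM normfV ler_pdivrMr ?normr_gt0// mul1r [leRHS]ger0_norm//.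
  have : s <= (N + j)%:R by rewrite natrD; apply: ltW; rewrite ltr_wpDr.
  move: (N + j)%N => m sm; rewrite -opprB normrN ger0_norm ?subr_ge0//.
  by apply: (@le_trans _ _ m%:R); [rewrite gerBl ltW|rewrite ler_nat].
by rewrite -(subnKC (ltnW Nk)).
Qed.

(** The n-th derivative of (1 + y)^s on [0, 1[ is bounded by |ff n| 2^s. Divided by n! this stays
    bounded in n, and the remaining factor x^n tends to 0. *)
Lemma cvg_gen_binomial (x : R) : 0 <= x < 1 ->
  \sum_(0 <= k < n) gen_binomial k * x ^+ k @[n --> \oo] --> expR (s * ln (1 + x)).
Proof.
move=> x01; pose f k (y : R) := ff k * expR ((s - k%:R) * ln (1 + y)).
have df k (y : R) : 0 <= y < 1 -> is_derive y 1 (f k) (f k.+1 y).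
  move=> /andP[y0 _]; have y1 : 0 < 1 + y by lra.
  have h0 : is_derive y 1 (fun y => 1 + y) 1.
    have h := is_deriveD (is_derive_cst (1 : R) y 1) (is_derive_id y 1).
    by rewrite add0r in h.
  have h1 := is_derive_expR_comp (is_deriveZ (s - k%:R) (is_derive_ln_comp h0 y1)).
  apply: (is_derive_eq (is_deriveZ (ff k) h1)); rewrite /GRing.scale/= /f ffS.
  have -> : (s - k.+1%:R) * ln (1 + y) = (s - k%:R) * ln (1 + y) - ln (1 + y).
    by rewrite -natr1; ring.
  by rewrite expRD expRN lnK//; field; rewrite gt_eqF.
have fC k (y : R) : 0 <= y < 1 -> `|f k y| <= `|ff k| * expR (s * ln 2).
  move=> /andP[y0 y1]; rewrite normrM (ger0_norm (expR_ge0 _)) ler_wpM2l// ler_expR.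
  have l0 : 0 <= ln (1 + y) by rewrite ln_ge0//; lra.
  have l2 : ln (1 + y) <= ln 2 by rewrite ler_ln ?posrE//; lra.
  rewrite mulrBl; have := ler_wpM2l (ltW s0) l2.
  have : 0 <= k%:R * ln (1 + y) by rewrite mulr_ge0.
  lra.
have [M M0 gM] := gen_binomial_bound.
have f0E : f 0%N x = expR (s * ln (1 + x)).
  by rewrite /f /ff big_ord0 mul1r subr0.
have TE n : taylor_poly (fun k => f k 0) n x = \sum_(0 <= k < n) gen_binomial k * x ^+ k.
  rewrite big_mkord; apply: eq_bigr => k _.
  rewrite /f addr0 ln1 mulr0 expR0 mulr1 /gen_binomial.
  by move: (_`!%:R^-1) => u; ring.
rewrite -f0E; apply/cvgrPdist_le => e e0.
have /andP[x0 x1] := x01.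
have xn : (M * expR (s * ln 2)) * x ^+ n @[n --> \oo] --> (0 : R).
  rewrite -[X in _ --> X](mulr0 (M * expR (s * ln 2))).
  apply: cvgM; first exact: cvg_cst.
  by apply: cvg_expr; rewrite ger0_norm.
have /cvgrPdist_le/(_ e e0) := xn; apply: filterS => n.
rewrite sub0r normrN => H; rewrite -TE.
apply: le_trans (taylor_bound df fC n x01) _.
apply: le_trans H; apply: le_trans (ler_norm _).
have -> : `|ff n| * expR (s * ln 2) * x ^+ n / n`!%:R = `|gen_binomial n| * expR (s * ln 2) * x ^+ n.
  by rewrite /gen_binomial normrM normfV (ger0_norm (ler0n _ _)); move: (_`!%:R^-1) => u; ring.
by rewrite ler_wpM2r ?exprn_ge0// ler_wpM2r ?expR_ge0.
Qed.

(** For N the integral part of s, the factors s - 0, ..., s - N are positive and s - (N + 1) is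
    negative; so the coefficient of index N + 2 is negative. *)
Lemma gen_binomial_lt0 : (forall n : nat, s != n%:R) -> exists k, gen_binomial k < 0.
Proof.
move=> sn; pose N := Num.truncn s; have sN : s < N.+1%:R by exact: truncnS_gt.
have Ns : N%:R < s by rewrite lt_neqAle eq_sym sn/= truncn_le// ltW.
exists N.+2; rewrite /gen_binomial pmulr_llt0 ?invr_gt0 ?ltr0n ?fact_gt0// ffS.
rewrite pmulr_rlt0 ?subr_lt0//; apply: prodr_gt0 => i _; rewrite subr_gt0.
by apply: le_lt_trans Ns; rewrite ler_nat -ltnS.
Qed.

End falling_factorials.

Section discrete_measures.
Context {R : realType}.

Lemma exists_discrete_measure (u : nat -> R) : (forall k, 0 <= u k) ->
  exists m : {measure set (measurableTypeR R) -> \bar R},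
    (forall k, m [set k%:R] = (u k)%:E) /\
    forall h l, \sum_(0 <= k < n) u k * expR (h * k%:R) @[n --> \oo] --> l ->
      laplace m id h = l%:E.
Proof.
move=> u0.
have mu : measurable_fun [set: nat] u by [].
have [m mE] := exists_density_measure (@counting nat R) mu u0.
have mn : measurable_fun setT (fun k : nat => k%:R : measurableTypeR R) by [].
have [m' m'E m'I] := exists_pushforward m mn.
exists m'; split.
  move=> k; rewrite m'E mE.
  rewrite (_ : _ @^-1` _ = [set k]); first exact: integral_counting_set1.
  by apply/seteqP; split=> j /=; [move=> /eqP; rewrite eqr_nat => /eqP|move=> ->].
move=> h l hl.
have mexp : measurable_fun setT (fun y : measurableTypeR R => (expR (h * y))%:E).
  by apply/measurable_EFinP; apply: measurable_expR_lin; exact: measurable_id.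
have exp0 (y : measurableTypeR R) : (0 <= (expR (h * y))%:E)%E.
  by rewrite lee_fin expR_ge0.
rewrite /laplace (m'I _ _ measurableT mexp exp0).
rewrite preimage_setT (ge0_integral_density mu u0 (fun A _ => mE A))//.
under eq_integral do rewrite -EFinM.
apply: (@ge0_integral_counting R _ nat id) => //.
- by exists id.
- by move=> k; rewrite mulr_ge0 ?expR_ge0.
- by under eq_fun do under eq_bigr do rewrite mulrC.
Qed.

End discrete_measures.

(* The moment generating function [(1 - w + w e^h)^s] has a power series in [e^h];
   moving its negative terms to the other side gives two measures with the same
   transform, hence the coefficients are nonnegative. *)
Lemma binomial_exponent_integer {R : realType} d (X : measurableType d)
    (nu : probability X R) (t : X -> R) (s w e : R) :
  measurable_fun setT t -> 0 < s -> 0 < w < 2^-1 -> 0 < e ->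
  (forall h, `|h| < e ->
     laplace nu t h = (expR (s * ln (1 - w + w * expR h)))%:E) ->
  exists n : nat, s = n%:R.
Proof.
move=> mt s0 /andP[w0 w2] e0 H; apply: contrapT => sn.
have {}sn (n : nat) : s != n%:R by apply/eqP => E; apply: sn; exists n.
have [k0 ck0] := gen_binomial_lt0 s0 sn.
have w1 : 0 < 1 - w by lra.
(* (1 - w + w e^h)^s = (1 - w)^s (1 + rho e^h)^s, and w < 1/2 means rho < 1: the binomial series
   converges for all h < - ln rho, hence near 0. *)
pose rho := w / (1 - w); have rho0 : 0 < rho by rewrite divr_gt0.
have rho1 : rho < 1 by rewrite ltr_pdivrMr//; lra.
pose c k := expR (s * ln (1 - w)) * (gen_binomial s k * rho ^+ k).
pose u k := Num.max (c k) 0; pose v k := Num.max (- c k) 0.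
have u0 k : 0 <= u k by rewrite le_max lexx orbT.
have v0 k : 0 <= v k by rewrite le_max lexx orbT.
have uv k : u k = v k + c k.
  by rewrite /u /v; case: (lerP (c k) 0) => h; case: (lerP (- c k) 0) => h'; lra.
have [mU [U1 UL]] := exists_discrete_measure u0.
have [mV [V1 VL]] := exists_discrete_measure v0.
have [mL L1 LI] := @exists_pushforward R _ _ X (measurableTypeR R) t nu mt.
pose e' := Num.min e (- ln rho).
have e'0 : 0 < e' by rewrite lt_min e0 oppr_gt0 ln_lt0// rho0.
have mexp h : measurable_fun setT (fun y : measurableTypeR R => (expR (h * y))%:E).
  by apply/measurable_EFinP; apply: measurable_expR_lin; exact: measurable_id.
have exp0 h (y : measurableTypeR R) : (0 <= (expR (h * y))%:E)%E.
  by rewrite lee_fin expR_ge0.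
have LL h : laplace mL id h = laplace nu t h.
  by rewrite /laplace (LI _ _ measurableT (mexp h) (exp0 h)).
have [M M0 gM] := gen_binomial_bound s0.
pose K := expR (s * ln (1 - w)); have K0 : 0 < K := expR_gt0 _.
have x1 h : `|h| < e' -> 0 <= rho * expR h < 1.
  rewrite lt_min => /andP[_ he]; rewrite mulr_ge0 ?expR_ge0 ?(ltW rho0)//=.
  rewrite -[rho]lnK ?posrE// -expRD -[X in _ < X]expR0 ltr_expR.
  by move: he; rewrite ltr_norml; lra.
have cE h k : c k * expR (h * k%:R) = K * (gen_binomial s k * (rho * expR h) ^+ k).
  by rewrite /c -/K [(rho * _) ^+ k]exprMn expRM_natr -!mulrA.
have ex_lim (a : nat -> R) h : (forall k, 0 <= a k) -> (forall k, a k <= `|c k|) -> `|h| < e' ->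
    exists l : R, \sum_(0 <= k < n) a k * expR (h * k%:R) @[n --> \oo] --> l.
  move=> a0 ac he; have /andP[y0 y1] := x1 h he; set y := rho * expR h in y0 y1 *.
  have cg : cvgn (series (fun k => K * M * y ^+ k)).
    by apply: is_cvg_geometric_series; rewrite ger0_norm.
  have : cvgn (series (fun k => a k * expR (h * k%:R))).
    apply: series_le_cvg cg => k.
    - by rewrite mulr_ge0 ?expR_ge0.
    - by rewrite mulr_ge0 ?exprn_ge0// mulr_ge0 ?(ltW M0) ?(ltW K0).
    - apply: (@le_trans _ _ (`|c k| * expR (h * k%:R))).
        by rewrite ler_wpM2r ?expR_ge0.
      rewrite -[expR _]ger0_norm ?expR_ge0// -normrM cE -/y.
      rewrite [`|K * _|]normrM (gtr0_norm K0) [`|gen_binomial s k * _|]normrM (ger0_norm (exprn_ge0 _ y0)) mulrA.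
      by rewrite ler_wpM2r ?exprn_ge0// ler_wpM2l ?(ltW K0).
  by move=> h2; exists (limn (series (fun k => a k * expR (h * k%:R)))).
have uc k : u k <= `|c k| by rewrite ge_max ler_norm normr_ge0.
have vc k : v k <= `|c k| by rewrite ge_max -normrN ler_norm normr_ge0.
have sumE h : `|h| < e' -> exists l1 l2 : R,
   [/\ \sum_(0 <= k < n) u k * expR (h * k%:R) @[n --> \oo] --> l1,
       \sum_(0 <= k < n) v k * expR (h * k%:R) @[n --> \oo] --> l2 &
       l1 = l2 + expR (s * ln (1 - w + w * expR h))].
  move=> he; have [l1 h1] := ex_lim u h u0 uc he; have [l2 h2] := ex_lim v h v0 vc he.
  exists l1, l2; split => //.
  have h4 : \sum_(0 <= k < n) v k * expR (h * k%:R) +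
      K * \sum_(0 <= k < n) gen_binomial s k * (rho * expR h) ^+ k @[n --> \oo] -->
      l2 + K * expR (s * ln (1 + rho * expR h)).
    apply: cvgD h2 _; apply: cvgM; first exact: cvg_cst.
    by have := @cvg_gen_binomial R s s0 (rho * expR h) (x1 h he); exact.
  rewrite (_ : expR _ = K * expR (s * ln (1 + rho * expR h))); last first.
    have /andP[y0 _] := x1 h he.
    rewrite -expRD -mulrDr -lnM ?posrE//; last by rewrite ltr_pwDl.
    congr (expR (s * ln _)); rewrite /rho; field; rewrite gt_eqF//.
  have E : (fun n => \sum_(0 <= k < n) v k * expR (h * k%:R) +
      K * \sum_(0 <= k < n) gen_binomial s k * (rho * expR h) ^+ k) =
      (fun n => \sum_(0 <= k < n) u k * expR (h * k%:R)).
    apply/funext => n; rewrite mulr_sumr -big_split/=; apply: eq_bigr => k _.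
    by rewrite -cE -mulrDl -uv.
  by rewrite E in h4; exact: (cvg_unique _ h1 h4).
have E : mU [set k0%:R] = (mV [set k0%:R] + mL [set k0%:R])%E.
  rewrite -measure_addE.
  apply: (@laplace_inj R mU (measure_add mV mL) e' e'0 _ _ [set k0%:R] (measurable_set1 _)).
  - by move=> h he; have [l1 [_ [h1 _ _]]] := sumE h he; rewrite (UL _ _ h1) ltry.
  - move=> h he; have [l1 [l2 [h1 h2 l12]]] := sumE h he.
    rewrite (UL _ _ h1) l12.
    rewrite [RHS](@ge0_integral_measure_add _ (measurableTypeR R) R mV mL setT measurableT _
      (fun y _ => exp0 h y) (mexp h)).
    rewrite [X in (X + _)%E](VL _ _ h2) [X in (_ + X)%E]LL H//.
    by move: he; rewrite lt_min => /andP[].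
(* Comparing masses at k0 gives v k0 <= u k0, whereas u k0 - v k0 = c k0 is negative. *)
move: E; rewrite U1 V1 => E.
have : ((v k0)%:E <= (u k0)%:E)%E by rewrite E leeDl.
have c0 : c k0 < 0 by rewrite /c pmulr_rlt0// pmulr_llt0// exprn_gt0.
by rewrite lee_fin uv; lra.
Qed.

(** * Radon measures and sigma-finiteness from a finite transform *)

Section radon_measures.
Context {R : realType} (X : ptopologicalType).
Hypothesis hX : hausdorff_space X.

(** Inner regularity up to a null set. Null sets remain null for a measure with a density, so this
    passes at once from the reference measure to the base measure and to all members. *)
Definition inner_exhausted (m : {measure set (borel X) -> \bar R}) :=
  forall A : set (borel X), measurable A -> exists K : nat -> set X,
    [/\ forall j, compact (K j), forall j, K j `<=` A,
        nondecreasing_seq K & m (A `\` \bigcup_j K j) = 0%E].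

Lemma compact_borel (K : set X) : compact K -> measurable (K : set (borel X)).
Proof.
move=> cK; have oK : open (~` K) by apply: closed_openC; exact: compact_closed.
rewrite -(setCK (K : set (borel X))); apply: measurableC.
exact: sub_sigma_algebra.
Qed.

Lemma inner_exhausted_density (m m' : {measure set (borel X) -> \bar R}) (f : X -> R) :
  inner_exhausted m -> measurable_fun setT (f : borel X -> R) ->
  (forall A, measurable A -> m' A = (\int[m]_(x in A) (f x)%:E)%E) -> inner_exhausted m'.
Proof.
move=> im mf m'E A mA; have [K [cK KA ndK KA0]] := im A mA; exists K; split => //.
have mN : measurable (A `\` \bigcup_j K j : set (borel X)).
  apply: measurableD => //; apply: bigcupT_measurable => j; exact: compact_borel.
rewrite m'E//; apply: null_set_integral => //.
by apply/measurable_EFinP/measurable_funTS.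
Qed.

Variables (m : {measure set (borel X) -> \bar R}) (t : X -> R) (h : R).
Hypothesis ct : continuous t.
Hypothesis fin : (laplace m (t : borel X -> R) h < +oo)%E.

Let mt : measurable_fun setT (t : borel X -> R).
Proof. by apply: (iffLR (measurable_fun_borel _)); exact: continuous_borel. Qed.

Let me : measurable_fun setT (fun x : borel X => (expR (h * t x))%:E).
Proof. by apply/measurable_EFinP; exact: measurable_expR_lin mt h. Qed.

(* On a set where [t] is bounded the exponential is bounded away from 0. *)
Let finite_bounded (A : set (borel X)) (M : R) : measurable A ->
  (forall x, A x -> `|t x| <= M) -> (m A < +oo)%E.
Proof.
move=> mA AM; have e0 : 0 < expR (- (`|h| * M)) := expR_gt0 _.
have le1 : ((expR (- (`|h| * M)))%:E * m A <= laplace m (t : borel X -> R) h)%E.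
  rewrite -integral_cst//; apply: (@le_trans _ _ (\int[m]_(x in A) (expR (h * t x))%:E)%E).
    apply: ge0_le_integral => //.
    - by move=> x _; rewrite lee_fin expR_ge0.
    - exact: measurable_funTS me.
    - move=> x Ax; rewrite lee_fin ler_expR lerNl.
      apply: le_trans (ler_norm _) _; rewrite normrN normrM.
      by rewrite ler_wpM2l// AM.
  apply: ge0_subset_integral => //.
have := le_lt_trans le1 fin; rewrite !ltey; apply: contra => /eqP ->.
by rewrite gt0_muley.
Qed.

(** The sets |t| <= n cover the space and have finite measure. *)
Lemma sigma_finite_laplace : sigma_finite setT m.
Proof.
pose E n : set (borel X) := t @^-1` [set` `[- n%:R, n%:R]].
have mE n : measurable (E n).
  by have := mt measurableT (measurable_itv `[- n%:R, n%:R]); rewrite setTI.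
exists E; last first.
  move=> n; split; first exact: mE.
  apply: (@finite_bounded _ n%:R) => // x; rewrite /E/= in_itv/=.
  by rewrite -ler_norml.
apply/seteqP; split=> // x _; exists (Num.truncn `|t x|).+1 => //.
by rewrite /E/= in_itv/= -ler_norml ltW// truncnS_gt.
Qed.

(** On a compact set the continuous t is bounded, so the measure is finite; inner regularity is
    continuity from below along the exhausting compacts. *)
Lemma radon_laplace : inner_exhausted m -> radon m.
Proof.
move=> im; split.
  move=> K cK; have := continuous_compact (continuous_subspaceT ct) cK.
  move=> /compact_bounded[M [Mr MB]].
  apply: (@finite_bounded _ (M + 1)); first exact: compact_borel.
  move=> x Kx; apply: (MB (M + 1)); first by rewrite ltrDl.
  by exists x.
move=> A mA; apply/eqP; rewrite eq_le; apply/andP; split; last first.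
  apply: ge_ereal_sup => _ [K [cK KA] <-].
  by apply: le_measure => //; rewrite inE//; exact: compact_borel.
have [K [cK KA ndK KA0]] := im A mA.
have mK j : measurable (K j : set (borel X)) by exact: compact_borel.
have mU : measurable (\bigcup_j K j : set (borel X)) by exact: bigcupT_measurable.
have -> : m A = m (\bigcup_j K j : set (borel X)).
  have -> : A = (A `\` \bigcup_j K j) `|` (\bigcup_j K j : set (borel X)).
    rewrite setUC setDUK// => x [j _ Kx]; exact: KA Kx.
  rewrite measureU//; [|exact: measurableD|by rewrite setIC setDIK].
  by rewrite [X in (X + _)%E]KA0 add0e.
have cv := @nondecreasing_cvg_mu _ (borel X) R m K mK mU ndK.
rewrite -(cvg_lim _ cv)//; apply: lime_le; first exact: cvgP cv.
apply: nearW => j; apply: ereal_sup_ubound; exists (K j) => //.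
Qed.

End radon_measures.

(** The normalization changes nothing, as the mass is 1, but yields the [probability] structure; the
    Dirac measure is its default value for mass 0 or infinity. *)
Lemma exists_probability {R : realType} d (T : measurableType d)
    (m : {measure set T -> \bar R}) (a : T) : m setT = 1%E ->
  exists P : probability T R, forall A, P A = m A.
Proof.
move=> m1; exists (mnormalize m (dirac a)) => A.
rewrite /= /mnormalize m1 /= ifF; last by rewrite onee_eq0.
by rewrite invr1 mule1.
Qed.

Lemma two_members_order {R : realType} (X : sampleSpace R) (P : set (probability X R))
    n (T : X -> 'rV[R]_n) mu : two_members P -> realization T P mu -> (0 < n)%N.
Proof.
case: n T => // T [nu1 [nu2 [P1 P2 [A mA ne]]]] [_ _ rP]; case: ne.
have [th1 e1] := rP nu1 P1; have [th2 e2] := rP nu2 P2.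
have E : th1 = th2 by apply/matrixP => -[].
rewrite E in e1; have [_ h1] := e1; have [_ h2] := e2.
exact: etrans (h1 A mA) (esym (h2 A mA)).
Qed.

(** * Exponential families given by a density on a reference measure *)

Section models.
Context {R : realType} (c : category) (F : densityFamily R).
Local Notation X := (borelSpace R c (fspace F)).
Local Notation ref := (ref_measure F).
Local Notation tF := (@Defs.incl R F).
Local Notation t := (@Defs.incl R F : X -> R).

Variables (nat_par : R -> R) (psi psi1 : R -> R) (k : fspace F -> R).
Hypotheses (hF : hausdorff_space (fspace F)) (lF : locally_compact [set: fspace F]).
Hypothesis ct : continuous (@Defs.incl R F).
Hypothesis iref : inner_exhausted ref.
Hypothesis mk : measurable_fun setT (k : X -> R).
Hypothesis k0 : forall x, 0 <= k x.
Let D : set R := nat_par @` par F.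
Hypothesis oD : forall th, D th -> exists a b, a < th < b /\ forall h, a < h < b -> D h.
Hypothesis densE : forall p x, par F p ->
  dens (d := F) p x = expR (nat_par p * tF x - psi (nat_par p)) * k x.
Hypothesis Zin : forall th, D th ->
  (\int[ref]_x (expR (th * tF x) * k x)%:E = (expR (psi th))%:E)%E.
Hypothesis Zout : forall th, ~ D th ->
  (\int[ref]_x (expR (th * tF x) * k x)%:E = +oo)%E.
Hypothesis dpsi : forall th : R, D th -> is_derive th 1 psi (psi1 th).
Hypothesis two_means : exists p1 p2, [/\ par F p1, par F p2 & psi1 (nat_par p1) <> psi1 (nat_par p2)].

Lemma model_category : in_category c X.
Proof. by case: c; [exact: InContinuous|exact: InMeasurable]. Qed.

Let mt : measurable_fun setT t.
Proof. by apply: (iffLR (measurable_fun_borel _)); exact: continuous_borel. Qed.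

Let mex th : measurable_fun setT (fun x : X => (expR (th * tF x))%:E).
Proof. by apply/measurable_EFinP; exact: measurable_expR_lin mt th. Qed.

Let coordE : coord (X := X) (inclusion F) = t.
Proof. by apply/funext => x; rewrite /coord /inclusion mxE eqxx mulr1n. Qed.

Let ok_stat_inclusion : ok_stat X (inclusion F).
Proof.
have ci : continuous (inclusion F : fspace F -> 'rV[R]_1).
  move=> x; apply: (@continuous_comp _ _ _ tF (fun y : R => y%:M : 'rV[R]_1)); first exact: ct.
  exact: continuous_scalar_mx1.
by case: c; [exact: ci|exact: continuous_borel].
Qed.

Let ok_measure_laplace (m : {measure set X -> \bar R}) h :
  inner_exhausted m -> (laplace m t h < +oo)%E -> ok_measure X m.
Proof.
move=> im fh; suff [h1 h2] : radon m /\ sigma_finite setT m by case: c.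
by split; [exact: radon_laplace hF _ _ _ ct fh im|exact: sigma_finite_laplace ct fh].
Qed.

(** The density splits as exp (th x - psi th) k(x). So k times the reference measure is the base
    measure, psi its log normalizer on D, and [Zin] and [Zout] identify D as the natural domain. Two
    different means exclude order 0. *)
Lemma model : exists mu : {measure set X -> \bar R},
  [/\ inclusion_realization c F mu nat_par, two_members (X := X) (members F),
      forall th, (laplace mu (coord (X := X) (inclusion F)) th < +oo)%E <-> D th &
      forall th, D th -> phi c F mu th = psi th].
Proof.
have [mu muE] := exists_density_measure ref mk k0.
have muE' A : measurable A -> mu A = (\int[ref]_(x in A) (k x)%:E)%E by move=> _; exact: muE.
exists mu.
have lapE th : laplace mu t th = (\int[ref]_x (expR (th * tF x) * k x)%:E)%E.
  rewrite /laplace (ge0_integral_density mk k0 muE' measurableT (mex th))//.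
have lapD th : (laplace mu t th < +oo)%E <-> D th.
  split=> [h|Dth]; last by rewrite lapE Zin// ltry.
  by apply: contrapT => nD; move: h; rewrite lapE Zout// ltxx.
have cgfD th : D th -> cgf mu t th = psi th.
  by move=> Dth; rewrite cgfE lapE Zin//= expRK.
have phiE : phi c F mu = cgf mu t.
  by apply/funext => th; rewrite /phi /log_normalizer1 log_normalizerE coordE.
have densI p A : par F p -> measurable A ->
    (\int[ref]_(x in A) (dens (d := F) p x)%:E =
     \int[mu]_(x in A) (expR (nat_par p * t x - cgf mu t (nat_par p)))%:E)%E.
  move=> Pp mA; have Dp : D (nat_par p) by exists p.
  have mte : measurable_fun A (fun x : X => (expR (nat_par p * t x - cgf mu t (nat_par p)))%:E).
    by apply/measurable_EFinP/measurable_funTS; exact: measurable_tilt.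
  rewrite (ge0_integral_density mk k0 muE' mA mte); last by move=> x; rewrite lee_fin expR_ge0.
  by apply: eq_integral => x _; rewrite densE// cgfD.
have mdens p : par F p -> measurable_fun setT (dens (d := F) p : X -> R).
  move=> Pp; have -> : dens (d := F) p = fun x => expR (nat_par p * tF x - psi (nat_par p)) * k x.
    by apply/funext => x; rewrite densE.
  by apply: measurable_funM => //; exact: measurable_tilt.
have dens0 p x : par F p -> 0 <= dens (d := F) p x.
  by move=> Pp; rewrite densE// mulr_ge0 ?expR_ge0.
have formE p nu : par F p -> has_density F p nu <-> exp_form (X := X) (inclusion F) mu (nat_par p)%:M nu.
  move=> Pp; have Dp : D (nat_par p) by exists p.
  apply: iff_trans (iff_sym (exp_formE (X := X) _ _ _ _)); rewrite coordE; split.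
    move=> h; split; first exact/(lapD _).2.
    by move=> A mA; rewrite h// densI.
  by move=> [_ h] A mA; rewrite h// densI.
have exists_nu p : par F p -> exists nu, has_density F p nu.
  move=> Pp; have Dp : D (nat_par p) by exists p.
  have [m mE] := exists_density_measure ref (mdens p Pp) (fun x => dens0 p x Pp).
  have m1 : m setT = 1%E.
    have mz : measurable_fun setT (fun x : X => expR (nat_par p * tF x) * k x).
      by apply: measurable_funM mk; exact: measurable_expR_lin mt (nat_par p).
    have z0 (x : X) : setT x -> 0 <= expR (nat_par p * tF x) * k x.
      by move=> _; rewrite mulr_ge0 ?expR_ge0.
    rewrite mE; under eq_integral do rewrite densE// addrC expRD -mulrA.
    rewrite (ge0_integralM_EFin ref measurableT mz z0 (expR_ge0 _)) Zin// -EFinM -expRD.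
    by rewrite addNr expR0.
  have [nu nuE] := @exists_probability R _ (borel (fspace F)) m (point : fspace F) m1.
  by exists nu => A mA; rewrite nuE mE.
have cX := model_category.
have mean p nu : par F p -> has_density F p nu ->
    expectation nu t = (psi1 (nat_par p))%:E /\
    expectation nu t = (derive1 (phi c F mu) (nat_par p))%:E /\
    variance nu t = (derive1n 2 (phi c F mu) (nat_par p))%:E.
  move=> Pp nuE; have Dp : D (nat_par p) by exists p.
  have [a [b [/andP[ap pb] abD]]] := oD Dp.
  have Zfin h : a < h < b -> (laplace mu t h < +oo)%E by move=> /abD/((lapD _).2).
  have Zpos h : a < h < b -> 0 < fine (laplace mu t h).
    by move=> /abD Dh; rewrite lapE Zin//= expR_gt0.
  have pab : a < nat_par p < b by rewrite ap.
  have E1 : cgf1 mu t (nat_par p) = psi1 (nat_par p).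
    have [_ <-] := dpsi Dp; have [_ <-] := is_derive_cgf mt Zfin Zpos pab.
    apply: near_eq_derive; apply: filterS (near_itvoo pab) => h hab.
    by rewrite cgfD//; exact: abD.
  have [_ nuE'] := (formE p nu Pp).1 nuE.
  have {}nuE' A : measurable A ->
      nu A = (\int[mu]_(x in A) (expR (nat_par p * t x - cgf mu t (nat_par p)))%:E)%E.
    by move=> mA; rewrite nuE// densI.
  have Za : (laplace mu t ((a + nat_par p) / 2) < +oo)%E by apply: Zfin; lra.
  have Zb : (laplace mu t ((nat_par p + b) / 2) < +oo)%E by apply: Zfin; lra.
  have pab' : (a + nat_par p) / 2 < nat_par p < (nat_par p + b) / 2 by lra.
  have TM := tilted_mean mt Za Zb pab' (Zpos _ pab) nuE'.
  have TV := tilted_variance mt Za Zb pab' (Zpos _ pab) nuE'.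
  have D2 : derive1n 2 (cgf mu t) (nat_par p) = cgf2 mu t (nat_par p).
    by rewrite -(derive2_cgf mt Zfin Zpos pab) /= .
  by rewrite phiE (derive1_cgf mt Zfin Zpos pab) D2 TM TV E1.
have two : two_members (X := X) (members F).
  have [p1 [p2 [P1 P2 ne]]] := two_means.
  have [nu1 n1] := exists_nu p1 P1; have [nu2 n2] := exists_nu p2 P2.
  exists nu1, nu2; split; [by exists p1|by exists p2|].
  apply: contrapT => H; apply: ne.
  have E A : measurable A -> nu1 A = nu2 A.
    by move=> mA; apply: contrapT => h; apply: H; exists A.
  have [M1 _] := mean p1 nu1 P1 n1; have [M2 _] := mean p2 nu2 P2 n2.
  have : expectation nu1 t = expectation nu2 t.
    by rewrite unlock; apply: eq_measure_integral => A mA _; exact: E.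
  by rewrite M1 M2 => -[].
have [p1 [p2 [P1 P2 _]]] := two_means.
have iden p (nu : probability X R) : par F p -> has_density F p nu -> inner_exhausted nu.
  by move=> Pp nuE; exact: inner_exhausted_density iref (mdens p Pp) nuE.
have okm nu : members F nu -> ok_measure X nu.
  move=> [p Pp nuE]; apply: (ok_measure_laplace (h := 0)); first exact: iden nuE.
  by rewrite laplace0 ltry.
have okmu : ok_measure X mu.
  apply: (ok_measure_laplace (h := nat_par p1)).
    exact: inner_exhausted_density iref mk muE'.
  by apply: (lapD _).2; exists p1.
have rT : realization (X := X) (inclusion F) (members F) mu.
  split; [exact: ok_stat_inclusion|exact: okmu|].
  by move=> nu [p Pp nuE]; exists (nat_par p)%:M; exact: (formE p nu Pp).1.
have parE : parameter_set (X := X) (inclusion F) (members F) mu =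
    natural_domain (X := X) (inclusion F) mu.
  apply/seteqP; split=> [th [nu _ []] //|th nth].
  have : D (th 0 0).
    apply: (lapD _).1; rewrite -coordE; apply: (natural_domainE (X := X) mu (th 0 0) _).1.
      by rewrite coordE.
    by rewrite -scalar_mx11.
  move=> [p Pp pth]; have [nu nuE] := exists_nu p Pp.
  exists nu; first by exists p.
  by rewrite (scalar_mx11 th) -pth; exact: (formE p nu Pp).1.
have natE : natural_domain (X := X) (inclusion F) mu = (fun th : 'cV[R]_1 => th 0 0) @^-1` D.
  have E th := natural_domainE (X := X) (T := inclusion F) mu (th 0 0).
  apply/seteqP; split=> th nth.
    apply: (lapD _).1; rewrite -coordE; apply: (natural_domainE (X := X) mu (th 0 0) _).1.
      by rewrite coordE.
    by rewrite -scalar_mx11.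
  rewrite (scalar_mx11 th); apply: (natural_domainE (X := X) mu (th 0 0) _).2.
    by rewrite coordE.
  by rewrite coordE; exact: (lapD _).2.
have openD : open D.
  rewrite openE => th Dth; have [a [b [hab abD]]] := oD Dth.
  by apply: filterS (near_itvoo hab) => h /abD.
have rv : regular_via (X := X) (members F) (inclusion F) mu.
  split.
  - by split; [exact: rT|move=> n' T' mu' r'; exact: two_members_order two r'].
  - exact: parE.
  - rewrite parE natE; apply: open_comp openD => th _; exact: coord_continuous.
split.
- split.
  + exact: cX.
  + split; [|exact: okm|by exists 1%N, (inclusion F), mu].
    by have [nu nuE] := exists_nu p1 P1; exists nu, p1.
  + exact: rv.
  + by move=> p x; exact: dens0.
  + move=> p Pp; split; first exact: exists_nu.
    move=> nu nuE; have [_ [M V]] := mean p nu Pp nuE.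
    by split; [exact: (formE p nu Pp).1|exact: M|exact: V].
- exact: two.
- by move=> th; rewrite coordE; exact: lapD.
- by move=> th Dth; rewrite phiE cgfD.
Qed.

End models.

(** * Topology and inner exhaustion of the sample spaces *)

Section sample_spaces.
Context {R : realType}.

Lemma inner_exhausted_bigcup (X : ptopologicalType) (m : {measure set (borel X) -> \bar R}) :
  (forall A : set (borel X), measurable A -> exists C : nat -> set X,
     [/\ forall j, compact (C j), forall j, C j `<=` A & m (A `\` \bigcup_j C j) = 0%E]) ->
  inner_exhausted m.
Proof.
move=> H A mA; have [C [cC CA C0]] := H A mA.
exists (fun n => \big[setU/set0]_(i < n.+1) C i); split.
- by move=> j; exact: bigsetU_compact.
- by move=> j; rewrite -bigcup_mkord; apply: bigcup_sub => i _; exact: CA.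
- by move=> i j ij; apply/subsetPset; rewrite -!bigcup_mkord => x [k /= ki Ck]; exists k => //=; exact: leq_trans ki _.
- by rewrite bigcup_bigsetU_bigcup.
Qed.

(** A compact subset misses less than 1/(n+1) of A in [-n, n]. In a fixed [-n, n] the part of A
    missed by all of them is smaller than 1/(k+1) for every k >= n, hence null. *)
Lemma lebesgue_exhausted (A : set (measurableTypeR R)) : measurable A ->
  exists C : nat -> set R, [/\ forall j, compact (C j), forall j, C j `<=` A &
    lebesgue_measure (A `\` \bigcup_j C j) = 0%E].
Proof.
move=> mA; pose I n : set (measurableTypeR R) := [set` `[(- n%:R : R), n%:R]].
have mI n : measurable (I n) by exact: measurable_itv.
have finI n : (lebesgue_measure (A `&` I n) < +oo)%E.
  apply: (@le_lt_trans _ _ (lebesgue_measure (I n))).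
    by apply: le_measure; rewrite ?inE//; exact: measurableI.
  by rewrite lebesgue_measure_itv; case: ifP => _; rewrite ?ltry// -EFinB ltry.
have ex n : exists V : set R, [/\ compact V, V `<=` A `&` I n &
    (lebesgue_measure ((A `&` I n) `\` V) < (n.+1%:R^-1 : R)%:E)%E].
  exact: (lebesgue_regularity_inner (measurableI _ _ mA (mI n)) (finI n)).
have [C CP] := choice ex; exists C; split.
- by move=> j; have [] := CP j.
- by move=> j; have [_ h _] := CP j; apply: subset_trans h _; exact: subIsetl.
have mC j : measurable (C j : set (measurableTypeR R)).
  have [cC _ _] := CP j; apply: closed_measurable; apply: compact_closed cC.
  exact: norm_hausdorff.
pose N : set (measurableTypeR R) := A `\` \bigcup_j C j.
have mN : measurable N by apply: measurableD => //; exact: bigcupT_measurable.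
have NI n : lebesgue_measure (N `&` I n) = 0%E.
  apply/eqP; rewrite eq_le measure_ge0 andbT; apply/lee_addgt0Pr => e e0; rewrite add0e.
  pose k := maxn n (Num.truncn e^-1); have [_ _ hk] := CP k.
  apply: (@le_trans _ _ (lebesgue_measure ((A `&` I k) `\` C k))).
    apply: le_measure; rewrite ?inE.
    - exact: measurableI.
    - by apply: measurableD => //; exact: measurableI.
    move=> x [[Ax nC]]; rewrite /I/= !in_itv/= => /andP[h1 h2].
    have nk : (n%:R : R) <= k%:R by rewrite ler_nat leq_maxl.
    split; last by move=> Cx; apply: nC; exists k.
    by split=> //; apply/andP; split; lra.
  apply: le_trans (ltW hk) _; rewrite lee_fin invf_ple ?posrE//.
  have ei : 0 < e^-1 by rewrite invr_gt0.
  apply: le_trans (ltW (truncnS_gt _)) _; rewrite ler_nat ltnS leq_maxr//.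
have -> : A `\` \bigcup_j C j = \bigcup_n (N `&` I n).
  apply/seteqP; split=> [x Nx|x [n _ [Nx _]]//].
  exists (Num.truncn `|x|).+1 => //; split=> //.
  by rewrite /I/= in_itv/= -ler_norml ltW// truncnS_gt.
have mNI n : measurable (N `&` I n) by exact: measurableI.
have neg n : (@lebesgue_measure R).-negligible (N `&` I n).
  by apply/negligibleP; [exact: mNI|exact: NI].
have /negligibleP := negligible_bigcup neg; apply; exact: bigcupT_measurable.
Qed.

Lemma inner_exhausted_line : inner_exhausted (@lebesgue_line R).
Proof.
apply: inner_exhausted_bigcup => A mA.
exact: (lebesgue_exhausted (borel_line_measurable mA)).
Qed.

Lemma posReal_continuous : continuous (@posReal_val R).
Proof. exact: initial_continuous. Qed.

Lemma posReal_nbhs (x : posReal R) (U : set (posReal R)) : nbhs x U ->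
  exists2 V, nbhs (posReal_val x) V & @posReal_val R @^-1` V `<=` U.
Proof.
move=> [W [[V oV VW] Wx] WU]; exists V.
  by apply: open_nbhs_nbhs; split=> //; rewrite -VW in Wx.
by apply: subset_trans WU; rewrite -VW.
Qed.

Lemma posReal_hausdorff : hausdorff_space (posReal R).
Proof.
move=> p q pq; apply: (@posReal_val_inj R); apply: (@norm_hausdorff R R) => A B pA qB.
have [z [Az Bz]] := pq _ _ (posReal_continuous pA) (posReal_continuous qB).
by exists (posReal_val z).
Qed.

Lemma posReal_gt0 (x : posReal R) : 0 < posReal_val x. Proof. exact: (set_valP x). Qed.

Lemma posReal_surj (y : R) : 0 < y -> exists x : posReal R, posReal_val x = y.
Proof. by move=> y0; exists (SigSub (mem_set y0 : y \in [set x : R | 0 < x])). Qed.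

(** The cluster point found in the line lies in C, so it is positive and lifts to the half-line. *)
Lemma posReal_compact (C : set R) : compact C -> (forall y, C y -> 0 < y) ->
  compact (@posReal_val R @^-1` C).
Proof.
move=> cC C0 F FF FC.
have : (C `&` cluster (@posReal_val R @ F)) !=set0 by exact: cC.
move=> [y [Cy cy]]; have [x xy] := posReal_surj (C0 y Cy).
exists x; split; first by rewrite /= xy.
move=> A U FA /posReal_nbhs[V]; rewrite xy => yV VU.
have FA' : (@posReal_val R @ F) (@posReal_val R @` A).
  by apply: (@filterS _ F _ A) FA => z Az; exists z.
have [z [[w Aw wz] Vz]] := cy _ _ FA' yV.
by exists w; split=> //; apply: VU; rewrite /= wz.
Qed.

Lemma posReal_locally_compact : locally_compact [set: posReal R].
Proof.
move=> x _; exists (@posReal_val R @^-1` [set` `[posReal_val x / 2, posReal_val x + 1]]).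
  apply: (@filterS _ (nbhs x) _ (@posReal_val R @^-1` [set` `[posReal_val x / 2, posReal_val x + 1]])).
    by move=> y.
  apply: (@posReal_continuous x); have x0 := posReal_gt0 x.
  have : posReal_val x / 2 < posReal_val x < posReal_val x + 1 by lra.
  move=> /near_itvoo; apply: filterS => y; rewrite /= in_itv/=; lra.
split.
  apply: posReal_compact; first exact: segment_compact.
  by move=> y; rewrite /= in_itv/=; have := posReal_gt0 x; lra.
by apply: closed_comp => [y _|]; [exact: posReal_continuous|exact: itv_closed].
Qed.

Lemma inner_exhausted_posReal : inner_exhausted (@lebesgue_posReal R).
Proof.
apply: inner_exhausted_bigcup => A mA.
have [C [cC CA C0]] := lebesgue_exhausted (image_posReal_measurable mA).
have C_gt0 j y : C j y -> 0 < y by move=> /CA[x _ <-]; exact: posReal_gt0.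
exists (fun j => @posReal_val R @^-1` C j); split.
- by move=> j; apply: posReal_compact => // y; exact: C_gt0.
- by move=> j x /CA[z Az /posReal_val_inj <-].
rewrite -[RHS]C0 /= /lebesgue_posReal; congr (lebesgue_measure _).
apply/seteqP; split=> [_ [x [Ax nC] <-]|y [[x Ax xy] nC]].
  by split; [exists x|move=> [j _ Cj]; apply: nC; exists j].
by exists x => //; split=> // -[j _ Cj]; apply: nC; exists j => //; rewrite -xy.
Qed.

(** The fibers of v have at most one point, so every set is a countable union of compact sets. *)
Lemma inner_exhausted_injective_nat (X : ptopologicalType) (v : X -> nat)
    (m : {measure set (borel X) -> \bar R}) : injective v -> inner_exhausted m.
Proof.
move=> vi; apply: inner_exhausted_bigcup => A mA.
exists (fun j => A `&` v @^-1` [set j]); split.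
- move=> j; apply: finite_compact; have [[x Ax]|E] := pselect (A `&` v @^-1` [set j] !=set0).
    apply: (@sub_finite_set _ _ [set x]); last exact: finite_set1.
    by move=> y [_ vy]; apply: vi; case: Ax => _ ->.
  by rewrite (_ : _ `&` _ = set0) //; apply/seteqP; split=> // y Ay; apply: E; exists y.
- by move=> j; exact: subIsetl.
- rewrite (_ : _ `\` _ = set0) ?measure0//; apply/seteqP; split=> // x [Ax]; apply.
  by exists (v x).
Qed.

Lemma discrete_locally_compact (X : discreteTopologicalType) : locally_compact [set: X].
Proof.
move=> x _; exists [set x].
  by apply: filterS (discrete_set1 x) => y.
by split; [exact: compact_set1|exact: discrete_closed].
Qed.

Lemma discrete_continuous (X : discreteTopologicalType) (Y : topologicalType) (f : X -> Y) :
  continuous f.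
Proof. by apply/continuousP => A _; exact: discrete_open. Qed.

Lemma discrete_borel_measurable (f : nat -> R) : measurable_fun setT (f : borel nat -> R).
Proof. by apply: (iffLR (measurable_fun_borel _)); apply: continuous_borel; exact: discrete_continuous. Qed.

Lemma ge0_integral_line (f : R -> R) : measurable_fun setT f -> (forall x, 0 <= f x) ->
  (\int[@lebesgue_line R]_x (f x)%:E = \int[lebesgue_measure]_x (f x)%:E)%E.
Proof.
move=> mf f0; have mid : measurable_fun setT (fun x : borel R => (x : measurableTypeR R)).
  move=> _ A mA; rewrite setTI; exact: ((borelP A).2 mA).
have [m mE mI] := exists_pushforward (@lebesgue_line R) mid.
have := mI (fun x => (f x)%:E) setT measurableT.
rewrite preimage_setT => <-.
- apply: eq_measure_integral => A mA _; rewrite mE//.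
- by apply/measurable_EFinP.
- by move=> y; rewrite lee_fin.
Qed.

End sample_spaces.

(** * Models with quadratic variance function *)

Section quadratic_models.
Context {R : realType} (c : category) (F : densityFamily R).
Local Notation X := (borelSpace R c (fspace F)).
Local Notation tF := (@Defs.incl R F).

(** All that is used of a family: the identities for its log normalizer and curvature, and the same
    information as [cgf1] and [variance_at], the form in which families are matched. *)
Definition quadratic_model (nat_par psi psi1 : R -> R) (a2 a1 a0 : R) :=
  exists mu : {measure set X -> \bar R},
  [/\ inclusion_realization c F mu nat_par, two_members (X := X) (members F) &
      forall p, par F p -> let th := nat_par p in
      [/\ phi c F mu th = psi th, (phi c F mu)^`()%classic th = psi1 th,
          (phi c F mu)^`(2)%classic th = a2 * psi1 th ^+ 2 + a1 * psi1 th + a0 &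
          HSC c F mu th = a2] /\
      (cgf1 mu (coord (X := X) (inclusion F)) th = psi1 th /\
       variance_at mu (coord (X := X) (inclusion F)) th a2 a1 a0)].

Variables (nat_par : R -> R) (psi psi1 : R -> R) (k : fspace F -> R) (D : set R) (a2 a1 a0 : R).
Hypotheses (hF : hausdorff_space (fspace F)) (lF : locally_compact [set: fspace F]).
Hypothesis ct : continuous (@Defs.incl R F).
Hypothesis iref : inner_exhausted (ref_measure F).
Hypothesis mk : measurable_fun setT (k : X -> R).
Hypothesis k0 : forall x, 0 <= k x.
Hypothesis DE : nat_par @` par F = D.
Hypothesis oD : forall th, D th -> exists a b, a < th < b /\ forall h, a < h < b -> D h.
Hypothesis densE : forall p x, par F p ->
  dens (d := F) p x = expR (nat_par p * tF x - psi (nat_par p)) * k x.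
Hypothesis Zin : forall th, D th ->
  (\int[ref_measure F]_x (expR (th * tF x) * k x)%:E = (expR (psi th))%:E)%E.
Hypothesis Zout : forall th, ~ D th ->
  (\int[ref_measure F]_x (expR (th * tF x) * k x)%:E = +oo)%E.
Hypothesis dpsi : forall th : R, D th -> is_derive th 1 psi (psi1 th).
Hypothesis dpsi1 : forall th : R, D th ->
  is_derive th 1 psi1 (a2 * psi1 th ^+ 2 + a1 * psi1 th + a0).
Hypothesis two_means : exists th1 th2, [/\ D th1, D th2 & psi1 th1 <> psi1 th2].

(** Everything follows from psi1' = V(psi1): then (log V)' = 2 a2 psi1 + a1 and (log V)'' = 2 a2 V
    along the parameter, so the curvature is a2. *)
Lemma quadratic_modelP : quadratic_model nat_par psi psi1 a2 a1 a0.
Proof.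
have two : exists p1 p2, [/\ par F p1, par F p2 & psi1 (nat_par p1) <> psi1 (nat_par p2)].
  move: two_means => [th1 [th2 []]]; rewrite -DE => -[p1 P1 <-] [p2 P2 <-] ne.
  by exists p1, p2.
have oD' th : (nat_par @` par F) th -> exists a b, a < th < b /\ forall h, a < h < b -> (nat_par @` par F) h.
  by rewrite DE; exact: oD.
have Zin' th : (nat_par @` par F) th ->
  (\int[ref_measure F]_x (expR (th * tF x) * k x)%:E = (expR (psi th))%:E)%E.
  by rewrite DE; exact: Zin.
have Zout' th : ~ (nat_par @` par F) th ->
  (\int[ref_measure F]_x (expR (th * tF x) * k x)%:E = +oo)%E.
  by rewrite DE; exact: Zout.
have dpsi' (th : R) : (nat_par @` par F) th -> is_derive th 1 psi (psi1 th).
  by rewrite DE; exact: dpsi.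
have [mu [ir P2 lapD phiD]] := @model R c F nat_par psi psi1 k hF lF ct iref mk k0 oD' densE Zin' Zout' dpsi' two.
rewrite DE in lapD phiD.
have cX : in_category c X by case: ir.
have rv : regular_via (X := X) (members F) (inclusion F) mu by case: ir.
have [[rT _] _ _] := rv; have [oT _ _] := rT; have mt := coord_measurable cX oT.
exists mu; split=> // p Pp /=; set th := nat_par p.
have Dth : D th by rewrite -DE; exists p.
have [a [b [hab abD]]] := oD Dth.
pose t := coord (X := X) (inclusion F); pose V h := a2 * psi1 h ^+ 2 + a1 * psi1 h + a0.
have Zfin h : a < h < b -> (laplace mu t h < +oo)%E by move=> /abD/((lapD _).2).
have V0 h : a < h < b -> 0 < cgf2 mu t h by exact: (cgf2_gt0 cX P2 rv Zfin).
have Zpos h : a < h < b -> 0 < fine (laplace mu t h).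
  by move=> /Zfin fh; have [nu _ e] := natural_parameter cX rv fh; exact: (exp_form_laplace_gt0 mt e).
have phiE : phi c F mu = cgf mu t.
  by apply/funext => h; rewrite /phi /log_normalizer1 log_normalizerE.
have near_psi h : a < h < b -> \forall y \near h, phi c F mu y = psi y.
  by move=> /near_itvoo; apply: filterS => y /abD; exact: phiD.
have E1 h : a < h < b -> cgf1 mu t h = psi1 h.
  move=> hh; have [_ <-] := dpsi (abD h hh); have [_ <-] := is_derive_cgf mt Zfin Zpos hh.
  by rewrite -phiE; apply: near_eq_derive; exact: near_psi.
have E2 h : a < h < b -> cgf2 mu t h = V h.
  move=> hh; rewrite /V; have [_ <-] := dpsi1 (abD h hh); have [_ <-] := is_derive_cgf1 mt Zfin Zpos hh.
  by apply: near_eq_derive; apply: filterS (near_itvoo hh) => y; exact: E1.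
have D2 h : a < h < b -> (phi c F mu)^`(2)%classic h = V h.
  by move=> hh; rewrite phiE (derive2_cgf mt Zfin Zpos hh) E2.
have fisherE h : a < h < b -> fisher_metric (X := X) (inclusion F) mu h = V h := D2 h.
have dV (h : R) : a < h < b -> is_derive h 1 V ((2 * a2 * psi1 h + a1) * V h).
  move=> hh; have h1 := dpsi1 (abD h hh).
  apply: (is_derive_eq (is_deriveD (is_deriveD (is_deriveZ a2 (is_deriveX 2 h1)) (is_deriveZ a1 h1)) (is_derive_cst a0 h 1))).
  by rewrite /GRing.scale/= /V; ring.
have dl (h : R) : a < h < b -> is_derive h 1 (fun s => ln (fisher_metric (X := X) (inclusion F) mu s)) (2 * a2 * psi1 h + a1).
  move=> hh; have Vh : 0 < V h by rewrite -E2// V0.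
  apply: (near_eq_is_derive (f := fun s => ln (V s))).
    by apply: filterS (near_itvoo hh) => y hy; rewrite fisherE.
  by apply: (is_derive_eq (is_derive_ln_comp (dV h hh) Vh)); rewrite mulfK// gt_eqF.
have dl1 (h : R) : a < h < b -> is_derive h 1 (fun s => 2 * a2 * psi1 s + a1) (2 * a2 * V h).
  move=> hh; have h1 := dpsi1 (abD h hh).
  apply: (is_derive_eq (is_deriveD (is_deriveZ (2 * a2) h1) (is_derive_cst a1 h 1))).
  by rewrite addr0.
split; [split|split].
- exact: phiD.
- by rewrite phiE (derive1_cgf mt Zfin Zpos hab) E1.
- exact: D2.
- rewrite /HSC /hsc fisherE//.
  have Vh : 0 < V th by rewrite -E2// V0.
  have -> : ((fun s => ln (fisher_metric (X := X) (inclusion F) mu s))^`(2))%classic th = 2 * a2 * V th.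
    apply: (near_is_derive_derive2 (f' := fun s => 2 * a2 * psi1 s + a1) (f'' := fun h => 2 * a2 * V h)).
      by apply: filterS (near_itvoo hab) => y; exact: dl.
    by apply: filterS (near_itvoo hab) => y; exact: dl1.
  have V2 : 2 * V th != 0 by rewrite mulf_neq0// gt_eqF.
  by apply: (mulIf V2); rewrite divfK//; ring.
- exact: E1.
- exists (Num.min (th - a) (b - th)).
    by rewrite lt_min; lra.
  move=> h hh; have : a < h < b.
    by move: hh; have := ge_min (th - a) (th - a) (b - th); have := ge_min (b - th) (th - a) (b - th); rewrite !lexx orbT /=; lra.
  by move=> hh'; split; [exact: Zfin|exact: Zpos|rewrite E2// E1].
Qed.

End quadratic_models.

(** * The six families as quadratic models *)

Section model_integrals.
Context {R : realType}.
Local Notation pos := ([set` `]0, +oo[%R] : set R).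

(* A nonnegative statistic has an increasing Laplace transform. *)
Lemma integral_unbounded d (T : measurableType d) (m : {measure set T -> \bar R})
    (t k : T -> R) (th : R) : measurable_fun setT t -> measurable_fun setT k ->
  (forall x, 0 <= t x) -> (forall x, 0 <= k x) ->
  (forall M, exists2 u, u <= th &
     (M%:E <= \int[m]_x (expR (u * t x) * k x)%:E)%E) ->
  (\int[m]_x (expR (th * t x) * k x)%:E = +oo)%E.
Proof.
move=> mt mk t0 k0 H; apply/eqyP => M M0.
have [u uth h] := H M; apply: le_trans h _.
have me v : measurable_fun setT (fun x => (expR (v * t x) * k x)%:E).
  by apply/measurable_EFinP; apply: measurable_funM mk; exact: measurable_expR_lin mt v.
apply: ge0_le_integral => //.
- by move=> x _; rewrite lee_fin mulr_ge0 ?expR_ge0.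
- by move=> x _; rewrite lee_fin ler_wpM2r// ler_expR ler_wpM2r.
Qed.

Lemma ge0_integral_posReal (f : R -> R) : measurable_fun setT f ->
  (forall x, 0 <= f x) ->
  (\int[@lebesgue_posReal R]_x (f (posReal_val x))%:E =
   \int[lebesgue_measure]_(x in pos) (f x)%:E)%E.
Proof.
move=> mf f0; have mv : measurable_fun setT (fun x : borel (posReal R) => (posReal_val x : measurableTypeR R)).
  by apply: (iffLR (measurable_fun_borel _)); apply: continuous_borel; exact: posReal_continuous.
have [m mE mI] := exists_pushforward (@lebesgue_posReal R) mv.
have mpos : measurable (pos : set (measurableTypeR R)) by exact: measurable_itv.
have mfE : measurable_fun setT (fun x : measurableTypeR R => (f x)%:E) by apply/measurable_EFinP.
have fE0 (y : measurableTypeR R) : (0 <= (f y)%:E)%E by rewrite lee_fin.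
have preE : (fun x : borel (posReal R) => (posReal_val x : measurableTypeR R)) @^-1`
    pos = setT.
  by apply/seteqP; split=> // x _; rewrite /= in_itv/= andbT posReal_gt0.
rewrite -preE -(mI _ _ mpos mfE fE0); apply: eq_measure_integral => A mA Apos.
rewrite [LHS]mE /= /lebesgue_posReal; congr (lebesgue_measure _).
apply/seteqP; split=> [_ [x Ax <-]//|y Ay].
have : 0 < y by have := Apos y Ay; rewrite /= in_itv/= andbT.
by move=> /posReal_surj[x xy]; exists x => //=; rewrite xy.
Qed.

Lemma ge0_integral_upto n (f : nat -> R) : (forall x, 0 <= f x) ->
  (\int[@counting (borel (upto n)) R]_x (f (upto_val x))%:E =
   (\sum_(i < n.+1) f i)%:E)%E.
Proof.
move=> f0; have mA (A : set (borel (upto n))) : measurable A.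
  by apply: sub_sigma_algebra; exact: (@discrete_open (upto n)).
have mf : measurable_fun setT (fun x : borel (upto n) => (f (upto_val x))%:E) by move=> _ ? ?.
pose s : seq (upto n) := enum 'I_n.+1.
have setE : [set: borel (upto n)] = \big[setU/set0]_(i <- s) [set i].
  apply/seteqP; split=> // x _; rewrite -bigcup_seq; exists x => //=.
  by rewrite (mem_enum 'I_n.+1).
rewrite setE ge0_integral_bigsetU//.
- under eq_bigr do rewrite (integral_counting_set1 _ (mA _)).
  by rewrite sumEFin big_enum.
- exact: enum_uniq.
- by apply/trivIsetP => i j _ _ ij; apply/seteqP; split=> // x [-> ji]; move/eqP: ij; apply.
- by move=> x _; rewrite lee_fin.
Qed.

Lemma nat_id_bijective : bijective (id : nat -> nat). Proof. by exists id. Qed.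

Lemma ge0_integral_nat (f : nat -> R) l : (forall x, 0 <= f x) ->
  (\sum_(0 <= k < n) f k) @[n --> \oo] --> l ->
  (\int[@counting (borel nat) R]_x (f x)%:E = l%:E)%E.
Proof.
move=> f0 fl; apply: (@ge0_integral_counting R _ (borel nat) id) => //.
- by move=> k; apply: sub_sigma_algebra; exact: (@discrete_open nat).
- exact: nat_id_bijective.
- exact: discrete_borel_measurable.
Qed.

End model_integrals.

Section six_models.
Context {R : realType} (c : category).
Local Notation pos := ([set` `]0, +oo[%R] : set R).

Let realline (th : R) (P : R -> Prop) : (forall h, P h) -> exists a b, a < th < b /\ forall h, a < h < b -> P h.
Proof. by move=> H; exists (th - 1), (th + 1); split=> //; lra. Qed.

Lemma normal_model (s : R) : 0 < s ->
  quadratic_model c (normal_family s) (fun m => m / s ^+ 2)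
    (fun th => s ^+ 2 * th ^+ 2 / 2) (fun th => s ^+ 2 * th) 0 0 (s ^+ 2).
Proof.
move=> s0; have sn0 : s != 0 by rewrite gt_eqF.
(* The density at m = 0. Completing the square, exp (th x) k(x) is exp (s^2 th^2 / 2) times the
   normal density with mean s^2 th. *)
pose k (x : R) := (Num.sqrt (2 * pi * s ^+ 2))^-1 * expR (- x ^+ 2 / (2 * s ^+ 2)).
have k0 x : 0 <= k x by rewrite mulr_ge0 ?expR_ge0// invr_ge0 sqrtr_ge0.
have mkR : measurable_fun setT (k : measurableTypeR R -> measurableTypeR R).
  apply: measurable_funM => //; apply: measurableT_comp => //.
  by apply: measurable_funM => //; apply: measurableT_comp => //; exact: measurable_funX.
have mk : measurable_fun setT (k : borel R -> R).
  by move=> _ A mA; have := mkR measurableT A mA; rewrite !setTI => /borelP.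
refine (@quadratic_modelP R c (normal_family s) _ _ _ k setT _ _ _ _ _ _ _ _ _ _ _ _ _ _ _ _ _).
- exact: norm_hausdorff.
- exact: locally_compactR.
- by move=> x; exact: cvg_id.
- exact: inner_exhausted_line.
- exact: mk.
- exact: k0.
- by apply/seteqP; split=> // th _; exists (th * s ^+ 2) => //=; rewrite mulfK// expf_neq0.
- by move=> th _; exact: realline.
- move=> p x _ /=; rewrite /k [RHS]mulrCA -expRD; congr (_ * expR _); by field.
- move=> th _ /=.
  have mf : measurable_fun setT (fun x => expR (th * x) * k x : measurableTypeR R).
    by apply: measurable_funM => //; apply: measurableT_comp => //; exact: measurable_funM.
  rewrite (ge0_integral_line mf); last by move=> x; rewrite mulr_ge0 ?expR_ge0.
  have -> : (fun x => (expR (th * x) * k x)%:E) = fun x =>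
     (expR (s ^+ 2 * th ^+ 2 / 2) * normal_pdf (s ^+ 2 * th) s x)%:E.
    apply/funext => x; rewrite normal_pdfE// /normal_peak /normal_fun /k.
    have -> : s ^+ 2 * pi *+ 2 = 2 * pi * s ^+ 2 by rewrite -mulr_natl; ring.
    congr EFin; rewrite mulrCA [RHS]mulrCA -!expRD; congr (_ * expR _).
    by rewrite -mulr_natl; field.
  have mp : measurable_fun setT (normal_pdf (s ^+ 2 * th) s) by exact: measurable_normal_pdf.
  have p0 x : setT x -> 0 <= normal_pdf (s ^+ 2 * th) s x by move=> _; exact: normal_pdf_ge0.
  apply: etrans (ge0_integralM_EFin lebesgue_measure measurableT mp p0 (expR_ge0 _)) _.
  by rewrite integral_normal_pdf mule1.
- by move=> th [].
- move=> th _; have -> : (fun y : R => s ^+ 2 * y ^+ 2 / 2) = (fun y => s ^+ 2 / 2 * y ^+ 2).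
    by apply/funext => y; ring.
  apply: (is_derive_eq (is_deriveZ (s ^+ 2 / 2) (is_deriveX 2 (is_derive_id th 1)))).
  by rewrite /GRing.scale/=; field.
- move=> th _; apply: (is_derive_eq (is_deriveZ (s ^+ 2) (is_derive_id th 1))).
  by rewrite /GRing.scale/=; ring.
- exists 0, 1; split=> //; rewrite mulr0 mulr1 => /esym/eqP.
  by rewrite expf_eq0 (negbTE sn0).
Qed.

Lemma poisson_model :
  quadratic_model c (poisson_family R) (@ln R) (@expR R) (@expR R) 0 1 0.
Proof.
pose k (x : nat) := (x`!%:R : R)^-1.
have k0 x : 0 <= k x by rewrite invr_ge0.
refine (@quadratic_modelP R c (poisson_family R) _ _ _ k setT _ _ _ _ _ _ _ _ _ _ _ _ _ _ _ _ _).
- exact: (@discrete_hausdorff nat).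
- exact: (@discrete_locally_compact nat).
- exact: (@discrete_continuous nat).
- exact: (@inner_exhausted_injective_nat R nat id).
- exact: discrete_borel_measurable.
- exact: k0.
- by apply/seteqP; split=> // th _; exists (expR th); rewrite /= ?expR_gt0 ?expRK.
- by move=> th _; exact: realline.
- move=> p x /= p0; rewrite lnK ?posrE// expRD expRM_natr lnK ?posrE//.
- move=> th _ /=.
  apply: (ge0_integral_nat (f := fun x => expR (th * x%:R) * k x)).
    by move=> x; rewrite mulr_ge0 ?expR_ge0.
  have h : series (exp_coeff (expR th)) @ \oo --> expR (expR th) := is_cvg_series_exp_coeff (expR th).
  apply: cvg_trans h.
  apply: near_eq_cvg; apply: nearW => n; rewrite /series/=.
  by apply: eq_bigr => i _; rewrite /exp_coeff/= /k -expRM_natr.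
- by move=> th [].
- by move=> th _; apply: (is_derive_eq (is_derive_expR th)); rewrite mul0r add0r mul1r addr0.
- by exists 0, 1; split=> // /expR_inj/esym/eqP; rewrite oner_eq0.
Qed.

Let negative (th : R) : th < 0 -> exists a b, a < th < b /\ forall h, a < h < b -> h < 0.
Proof. by move=> H; exists (th - 1), 0; split=> [|h]; lra. Qed.

Lemma gamma_model (a : R) : 0 < a ->
  quadratic_model c (gamma_family a) (fun b => - b)
    (fun th => - a * ln (- th)) (fun th => - (a / th)) (1 / a) 0 0.
Proof.
move=> a0; have an0 : a != 0 by rewrite gt_eqF.
have G0 := Gamma_gt0 a0; have Gn0 : Gamma a != 0 by rewrite gt_eqF.
(* This is x^(a-1) / Gamma(a); the factor b^a of the density goes into psi. *)
pose k (x : R) := (Gamma a)^-1 * expR ((a - 1) * ln x).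
have k0 x : 0 <= k x by rewrite mulr_ge0 ?expR_ge0// invr_ge0 ltW.
have mkR : measurable_fun setT (k : measurableTypeR R -> measurableTypeR R).
  apply: measurable_funM => //; apply: measurableT_comp => //.
  by apply: measurable_funM => //; exact: measurable_ln.
have mv : measurable_fun setT (@posReal_val R : borel (posReal R) -> R).
  by apply: (iffLR (measurable_fun_borel _)); apply: continuous_borel; exact: posReal_continuous.
have mk : measurable_fun setT (k \o @posReal_val R : borel (posReal R) -> R).
  by apply: measurableT_comp mv; exact: mkR.
have Zin (th : R) : th < 0 -> (\int[@lebesgue_posReal R]_x (expR (th * posReal_val x) * k (posReal_val x))%:E
    = (expR (- a * ln (- th)))%:E)%E.
  move=> th0; have tn0 : 0 < - th by rewrite oppr_gt0.
  have mf : measurable_fun setT (fun x => expR (th * x) * k x : measurableTypeR R).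
    by apply: measurable_funM => //; apply: measurableT_comp => //; exact: measurable_funM.
  rewrite (ge0_integral_posReal mf); last by move=> x; rewrite mulr_ge0 ?expR_ge0.
  pose w : R := - th * expR ((a - 1) * ln (- th)).
  have w0 : 0 < w by rewrite mulr_gt0 ?expR_gt0.
  have mg : measurable_fun setT (fun x => (gamma_weight a x)%:E).
    by apply/measurable_EFinP; exact: measurable_gamma_weight.
  have g0 (x : R) : (0 <= (gamma_weight a x)%:E)%E by rewrite lee_fin expR_ge0.
  have S := ge0_integral_scale tn0 mg g0.
  have E : (\int[lebesgue_measure]_(x in pos) (expR (th * x) * k x)%:E =
    ((Gamma a)^-1 * expR (- ((a - 1) * ln (- th))))%:E *
     \int[lebesgue_measure]_(x in pos) (gamma_weight a (- th * x))%:E)%E.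
    have mpos : measurable (pos : set (measurableTypeR R)) by exact: measurable_itv.
    have mgs : measurable_fun setT (fun x => gamma_weight a (- th * x) : measurableTypeR R).
      by apply: (measurableT_comp (measurable_gamma_weight a)); exact: measurable_funM.
    have gs0 x : pos x -> 0 <= gamma_weight a (- th * x) by move=> _; exact: expR_ge0.
    have c0 : 0 <= (Gamma a)^-1 * expR (- ((a - 1) * ln (- th))).
      by rewrite mulr_ge0 ?expR_ge0// invr_ge0 ltW.
    rewrite -(ge0_integralM_EFin lebesgue_measure mpos mgs gs0 c0).
    apply: eq_integral => x; rewrite inE/= in_itv/= andbT => x0.
    rewrite /k /gamma_weight lnM ?posrE// mulrCA -mulrA -!expRD.
    by congr (_ * expR _)%:E; ring.
  rewrite E; rewrite integral_gamma_weight// in S.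
  have -> : ((\int[lebesgue_measure]_(x in pos) (gamma_weight a (- th * x))%:E) =
      ((- th)^-1 * Gamma a)%:E)%E.
    by rewrite EFinM S muleA -EFinM mulVf ?gt_eqF// mul1e.
  rewrite -EFinM; congr EFin; rewrite -{2}(lnK (tn0 : - th \is Num.pos)) -expRN.
  have -> : - a * ln (- th) = - ((a - 1) * ln (- th)) + - ln (- th) by ring.
  by rewrite expRD; field.
refine (@quadratic_modelP R c (gamma_family a) _ _ _ (k \o @posReal_val R) [set th | th < 0] _ _ _ _ _ _ _ _ _ _ _ _ _ _ _ _ _).
- exact: posReal_hausdorff.
- exact: posReal_locally_compact.
- exact: posReal_continuous.
- exact: inner_exhausted_posReal.
- exact: mk.
- by move=> x; exact: k0.
- apply/seteqP; split=> [_ [b /= b0 <-]|th /= th0]; first by rewrite /= oppr_lt0.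
  by exists (- th); rewrite /= ?oppr_gt0 ?opprK.
- exact: negative.
- move=> b x /= b0; have x0 := posReal_gt0 x; rewrite opprK.
  rewrite /powR mulf_eq0 !gt_eqF//= lnM ?posrE// /k.
  rewrite -{3}(lnK (x0 : posReal_val x \is Num.pos)) -expRN.
  rewrite [LHS](_ : _ = (Gamma a)^-1 * (expR (a * (ln b + ln (posReal_val x))) * (expR (- b * posReal_val x) * expR (- ln (posReal_val x))))); last by ring.
  by rewrite [RHS]mulrCA -!expRD; congr (_ * expR _); ring.
- exact: Zin.
- move=> th /= /negP; rewrite -leNgt => th0.
  have U := @integral_unbounded R _ _ (@lebesgue_posReal R) _ _ th mv mk.
  apply: U => [x|x|M].
  - by rewrite ltW// posReal_gt0.
  - exact: k0.
  (* At this negative parameter the transform is exp |M|, which is at least M. *)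
  exists (- expR (- (`|M| / a))).
    by apply: le_trans th0; rewrite oppr_le0 expR_ge0.
  rewrite Zin ?oppr_lt0 ?expR_gt0// opprK expRK lee_fin.
  have -> : - a * - (`|M| / a) = `|M| by field.
  by apply: le_trans (ler_norm M) _; apply: le_trans (expR_ge1Dx _); lra.
- move=> th /= th0; have h : is_derive th 1 (fun y : R => - y) (- 1) by exact: is_deriveN.
  have tn0 : 0 < - th by rewrite oppr_gt0.
  apply: (is_derive_eq (is_deriveZ (- a) (is_derive_ln_comp h tn0))).
  by rewrite /GRing.scale/=; field; rewrite lt_eqF.
- move=> th /= th0; have tn : th != 0 by rewrite lt_eqF.
  apply: (is_derive_eq (is_deriveN (is_deriveZ a (is_derive_inv_comp (is_derive_id th 1) tn)))).
  by rewrite /GRing.scale/=; field; rewrite tn.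
- exists (- 1), (- 2); rewrite /= !oppr_lt0; split=> //.
  move=> /eqP; rewrite -subr_eq0; apply/negP.
  rewrite (_ : _ - _ = a / 2); last by field.
  by rewrite gt_eqF// divr_gt0.
Qed.

Lemma binomial_model n : (0 < n)%N ->
  quadratic_model c (binomial_family R n) (fun p => ln (p / (1 - p)))
    (fun th => n%:R * ln (1 + expR th)) (fun th => n%:R / (1 + expR (- th)))
    (- (1 / n%:R)) 1 0.
Proof.
move=> n0; have nR0 : 0 < n%:R :> R by rewrite ltr0n.
have nn0 : n%:R != 0 :> R by rewrite gt_eqF.
have e1 (th : R) : 0 < 1 + expR th by rewrite addr_gt0 ?expR_gt0.
pose k (x : upto n) := ('C(n, upto_val x)%:R : R).
refine (@quadratic_modelP R c (binomial_family R n) _ _ _ k setT _ _ _ _ _ _ _ _ _ _ _ _ _ _ _ _ _).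
- exact: (@discrete_hausdorff (upto n)).
- exact: (@discrete_locally_compact (upto n)).
- exact: (@discrete_continuous (upto n)).
- by apply: (@inner_exhausted_injective_nat R (upto n) (@upto_val n)) => x y; exact: val_inj.
- by move=> _ A mA; apply: sub_sigma_algebra; exact: (@discrete_open (upto n)).
- by move=> x; rewrite /k ler0n.
- apply/seteqP; split=> // th _; exists (expR th / (1 + expR th)).
    rewrite /= divr_gt0 ?expR_gt0//= ltr_pdivrMr// mul1r.
    by rewrite ltrDr.
  have en := lt0r_neq0 (e1 th).
  rewrite (_ : _ / _ = expR th) ?expRK//; field; rewrite en/=.
  by rewrite addrK oner_neq0.
- by move=> th _; exact: realline.
- move=> p x /= /andP[p0 p1]; have q0 : 0 < 1 - p by lra.
  have r0 : 0 < p / (1 - p) by rewrite divr_gt0.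
  rewrite lnK ?posrE// (_ : 1 + p / (1 - p) = (1 - p)^-1); last by field; rewrite gt_eqF.
  rewrite lnV ?posrE// expRD expRM_natr lnK ?posrE// mulrN opprK.
  rewrite [n%:R * _]mulrC expRM_natr lnK ?posrE// /k expr_div_n.
  have le : (upto_val x <= n)%N by rewrite -ltnS; exact: (ltn_ord x).
  have -> : (1 - p) ^+ n = (1 - p) ^+ upto_val x * (1 - p) ^+ (n - upto_val x) by rewrite -exprD subnKC.
  by field; rewrite expf_neq0// gt_eqF.
- move=> th _ /=.
  rewrite (@ge0_integral_upto R n (fun x => expR (th * x%:R) * 'C(n, x)%:R)); last first.
    by move=> x; rewrite mulr_ge0 ?expR_ge0 ?ler0n.
  rewrite mulrC expRM_natr lnK ?posrE// exprDn; congr EFin; apply: eq_bigr => i _.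
  by rewrite expr1n mul1r expRM_natr mulr_natr.
- by move=> th [].
- move=> th _; have h : is_derive th 1 (fun y => 1 + expR y) (expR th).
    by apply: (is_derive_eq (is_deriveD (is_derive_cst (1 : R) th 1) (is_derive_expR th))); rewrite add0r.
  apply: (is_derive_eq (is_deriveZ n%:R (is_derive_ln_comp h (e1 th)))).
  by rewrite /GRing.scale/= expRN; field; rewrite !gt_eqF ?expR_gt0// addr_gt0 ?expR_gt0.
- move=> th _; have h : is_derive th 1 (fun y => 1 + expR (- y)) (- expR (- th)).
    have h0 : is_derive th 1 (fun y : R => - y) (- 1) by exact: is_deriveN.
    apply: (is_derive_eq (is_deriveD (is_derive_cst (1 : R) th 1) (is_derive_expR_comp h0))).
    by rewrite add0r mulN1r.
  have en := lt0r_neq0 (e1 (- th)).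
  apply: (is_derive_eq (is_deriveZ n%:R (is_derive_inv_comp h en))).
  by rewrite /GRing.scale/=; field; rewrite en.
- exists 0, (- 1); split=> // /(mulfI nn0)/invr_inj/addrI/expR_inj; lra.
Qed.

Lemma negative_binomial_model (r : R) : 0 < r ->
  quadratic_model c (negative_binomial_family r) (@ln R)
    (fun th => - r * ln (1 - expR th)) (fun th => r / (expR (- th) - 1)) (1 / r) 1 0.
Proof.
move=> r0; have rn0 : r != 0 by rewrite gt_eqF.
have G0 x : 0 < Gamma (x%:R + r) by apply: Gamma_gt0; rewrite ltr_wpDl.
have Gr0 := Gamma_gt0 r0.
pose k (x : nat) := Gamma (x%:R + r) / (Gamma r * x`!%:R).
have k0 x : 0 <= k x by rewrite divr_ge0 ?(ltW (G0 _))// mulr_ge0// ltW.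
have e1 (th : R) : th < 0 -> 0 < 1 - expR th by move=> th0; rewrite subr_gt0 expR_lt1.
have Zin (th : R) : th < 0 -> (\int[@counting (borel nat) R]_x (expR (th * x%:R) * k x)%:E
    = (expR (- r * ln (1 - expR th)))%:E)%E.
  move=> th0; apply: (ge0_integral_nat (f := fun x => expR (th * x%:R) * k x)).
    by move=> x; rewrite mulr_ge0 ?expR_ge0.
  (* The successive derivatives of (1 - y)^(-r), nonnegative on [0, 1[. Their values at 0 are j!
     k(j), so the integral is the Taylor series at y = exp th. *)
  pose f j (y : R) := Gamma (j%:R + r) / Gamma r * expR (- (j%:R + r) * ln (1 - y)).
  have df j (y : R) : 0 <= y < 1 -> is_derive y 1 (f j) (f j.+1 y).
    move=> /andP[y0 y1]; have y1' : 0 < 1 - y by lra.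
    have h0 : is_derive y 1 (fun y => 1 - y) (- 1).
      by apply: (is_derive_eq (is_deriveB (is_derive_cst (1 : R) y 1) (is_derive_id y 1))); rewrite sub0r.
    have h1 := is_derive_expR_comp (is_deriveZ (- (j%:R + r)) (is_derive_ln_comp h0 y1')).
    apply: (is_derive_eq (is_deriveZ (Gamma (j%:R + r) / Gamma r) h1)); rewrite /GRing.scale/= /f.
    have -> : j.+1%:R + r = (j%:R + r) + 1 by rewrite -natr1; ring.
    rewrite Gamma_rec ?ltr_wpDl//.
    have -> : - (j%:R + r + 1) * ln (1 - y) = - (j%:R + r) * ln (1 - y) + - ln (1 - y) by ring.
    rewrite expRD expRN lnK ?posrE//.
    by field; rewrite !gt_eqF.
  have f0 j (y : R) : 0 <= y < 1 -> 0 <= f j y.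
    by move=> _; rewrite mulr_ge0 ?expR_ge0// divr_ge0// ltW.
  have e01 : 0 <= expR th < 1 by rewrite expR_ge0 expR_lt1.
  have := cvg_taylor_ge0 df f0 e01.
  rewrite {2}/f add0r divff ?gt_eqF// mul1r => h; apply: cvg_trans h.
  apply: near_eq_cvg; apply: nearW => m; rewrite /taylor_poly big_mkord.
  apply: eq_bigr => i _; rewrite /f subr0 ln1 mulr0 expR0 mulr1 -expRM_natr /k.
  by field; rewrite !gt_eqF// ltr0n fact_gt0.
refine (@quadratic_modelP R c (negative_binomial_family r) _ _ _ k [set th | th < 0] _ _ _ _ _ _ _ _ _ _ _ _ _ _ _ _ _).
- exact: (@discrete_hausdorff nat).
- exact: (@discrete_locally_compact nat).
- exact: (@discrete_continuous nat).
- exact: (@inner_exhausted_injective_nat R nat id).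
- exact: discrete_borel_measurable.
- exact: k0.
- apply/seteqP; split=> [_ [p /= p01 <-]|th /= th0]; first by rewrite /= ln_lt0.
  by exists (expR th); rewrite /= ?expRK// expR_gt0 expR_lt1.
- exact: negative.
- move=> p x /= /andP[p0 p1]; have q0 : 0 < 1 - p by lra.
  rewrite lnK ?posrE// expRD expRM_natr lnK ?posrE// /powR gt_eqF//.
  by rewrite mulNr opprK /k mulrC mulrCA mulrC [p ^+ _ * _]mulrC mulrA.
- exact: Zin.
- move=> th /= /negP; rewrite -leNgt => th0.
  have mi : measurable_fun setT (fun x : borel nat => x%:R : R) by exact: discrete_borel_measurable.
  have mk : measurable_fun setT (k : borel nat -> R) by exact: discrete_borel_measurable.
  apply: (integral_unbounded mi mk) => // M.
  (* At the parameter ln (1 - exp (- (|M| + 1) / r)) the transform is exp (|M| + 1); the added 1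
     keeps the argument of the logarithm positive when M = 0. *)
  have e2 : 0 < expR (- ((`|M| + 1) / r)) < 1.
    by rewrite expR_gt0 expR_lt1 oppr_lt0 divr_gt0// ltr_wpDl.
  have e3 : 0 < 1 - expR (- ((`|M| + 1) / r)) < 1 by lra.
  exists (ln (1 - expR (- ((`|M| + 1) / r)))).
    by apply: le_trans th0; apply/ltW; rewrite ln_lt0.
  rewrite Zin ?ln_lt0// lnK; last by rewrite posrE; lra.
  rewrite subKr expRK lee_fin.
  have -> : - r * - ((`|M| + 1) / r) = `|M| + 1 by field.
  by apply: le_trans (ler_norm M) _; apply: le_trans (expR_ge1Dx _); lra.
- move=> th /= th0; have h : is_derive th 1 (fun y => 1 - expR y) (- expR th).
    by apply: (is_derive_eq (is_deriveB (is_derive_cst (1 : R) th 1) (is_derive_expR th))); rewrite sub0r.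
  apply: (is_derive_eq (is_deriveZ (- r) (is_derive_ln_comp h (e1 th th0)))).
  have d0 := lt0r_neq0 (e1 th th0).
  have -> : expR (- th) - 1 = (1 - expR th) / expR th.
    by rewrite expRN; field; rewrite gt_eqF ?expR_gt0.
  by rewrite /GRing.scale/= invf_div !mulNr mulrN opprK.
- move=> th /= th0; have h : is_derive th 1 (fun y => expR (- y) - 1) (- expR (- th)).
    have h0 : is_derive th 1 (fun y : R => - y) (- 1) by exact: is_deriveN.
    apply: (is_derive_eq (is_deriveB (is_derive_expR_comp h0) (is_derive_cst (1 : R) th 1))).
    by rewrite subr0 mulN1r.
  have en : expR (- th) - 1 != 0 by rewrite gt_eqF// subr_gt0 expR_gt1 oppr_gt0.
  apply: (is_derive_eq (is_deriveZ r (is_derive_inv_comp h en))).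
  by rewrite /GRing.scale/=; field; rewrite en.
- exists (- 1), (- 2); rewrite /= !oppr_lt0; split=> //.
  by move=> /(mulfI rn0)/invr_inj/addIr/expR_inj; lra.
Qed.

Lemma ghs_model (r : R) : 0 < r ->
  quadratic_model c (ghs_family r) id
    (fun th => - r * ln (cos th)) (fun th => r * tan th) (1 / r) 0 r.
Proof.
move=> r0; have rn0 : r != 0 by rewrite gt_eqF.
have pi0 : 0 < pi :> R := pi_gt0 R.
(* The 2^r of (2 cos th)^r is moved into the weight, which leaves psi = - r ln cos. *)
pose w : R := expR (r * ln 2) / (4 * pi).
have w0 : 0 < w by rewrite divr_gt0 ?expR_gt0 ?mulr_gt0.
pose k (x : R) := w * ghs_weight r x.
have k0 x : 0 <= k x by rewrite mulr_ge0 ?ghs_weight_ge0// ltW.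
have mkR : measurable_fun setT (k : measurableTypeR R -> measurableTypeR R).
  by apply: measurable_funM => //; exact: measurable_ghs_weight.
have mk : measurable_fun setT (k : borel R -> R).
  by move=> _ A mA; have := mkR measurableT A mA; rewrite !setTI => /borelP.
have mg (th : R) : measurable_fun setT (fun x => expR (th * x) * ghs_weight r x : measurableTypeR R).
  apply: measurable_funM; last exact: measurable_ghs_weight.
  by apply: measurableT_comp => //; exact: measurable_funM.
have g0 (th x : R) : setT x -> 0 <= expR (th * x) * ghs_weight r x.
  by move=> _; rewrite mulr_ge0 ?expR_ge0// ghs_weight_ge0.
have Z (th : R) : (\int[@lebesgue_line R]_x (expR (th * x) * k x)%:E =
    w%:E * \int[lebesgue_measure]_x (expR (th * x) * ghs_weight r x)%:E)%E.
  have mf : measurable_fun setT (fun x => expR (th * x) * k x : measurableTypeR R).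
    by apply: measurable_funM => //; apply: measurableT_comp => //; exact: measurable_funM.
  rewrite (ge0_integral_line mf); last by move=> x; rewrite mulr_ge0 ?expR_ge0.
  rewrite -(ge0_integralM_EFin lebesgue_measure measurableT (mg th) (g0 th) (ltW w0)).
  by apply: eq_integral => x _; rewrite /k mulrCA.
refine (@quadratic_modelP R c (ghs_family r) _ _ _ k [set th | - (pi / 2) < th < pi / 2] _ _ _ _ _ _ _ _ _ _ _ _ _ _ _ _ _).
- exact: norm_hausdorff.
- exact: locally_compactR.
- by move=> x; exact: cvg_id.
- exact: inner_exhausted_line.
- exact: mk.
- exact: k0.
- by rewrite image_id.
- by move=> th /= hth; exists (- (pi / 2)), (pi / 2).
- move=> th x /= hth; have c0 := cos_gt0_pihalf hth.
  rewrite /powR mulf_eq0 !gt_eqF//= lnM ?posrE// /k /w !expRD mulNr opprK mulrDr expRD.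
  by ring.
- move=> th /= hth; rewrite Z ghs_laplace// -EFinM /ghs_partition /w expRD mulNr.
  have e0 := expR_gt0 (r * ln 2); congr EFin; rewrite expRN.
  have cancel (u v p : R) : u != 0 -> p != 0 -> u / (4 * p) * (4 * p * (u^-1 * v)) = v.
    by move=> un pn; field; rewrite un.
  by apply: cancel; rewrite gt_eqF.
- move=> th /= /negP hth; rewrite Z ghs_laplace_infinite//.
  by rewrite gt0_muley// lte_fin.
- move=> th /= hth; have c0 := cos_gt0_pihalf hth.
  apply: (is_derive_eq (is_deriveZ (- r) (is_derive_ln_comp (is_derive_cos th) c0))).
  by rewrite /GRing.scale/= /tan; field; rewrite gt_eqF.
- move=> th /= hth; have c0 := cos_gt0_pihalf hth.
  have cn : cos th != 0 by rewrite gt_eqF.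
  apply: (is_derive_eq (is_deriveZ r (is_derive_tan cn))).
  by rewrite /GRing.scale/= cos2_tan2//; field.
- exists 0, (pi / 4); rewrite /= tan0 tan_piquarter mulr0 mulr1; split; [lra|lra|].
  by move=> /esym/eqP; apply/negP.
Qed.

End six_models.

(** * Classification of constant curvature *)

Section classification.
Context {R : realType} (c : category).

Lemma cgf1_lt d (X : measurableType d) (mu : {measure set X -> \bar R}) (t : X -> R) a b x y :
  measurable_fun setT t ->
  (forall h, a < h < b -> (laplace mu t h < +oo)%E) ->
  (forall h, a < h < b -> 0 < fine (laplace mu t h)) ->
  (forall h, a < h < b -> 0 < cgf2 mu t h) ->
  a < x -> x < y -> y < b -> cgf1 mu t x < cgf1 mu t y.
Proof.
move=> mt fin pos V0 ax xy yb.
have sub z : z \in `]x, y[ -> a < z < b by rewrite in_itv/=; lra.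
have der z : z \in `]x, y[ -> is_derive z 1 (cgf1 mu t) (cgf2 mu t z).
  by move=> /sub zab; exact: (is_derive_cgf1 mt fin pos zab).
have cont : {within `[x, y], continuous (cgf1 mu t)}.
  apply: continuous_in_subspaceT => z; rewrite inE/= in_itv/= => hz.
  apply: differentiable_continuous; apply/derivable1_diffP.
  have zab : a < z < b by lra.
  by have [] := is_derive_cgf1 mt fin pos zab.
have [z zxy E] := MVT xy der cont.
rewrite -subr_gt0 E; apply: mulr_gt0; [exact: V0 (sub z zxy)|by rewrite subr_gt0].
Qed.

Lemma natural_domain_interval (X : sampleSpace R) (P : set (probability X R)) T mu th :
  in_category c X -> regular_via (X := X) P T mu ->
  (laplace mu (coord T) th < +oo)%E ->
  exists e, 0 < e /\ forall h, th - e < h < th + e -> (laplace mu (coord T) h < +oo)%E.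
Proof.
move=> cX rv fth; have [[[oT _ _] _] eqP oP] := rv; have mt := coord_measurable cX oT.
rewrite eqP in oP.
have : open ((fun x : R => x%:M : 'cV[R]_1) @^-1` natural_domain T mu).
  by apply: open_comp oP => x _; exact: continuous_scalar_mx1.
rewrite openE => /(_ th) /=; rewrite /interior => H.
have {H} : nbhs th ((fun x : R => x%:M : 'cV[R]_1) @^-1` natural_domain T mu).
  by apply: H; exact: (natural_domainE mu th mt).2.
move=> /nbhs_ballP[e /= e0 H]; exists e; split=> // h hh.
apply: (natural_domainE mu h mt).1; apply: (H h).
by rewrite /ball/= ltr_norml; lra.
Qed.

(** The last condition keeps the mean away from the symmetry point of V, where the binomial case
    would have success probability exactly 1/2. If it fails at th0, it holds at th0 + e / 2, because
    the mean is strictly increasing. *)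
Lemma constant_hsc_variance (X : sampleSpace R) (P : set (probability X R)) :
  in_category c X -> regular P -> has_order P 1 -> constant_hsc P ->
  exists (T : X -> 'rV[R]_1) mu th k p q,
  [/\ two_members P, regular_via P T mu, variance_at mu (coord T) th k p q,
      0 < k * cgf1 mu (coord T) th ^+ 2 + p * cgf1 mu (coord T) th + q &
      k <> 0 -> cgf1 mu (coord T) th + p / (2 * k) <> 0].
Proof.
move=> cX [ef [n [T0 [mu0 rv0]]]] o1 [T [mu [mr [k hk]]]].
have P2 := order_one_two_members cX ef o1.
have n1 : n = 1%N.
  have [T1 [mu1 [r1 min1]]] := o1; have [[r0 min0] _ _] := rv0.
  by apply/eqP; rewrite eqn_leq (min0 _ _ _ r1) (min1 _ _ _ r0).
move: T0 rv0; rewrite n1 => T0 rv0.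
have rv : regular_via P T mu := regular_via_transfer cX P2 rv0 mr.
have [rT _] := mr; have [oT _ _] := rT; have mt := coord_measurable cX oT.
have [nu0 [_ [P0 _ _]]] := P2; have [th0 e0] := realization_coord rT P0.
have [f0 _] := (exp_formE T mu th0 nu0).1 e0.
have [e [e_gt0 fin]] := natural_domain_interval cX rv f0.
have [b1 b2 b3] : [/\ th0 - e < th0, th0 < th0 + e / 2 & th0 + e / 2 < th0 + e] by split; lra.
have V0 h : th0 - e < h < th0 + e -> 0 < cgf2 mu (coord T) h by exact: (cgf2_gt0 cX P2 rv fin).
have pos h : th0 - e < h < th0 + e -> 0 < fine (laplace mu (coord T) h).
  by move=> /fin fh; have [nu _ e1] := natural_parameter cX rv fh; exact: (exp_form_laplace_gt0 mt e1).
have logE : log_normalizer1 T mu = cgf mu (coord T).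
  by apply/funext => h; rewrite /log_normalizer1 log_normalizerE.
have hscE h : th0 - e < h < th0 + e ->
    ((fun s => ln ((cgf mu (coord T))^`(2)%classic s))^`(2))%classic h
      / (2 * (cgf mu (coord T))^`(2)%classic h) = k.
  move=> hh; have [nu Pnu e1] := natural_parameter cX rv (fin h hh).
  have := hk h; rewrite /hsc /fisher_metric logE; apply.
  by exists nu.
have [p [q VE]] := quadratic_variance mt fin pos V0 hscE.
have var th : th0 - e < th < th0 + e ->
    variance_at mu (coord T) th k p q /\
    0 < k * cgf1 mu (coord T) th ^+ 2 + p * cgf1 mu (coord T) th + q.
  move=> hth; split; last by rewrite -VE// V0.
  exists (Num.min (th - (th0 - e)) (th0 + e - th)).
    by rewrite lt_min; lra.
  move=> h hh; have hh' : th0 - e < h < th0 + e.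
    by move: hh; have [] := leP (th - (th0 - e)) (th0 + e - th); lra.
  by split; [exact: fin|exact: pos|exact: VE].
have m0 : th0 - e < th0 < th0 + e by lra.
have m1 : th0 - e < th0 + e / 2 < th0 + e by lra.
have [v0 q0] := var th0 m0; have [v1 q1] := var (th0 + e / 2) m1.
have lt : cgf1 mu (coord T) th0 < cgf1 mu (coord T) (th0 + e / 2).
  exact: (cgf1_lt mt fin pos V0 b1 b2 b3).
have [E|ne] := eqVneq (cgf1 mu (coord T) th0 + p / (2 * k)) 0.
  exists T, mu, (th0 + e / 2), k, p, q; split=> // _; lra.
by exists T, mu, th0, k, p, q; split=> // _; apply/eqP.
Qed.

Section equivalent_to_model.
Variables (X : sampleSpace R) (P : set (probability X R)) (T : X -> 'rV[R]_1).
Variables (mu : {measure set X -> \bar R}) (th k p q : R).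
Hypotheses (cX : in_category c X) (P2 : two_members P) (rv : regular_via P T mu).
Hypothesis V1 : variance_at mu (coord T) th k p q.
Let m := cgf1 mu (coord T) th.

(** The equations say that y -> a y + b carries the variance function and the mean of P to those of
    the model at p0. *)
Lemma equivalent_quadratic_model F nat_par psi psi1 k' p' q' a b p0 : a != 0 ->
  quadratic_model c F nat_par psi psi1 k' p' q' -> par F p0 ->
  k' = k -> p' = a * p - 2 * k * b -> q' = a ^+ 2 * q - a * b * p + k * b ^+ 2 ->
  psi1 (nat_par p0) = a * m + b ->
  equivalent P (members F : set (probability (borelSpace R c (fspace F)) R)).
Proof.
move=> an0 [mu' [ir F2 H]] Pp0 k'E p'E q'E mE.
have [_ [cgfE' V2]] := H p0 Pp0; have [cF _ rv' _ _] := ir.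
rewrite k'E p'E q'E in V2; rewrite mE in cgfE'.
exact: (equivalent_of_variance cX cF P2 rv rv' an0 V1 V2 cgfE').
Qed.

(* An affine statistic with variance [y - y^2 / s] has the cumulant generating
   function of a binomial law with [s] trials. *)
Lemma binomial_trials a b (y := a * m + b) (s := - k^-1) : k < 0 -> a != 0 ->
  a * p - 2 * k * b = 1 -> a ^+ 2 * q - a * b * p + k * b ^+ 2 = 0 ->
  0 < y / s < 2^-1 -> exists n, s = n%:R.
Proof.
move=> k0 an0 pE qE; set w := y / s => w12.
have [[rT _] _ _] := rv; have [oT _ _] := rT; have mt := coord_measurable cX oT.
have [e1 e1_gt0 V1'] := V1.
have thth : th - e1 < th < th + e1 by lra.
have [fth _ _] := V1' th thth.
have [nu0 P0 e0] := natural_parameter cX rv fth.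
have [mE V0] := variance_at_base mt e0 V1.
pose t x := a * coord T x + b.
have mtt : measurable_fun setT t by apply: measurable_funD => //; exact: measurable_funM.
have V0' : variance_at nu0 (coord T) (a * 0) k p q by rewrite mulr0.
have [] := variance_at_affine mt mtt an0 (fun=> erefl) V0'.
rewrite pE qE mulr0 mE => mtE [e e_gt0 Vt].
have inE h : `|h| < e -> 0 - e < h < 0 + e by rewrite ltr_norml sub0r add0r.
have near h : - e < h < e -> 0 - e < h < 0 + e by rewrite sub0r add0r.
have fin h : - e < h < e -> (laplace nu0 t h < +oo)%E by move=> /near/Vt[].
have pos h : - e < h < e -> 0 < fine (laplace nu0 t h) by move=> /near/Vt[].
have s0 : 0 < s by rewrite /s oppr_gt0 invr_lt0.
have ks : k = - s^-1 by rewrite /s invrN invrK opprK.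
have D0 h : 0 < 1 - w + w * expR h.
  by case/andP: (w12) => w0 _; have := mulr_gt0 w0 (expR_gt0 h); lra.
have dD (h : R) : is_derive h 1 (fun h => 1 - w + w * expR h) (w * expR h).
  apply: (is_derive_eq (is_deriveD (is_derive_cst (1 - w) h 1) (is_deriveZ w (is_derive_expR h)))).
  by rewrite add0r.
pose k2 h := s * ln (1 - w + w * expR h).
pose m2 h := s * (w * expR h * (1 - w + w * expR h)^-1).
have dk2 (h : R) : - e < h < e -> is_derive h 1 k2 (m2 h).
  by move=> _; apply: (is_derive_eq (is_deriveZ s (is_derive_ln_comp (dD h) (D0 h)))).
have dm2 (h : R) : - e < h < e -> is_derive h 1 m2 (k * m2 h ^+ 2 + 1 * m2 h + 0).
  move=> _; have Dn := lt0r_neq0 (D0 h).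
  have h1 := is_deriveM (is_deriveZ w (is_derive_expR h)) (is_derive_inv_comp (dD h) Dn).
  apply: (is_derive_eq (is_deriveZ s h1)).
  have -> : (w \*: (@expR R)) h = w * expR h by [].
  by rewrite /GRing.scale/= ks /m2; field; rewrite Dn gt_eqF.
have dk1 (h : R) : - e < h < e -> is_derive h 1 (cgf nu0 t) (cgf1 nu0 t h).
  by move=> hh; exact: is_derive_cgf hh.
have dm1 (h : R) : - e < h < e ->
    is_derive h 1 (cgf1 nu0 t) (k * cgf1 nu0 t h ^+ 2 + 1 * cgf1 nu0 t h + 0).
  by move=> hh; have [_ _ <-] := Vt h (near h hh); exact: is_derive_cgf1 hh.
have k00 : cgf nu0 t 0 = k2 0 by rewrite cgfE laplace0 /k2 expR0 mulr1 subrK /= ln1 mulr0.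
have m00 : cgf1 nu0 t 0 = m2 0.
  rewrite mtE /m2 expR0 mulr1 subrK invr1 mulr1 /w -/y.
  by rewrite mulrC divfK// gt_eqF.
have U := cumulant_unique dk1 dk2 dm1 dm2 k00 m00.
apply: (@binomial_exponent_integer R _ X nu0 t s w e) => // h he.
have he' : - e < h < e by rewrite -ltr_norml.
have [_ E] := U h he'; rewrite (laplaceK (fin h he')); congr EFin.
by rewrite -/(k2 h) -E cgfE lnK// posrE pos.
Qed.

Hypothesis v_gt0 : 0 < k * m ^+ 2 + p * m + q.
Hypothesis m_ne : k <> 0 -> m + p / (2 * k) <> 0.
Local Notation equivalent_to F :=
  (equivalent P (members F : set (probability (borelSpace R c (fspace F)) R))).

(** The change y -> a y + b keeps k and multiplies d by a^2. For k != 0, a^2 is thus dictated by d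
    unless d = 0, b then normalizes the linear term, and the sign of a is left to place the mean
    correctly relative to the zeros of V. *)
Lemma classification_of_variance :
  (exists2 sigma, 0 < sigma & equivalent_to (normal_family sigma)) \/
  equivalent_to (poisson_family R) \/
  (exists2 a, 0 < a & equivalent_to (gamma_family a)) \/
  (exists2 n, (0 < n)%N & equivalent_to (binomial_family R n)) \/
  (exists2 r, 0 < r & equivalent_to (negative_binomial_family r)) \/
  (exists2 r, 0 < r & equivalent_to (ghs_family r)).
Proof.
pose d := p ^+ 2 - 4 * k * q.
have [k0|k0|k0] := ltgtP k 0; last first.
- have [p0|p0] := eqVneq p 0.
    left; exists (Num.sqrt q).
      by rewrite sqrtr_gt0; move: v_gt0; rewrite k0 p0 !mul0r !add0r.
    have q0 : 0 < q by move: v_gt0; rewrite k0 p0 !mul0r !add0r.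
    have sq : Num.sqrt q ^+ 2 = q by rewrite sqr_sqrtr// ltW.
    have sq0 : 0 < Num.sqrt q by rewrite sqrtr_gt0.
    apply: (@equivalent_quadratic_model _ _ _ _ _ _ _ 1 0 m (oner_neq0 R) (normal_model c sq0)) => //.
    + by rewrite p0 k0; ring.
    + by rewrite sq p0 k0; ring.
    + by rewrite mulrC divfK ?expf_neq0 ?gt_eqF//; ring.
  right; left; have a0 : p^-1 != 0 by rewrite invr_eq0.
  have v0 : 0 < (p * m + q) / p ^+ 2.
    by rewrite divr_gt0 ?exprn_even_gt0 ?p0 ?orbT//; move: v_gt0; rewrite k0 mul0r add0r.
  (* Scaling by 1 / p makes the slope of V equal to 1, and the translation moves its zero to 0. *)
  apply: (@equivalent_quadratic_model _ _ _ _ _ _ _ p^-1 (q / p ^+ 2)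
    ((p * m + q) / p ^+ 2) a0 (poisson_model c)) => //.
  + by rewrite k0; field.
  + by rewrite k0; field.
  + by rewrite lnK ?posrE//; field.
- have kn : k != 0 by rewrite gt_eqF.
  have r0 : 0 < k^-1 by rewrite invr_gt0.
  have k1 : 1 / k^-1 = k by rewrite div1r invrK.
  have mn : m + p / (2 * k) != 0 by apply/eqP; apply: m_ne; exact/eqP.
  have [d0|d0|d0] := ltgtP d 0.
  + do 5 right; exists k^-1 => //.
    have sd : 0 < Num.sqrt (- d) by rewrite sqrtr_gt0 oppr_gt0.
    have sdE : Num.sqrt (- d) ^+ 2 = - d by rewrite sqr_sqrtr// oppr_ge0 ltW.
    (* a^2 = 4 / (- d), together with the b that removes the linear term, gives V(y) = k y^2 + 1 /
       k. *)
    pose a := 2 / Num.sqrt (- d); have a0 : a != 0 by rewrite gt_eqF// divr_gt0.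
    have a2 : a ^+ 2 = 4 / (- d) by rewrite /a expr_div_n sdE; congr (_ / _); ring.
    pose b := a * p / (2 * k); pose x := atan (k * (a * m + b)).
    have xq : - (pi / 2) < x < pi / 2 by rewrite atan_gtNpi2 atan_ltpi2.
    have dn : - d != 0 by rewrite oppr_eq0 lt_eqF.
    apply: (@equivalent_quadratic_model _ _ _ _ _ _ _ a b x a0 (ghs_model c r0)) => //.
    * by rewrite /b; field.
    * have -> : a ^+ 2 * q - a * b * p + k * b ^+ 2 = a ^+ 2 * (- d) / (4 * k).
        by rewrite /b /d; field.
      by rewrite a2 divfK//; field.
    * by rewrite /= atanK mulrA mulVf// mul1r.
  + do 4 right; left; exists k^-1 => //.
    have sd : 0 < Num.sqrt d by rewrite sqrtr_gt0.
    have sdE : Num.sqrt d ^+ 2 = d by rewrite sqr_sqrtr// ltW.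
    (* a^2 = 1 / d and the b below give V(y) = k y^2 + y. The sign puts the mean to the right of -1
       / (2 k), the midpoint of the zeros -1 / k and 0; as V is positive at the mean, the mean is
       then positive. *)
    pose a := Num.sg (m + p / (2 * k)) / Num.sqrt d.
    have a2 : a ^+ 2 = d^-1 by rewrite /a expr_div_n sdE sqr_sg mn mul1r.
    have a0 : a != 0 by rewrite mulf_neq0 ?sgr_eq0// invr_eq0 gt_eqF.
    pose b := (a * p - 1) / (2 * k); pose y := a * m + b.
    have q'E : a ^+ 2 * q - a * b * p + k * b ^+ 2 = 0.
      have -> : a ^+ 2 * q - a * b * p + k * b ^+ 2 = (1 - a ^+ 2 * d) / (4 * k).
        by rewrite /b /d; field.
      by rewrite a2 mulVf ?gt_eqF// subrr mul0r.
    have y0 : 0 < y.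
      have yE : y + 1 / (2 * k) = `|m + p / (2 * k)| / Num.sqrt d.
        by rewrite normrEsg /y /b /a; field; rewrite kn gt_eqF.
      have yk : 0 < y + 1 / (2 * k) by rewrite yE divr_gt0 ?normr_gt0.
      have yv : 0 < k * y ^+ 2 + y.
        have -> : k * y ^+ 2 + y = a ^+ 2 * (k * m ^+ 2 + p * m + q) - (a ^+ 2 * q - a * b * p + k * b ^+ 2).
          by rewrite /y /b; field.
        by rewrite q'E subr0 mulr_gt0// exprn_even_gt0.
      have y1 : 0 < y * (k * y + 1) by rewrite mulrDr mulrCA -expr2 mulr1.
      have ky : 0 < 2 * k * y + 1.
        by have := mulr_gt0 (mulr_gt0 (ltr0Sn R 1) k0) yk; rewrite mulrDr mulrCA divff ?mulr1 ?mulf_neq0.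
      have [//|y0] := ltP 0 y.
      have : k * y <= 0 by rewrite pmulr_rle0.
      have := y1; nra.
    have p01 : 0 < y / (k^-1 + y) < 1.
        have ry : 0 < k^-1 + y by rewrite addr_gt0.
      by rewrite divr_gt0//= ltr_pdivrMr// mul1r ltrDr.
    apply: (@equivalent_quadratic_model _ _ _ _ _ _ _ a b (y / (k^-1 + y)) a0 (negative_binomial_model c r0)) => //.
    * by rewrite /b; field.
    * case/andP: p01 => p0 _; rewrite expRN lnK ?posrE// invf_div -/y.
      have -> : (k^-1 + y) / y - 1 = k^-1 / y by field; rewrite gt_eqF//= gt_eqF.
      by rewrite invf_div mulrCA divff ?mulr1// gt_eqF.
  + do 2 right; left; exists k^-1 => //.
    (* V is k times the square of the distance to its double zero; the sign reflects the mean to the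
       right of it. *)
    pose a := Num.sg (m + p / (2 * k)).
    have a2 : a ^+ 2 = 1 by rewrite /a sqr_sg mn.
    have a0 : a != 0 by rewrite sgr_eq0.
    pose b := a * p / (2 * k).
    have yE : a * m + b = `|m + p / (2 * k)| by rewrite normrEsg /b -/a; ring.
    have y0 : 0 < a * m + b by rewrite yE normr_gt0.
    have b0 : 0 < k^-1 / (a * m + b) by rewrite divr_gt0.
    apply: (@equivalent_quadratic_model _ _ _ _ _ _ _ a b (k^-1 / (a * m + b)) a0 (gamma_model c r0)) => //.
    * by rewrite /b; field.
    * have -> : a ^+ 2 * q - a * b * p + k * b ^+ 2 = - (a ^+ 2 * d / (4 * k)).
        by rewrite /b /d; field.
      by rewrite d0 mulr0 mul0r oppr0.
    * by rewrite invrN mulrN opprK invf_div mulrCA divff ?mulr1// invr_eq0.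
- have kn : k != 0 by rewrite lt_eqF.
  have mn : m + p / (2 * k) != 0 by apply/eqP; apply: m_ne; exact/eqP.
  (* d = V'(m)^2 - 4 k V(m), where V(m) > 0 and k < 0. *)
  have d0 : 0 < d.
    have -> : d = (2 * k * m + p) ^+ 2 + (- 4 * k) * (k * m ^+ 2 + p * m + q) by rewrite /d; ring.
    by rewrite ltr_wpDl ?sqr_ge0// mulr_gt0//; lra.
  have sd : 0 < Num.sqrt d by rewrite sqrtr_gt0.
  have sdE : Num.sqrt d ^+ 2 = d by rewrite sqr_sqrtr// ltW.
  (* Now V(y) = y - y^2 / s with s = -1 / k, and the sign puts the mean to the left of s / 2, the
     midpoint of the zeros: the success probability y / s is below 1/2. *)
  pose a := - Num.sg (m + p / (2 * k)) / Num.sqrt d.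
  have a2 : a ^+ 2 = d^-1 by rewrite /a expr_div_n sdE sqrrN sqr_sg mn mul1r.
  have a0 : a != 0 by rewrite mulf_neq0 ?oppr_eq0 ?sgr_eq0// invr_eq0 gt_eqF.
  pose b := (a * p - 1) / (2 * k); pose y := a * m + b.
  have p'E : a * p - 2 * k * b = 1 by rewrite /b; field.
  have q'E : a ^+ 2 * q - a * b * p + k * b ^+ 2 = 0.
    have -> : a ^+ 2 * q - a * b * p + k * b ^+ 2 = (1 - a ^+ 2 * d) / (4 * k).
      by rewrite /b /d; field.
    by rewrite a2 mulVf ?gt_eqF// subrr mul0r.
  have s0 : 0 < - k^-1 by rewrite oppr_gt0 invr_lt0.
  have wE : y / - k^-1 = - (k * y) by rewrite invrN invrK; ring.
  have yE : y + 1 / (2 * k) = - (`|m + p / (2 * k)| / Num.sqrt d).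
    by rewrite normrEsg /y /b /a; field; rewrite kn gt_eqF.
  have yv : 0 < k * y ^+ 2 + y.
    have -> : k * y ^+ 2 + y = a ^+ 2 * (k * m ^+ 2 + p * m + q) - (a ^+ 2 * q - a * b * p + k * b ^+ 2).
      by rewrite /y /b; field.
    by rewrite q'E subr0 mulr_gt0// exprn_even_gt0.
  have w12 : 0 < y / - k^-1 < 2^-1.
    have yk : y + 1 / (2 * k) < 0 by rewrite yE oppr_lt0 divr_gt0 ?normr_gt0.
    have w1 : - (k * y) < 2^-1.
      have : 0 < k * (y + 1 / (2 * k)) by rewrite nmulr_rgt0.
      by rewrite (_ : k * _ = k * y + 2^-1); [lra|field].
    have y1 : 0 < - (k * y) * (1 + k * y).
      have -> : - (k * y) * (1 + k * y) = - k * (k * y ^+ 2 + y) by ring.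
      by rewrite mulr_gt0// oppr_gt0.
    by rewrite wE w1 andbT -(pmulr_lgt0 _ (_ : 0 < 1 + k * y))//; lra.
  have [n sn] := binomial_trials k0 a0 p'E q'E w12.
  have n0 : (0 < n)%N by rewrite -(ltr0n R) -sn.
  do 3 right; left; exists n => //.
  rewrite sn in w12; pose x := y / n%:R.
  have x01 : 0 < x < 1 by rewrite /x; lra.
  have [x0 x1] := andP x01.
  have nk : - (1 / n%:R) = k by rewrite -sn div1r invrN invrK opprK.
  apply: (@equivalent_quadratic_model _ _ _ _ _ _ _ a b x a0 (binomial_model c n0)) => //.
  + have x1' : 0 < 1 - x by lra.
    have xp : x / (1 - x) \is Num.pos by rewrite posrE divr_gt0.
    rewrite expRN (lnK xp) invf_div -/y.
    have -> : 1 + (1 - x) / x = x^-1 by field; rewrite gt_eqF.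
    by rewrite invrK /x mulrC divfK// pnatr_eq0 -lt0n.
Qed.

End equivalent_to_model.

Lemma classification (X : sampleSpace R) (P : set (probability X R)) :
  in_category c X -> regular P -> has_order P 1 -> constant_hsc P ->
  let equivalent_to (F : densityFamily R) :=
    equivalent P (members F : set (probability (borelSpace R c (fspace F)) R)) in
  (exists2 sigma, 0 < sigma & equivalent_to (normal_family sigma)) \/
  equivalent_to (poisson_family R) \/
  (exists2 a, 0 < a & equivalent_to (gamma_family a)) \/
  (exists2 n, (0 < n)%N & equivalent_to (binomial_family R n)) \/
  (exists2 r, 0 < r & equivalent_to (negative_binomial_family r)) \/
  (exists2 r, 0 < r & equivalent_to (ghs_family r)).
Proof.
move=> cX reg o1 hs.
have [T [mu [th [k [p [q [P2 rv V v0 ne]]]]]]] := constant_hsc_variance cX reg o1 hs.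
exact: (classification_of_variance cX P2 rv V v0 ne).
Qed.

End classification.

(** * Invariance of the leading coefficient and equivalences within the series *)

Section inequivalence.
Context {R : realType} (c : category).

Lemma variance_at_realization (X : sampleSpace R) (P : set (probability X R))
    T mu T' mu' nu k p q : in_category c X -> two_members P -> P nu ->
  realization (X := X) T P mu -> realization (X := X) T' P mu' ->
  variance_at nu (coord T) 0 k p q -> exists a b, [/\ a != 0,
    cgf1 nu (coord T') 0 = a * cgf1 nu (coord T) 0 + b &
    variance_at nu (coord T') 0 k (a * p - 2 * k * b) (a ^+ 2 * q - a * b * p + k * b ^+ 2)].
Proof.
move=> cX P2 Pnu rT rT' V; have [oT _ _] := rT; have [oT' _ _] := rT'.
have mt := coord_measurable cX oT; have mt' := coord_measurable cX oT'.
have [th e] := realization_coord rT Pnu; have [th' e'] := realization_coord rT' Pnu.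
have [a [b [a0 t'E]]] := realization_affine cX P2 Pnu rT rT' e e'.
have change h : (laplace nu (coord T) (a * h + 0) < +oo)%E ->
    0 < fine (laplace nu (coord T) (a * h + 0)) ->
    [/\ (laplace nu (coord T') h < +oo)%E, 0 < fine (laplace nu (coord T') h) &
      cgf nu (coord T') h = cgf nu (coord T) (a * h + 0) + b * h + 0].
  rewrite !addr0 => h1 h2; have h3 := (laplace_affine_lty mt mt' t'E h).2 h1.
  split; [exact: h3|exact: fine_laplace_gt0|].
  by rewrite (cgf_affine mt mt' t'E h1); ring.
have V' : variance_at nu (coord T) (a * 0 + 0) k p q by rewrite mulr0 addr0.
have [] := variance_at_change mt mt' a0 change V'; rewrite mulr0 addr0 => m1 V1.
by exists a, b.
Qed.

(** The mean moves with speed V > 0, so the two quadratic functions agree on an interval. Their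
    difference E is followed along the parameter instead of inverting the mean: E = 0 gives G V = 0,
    hence G = 0, and G' = 2 (k1 - k2) V gives the claim. *)
Lemma leading_coefficient_unique d1 d2 (X1 : measurableType d1) (X2 : measurableType d2)
    (nu1 : probability X1 R) (nu2 : probability X2 R) t1 t2 k1 p1 q1 k2 p2 q2 :
  measurable_fun setT t1 -> measurable_fun setT t2 ->
  (forall h, laplace nu1 t1 h = laplace nu2 t2 h) ->
  variance_at nu1 t1 0 k1 p1 q1 -> variance_at nu2 t2 0 k2 p2 q2 ->
  0 < k1 * cgf1 nu1 t1 0 ^+ 2 + p1 * cgf1 nu1 t1 0 + q1 -> k1 = k2.
Proof.
move=> mt1 mt2 lE [e1 e10 V1] [e2 e20 V2] v0.
pose e := Num.min e1 e2; have e0 : 0 < e by rewrite lt_min e10.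
have in1 h : - e < h < e -> 0 - e1 < h < 0 + e1.
  by rewrite /e; have [] := leP e1 e2; lra.
have in2 h : - e < h < e -> 0 - e2 < h < 0 + e2.
  by rewrite /e; have [] := leP e1 e2; lra.
have zero : - e < 0 < e by rewrite oppr_lt0 e0.
have fin1 h : - e < h < e -> (laplace nu1 t1 h < +oo)%E by move=> /in1/V1[].
have pos1 h : - e < h < e -> 0 < fine (laplace nu1 t1 h) by move=> /in1/V1[].
have fin2 h : - e < h < e -> (laplace nu2 t2 h < +oo)%E by move=> /in2/V2[].
have pos2 h : - e < h < e -> 0 < fine (laplace nu2 t2 h) by move=> /in2/V2[].
have cE : cgf nu1 t1 = cgf nu2 t2 by apply/funext => h; rewrite !cgfE lE.
have c1E h : - e < h < e -> cgf1 nu1 t1 h = cgf1 nu2 t2 h.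
  move=> hh; have [_ <-] := is_derive_cgf mt1 fin1 pos1 hh.
  by have [_ <-] := is_derive_cgf mt2 fin2 pos2 hh; rewrite cE.
have c2E h : - e < h < e -> cgf2 nu1 t1 h = cgf2 nu2 t2 h.
  move=> hh; have [_ <-] := is_derive_cgf1 mt1 fin1 pos1 hh.
  have [_ <-] := is_derive_cgf1 mt2 fin2 pos2 hh.
  by apply: near_eq_derive; apply: filterS (near_itvoo hh) => y; exact: c1E.
pose y := cgf1 nu1 t1; pose V h := k1 * y h ^+ 2 + p1 * y h + q1.
have dy (h : R) : - e < h < e -> is_derive h 1 y (V h).
  by move=> hh; rewrite /V /y; have [_ _ <-] := V1 h (in1 h hh); exact: (is_derive_cgf1 mt1 fin1 pos1 hh).
pose E h := (k1 - k2) * y h ^+ 2 + (p1 - p2) * y h + (q1 - q2).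
pose G h := 2 * (k1 - k2) * y h + (p1 - p2).
have E0 h : - e < h < e -> E h = 0.
  move=> hh; have [_ _ v1] := V1 h (in1 h hh); have [_ _ v2] := V2 h (in2 h hh).
  have : V h = k2 * y h ^+ 2 + p2 * y h + q2 by rewrite /V /y -v1 c2E// v2 c1E.
  move=> /eqP; rewrite -subr_eq0 => /eqP <-; rewrite /V /E; ring.
have dE (h : R) : - e < h < e -> is_derive h 1 E (G h * V h).
  move=> hh; have h1 := dy h hh.
  apply: (is_derive_eq (is_deriveD (is_deriveD (is_deriveZ (k1 - k2) (is_deriveX 2 h1))
    (is_deriveZ (p1 - p2) h1)) (is_derive_cst (q1 - q2) h 1))).
  by rewrite /GRing.scale/= /G; ring.
have dG (h : R) : - e < h < e -> is_derive h 1 G (2 * (k1 - k2) * V h).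
  move=> hh; have h1 := dy h hh.
  apply: (is_derive_eq (is_deriveD (is_deriveZ (2 * (k1 - k2)) h1) (is_derive_cst (p1 - p2) h 1))).
  by rewrite addr0.
have dV : is_derive (0 : R) 1 V ((2 * k1 * y 0 + p1) * V 0).
  have h1 := dy 0 zero.
  apply: (is_derive_eq (is_deriveD (is_deriveD (is_deriveZ k1 (is_deriveX 2 h1))
    (is_deriveZ p1 h1)) (is_derive_cst q1 (0 : R) 1))).
  by rewrite /GRing.scale/= /V; ring.
have GV h : - e < h < e -> G h * V h = 0.
  move=> hh; have [_ <-] := dE h hh.
  rewrite -(derive_cst (0 : R) h 1); apply: near_eq_derive.
  by apply: filterS (near_itvoo hh) => z; exact: E0.
have nearV : \forall h \near (0 : R), 0 < V h.
  have cV : {for (0 : R), continuous V}.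
    by apply: differentiable_continuous; apply/derivable1_diffP; have [] := dV.
  exact: cvgr_gt cV _ v0.
have G0 : \forall h \near (0 : R), G h = 0.
  near=> h; have hh : - e < h < e by near: h; exact: near_itvoo.
  have Vh : 0 < V h by near: h.
  by move/eqP: (GV h hh); rewrite mulf_eq0 (gt_eqF Vh) orbF => /eqP.
have : 2 * (k1 - k2) * V 0 = 0.
  have [_ <-] := dG 0 zero.
  have -> : 'D_1 G 0 = 'D_1 (cst (0 : R)) (0 : R) by apply: near_eq_derive; exact: G0.
  exact: derive_cst.
move/eqP; rewrite !mulf_eq0 (gt_eqF v0) pnatr_eq0/= orbF subr_eq0 => /eqP//.
Unshelve. all: by end_near. Qed.

(** An equivalence may use any minimal statistic. It is almost everywhere an affine function of the
    inclusion, and this preserves the leading coefficient and the positivity of the variance. *)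
Lemma quadratic_model_law F nat_par psi psi1 k p q
    (T : borelSpace R c (fspace F) -> 'rV[R]_1) mu nu :
  quadratic_model c F nat_par psi psi1 k p q ->
  realization (X := borelSpace R c (fspace F)) T (members F) mu -> members F nu ->
  exists p' q', variance_at nu (coord T) 0 k p' q' /\
    0 < k * cgf1 nu (coord T) 0 ^+ 2 + p' * cgf1 nu (coord T) 0 + q'.
Proof.
move=> [m [ir P2 H]] rT Pnu; have [cX _ rv _ dn] := ir.
have [p0 Pp0 nuE] := Pnu; have [_ /(_ nu nuE) [ef _ _]] := dn p0 Pp0.
have [_ [_ V]] := H p0 Pp0; have [[rI _] _ _] := rv; have [oI _ _] := rI.
have mt := coord_measurable cX oI.
have [mE V0] := variance_at_base mt ef V.
have [a [b [a0 mE' V']]] := variance_at_realization cX P2 Pnu rI rT V0.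
have [e e0 Ve] := V.
have fin h : nat_par p0 - e < h < nat_par p0 + e ->
  (laplace m (coord (X := borelSpace R c (fspace F)) (inclusion F)) h < +oo)%E by move=> /Ve[].
have hh : nat_par p0 - e < nat_par p0 < nat_par p0 + e by lra.
have v0 := cgf2_gt0 cX P2 rv fin hh.
have [_ _ vE] := Ve _ hh; rewrite vE -mE in v0.
exists (a * p - 2 * k * b), (a ^+ 2 * q - a * b * p + k * b ^+ 2); split=> //.
rewrite mE'; set y := cgf1 nu _ 0 in v0 *.
have -> : k * (a * y + b) ^+ 2 + (a * p - 2 * k * b) * (a * y + b) +
  (a ^+ 2 * q - a * b * p + k * b ^+ 2) = a ^+ 2 * (k * y ^+ 2 + p * y + q) by ring.
by rewrite mulr_gt0// exprn_even_gt0.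
Qed.

(** Equality of the sets of image laws provides two members whose statistics have the same law,
    hence the same transform, from which the leading coefficient can be read off. *)
Lemma equivalent_leading_coefficient F nat_par psi psi1 k p q G nat_par' psi' psi1' k' p' q' :
  quadratic_model c F nat_par psi psi1 k p q ->
  quadratic_model c G nat_par' psi' psi1' k' p' q' ->
  equivalent (members F : set (probability (borelSpace R c (fspace F)) R))
    (members G : set (probability (borelSpace R c (fspace G)) R)) -> k = k'.
Proof.
move=> qF qG [n [T1 [m1 [T2 [m2 [mr1 mr2 E]]]]]].
have [mu [irF F2 _]] := qF; have [mu' [irG _ _]] := qG.
have [cF _ [[rI minI] _ _] _ _] := irF; have [cG _ _ _ _] := irG.
have n1 : n = 1%N.
  have [r1 min1] := mr1.
  by apply/eqP; rewrite eqn_leq (min1 _ _ _ rI) (minI _ _ _ r1).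
subst n; have [r1 _] := mr1; have [r2 _] := mr2.
have [oT1 _ _] := r1; have mt1 := coord_measurable cF oT1.
have [oT2 _ _] := r2; have mt2 := coord_measurable cG oT2.
have [nu1 [_ [P1 _ _]]] := F2.
have : pushforward_laws (X := borelSpace R c (fspace F)) T1 (members F)
  (fun B => pushforward nu1 (T1 : borelSpace R c (fspace F) -> borel 'rV[R]_1) (set_val B)) by exists nu1.
rewrite E => -[nu2 P2 nuE].
have [p1 [q1 [V1 v0]]] := quadratic_model_law qF r1 P1.
have [p2 [q2 [V2 _]]] := quadratic_model_law qG r2 P2.
apply: (leading_coefficient_unique mt1 mt2 _ V1 V2 v0) => h.
have [l1 l1E I1] := @exists_pushforward R _ _ _ (measurableTypeR R) (coord T1) nu1 mt1.
have [l2 l2E I2] := @exists_pushforward R _ _ _ (measurableTypeR R) (coord T2) nu2 mt2.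
have mg : measurable_fun setT (fun y : measurableTypeR R => (expR (h * y))%:E).
  by apply/measurable_EFinP; apply: measurable_expR_lin; exact: measurable_id.
have g0 (y : measurableTypeR R) : (0 <= (expR (h * y))%:E)%E by rewrite lee_fin expR_ge0.
apply: etrans (esym (I1 _ setT measurableT mg g0)) _.
apply: etrans _ (I2 _ setT measurableT mg g0).
apply: eq_measure_integral => A mA _; rewrite l1E l2E.
pose B : set (borel 'rV[R]_1) := (fun v : 'rV[R]_1 => v 0 0) @^-1` A.
have mB : measurable B.
  have := (iffLR (measurable_fun_borel _) (@continuous_borel _ _ _ (@continuous_coord R 1 1 0 0))) measurableT A mA.
  by rewrite setTI.
by have := congr1 (fun f => f (SigSub (mem_set mB : B \in [set B : set (borel 'rV[R]_1) | measurable B]))) nuE.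
Qed.

(** The scaling y -> (u / s) y carries the variance s^2 to u^2, and the centered members
    correspond. *)
Lemma normal_equivalent (s u : R) : 0 < s -> 0 < u ->
  equivalent (members (normal_family s) : set (probability (borelSpace R c (fspace (normal_family s))) R))
    (members (normal_family u) : set (probability (borelSpace R c (fspace (normal_family u))) R)).
Proof.
move=> s0 u0; have [mu [ir P2 H]] := normal_model c s0.
have [cX _ rv _ _] := ir; have [_ [mE V]] := H 0 I.
have a0 : u / s != 0 by rewrite gt_eqF// divr_gt0.
apply: (equivalent_quadratic_model cX P2 rv V (F := normal_family u) (p0 := 0) (b := 0) a0 (normal_model c u0)) => //.
- by ring.
- by field; rewrite gt_eqF.
- by rewrite mE !(mul0r, mulr0, addr0).
Qed.

End inequivalence.

(** * Classification, data of the six families and comparison within the series, combined *)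

Theorem proposition1p3 (R : realType) (c : category) :
  (* classification *)
  (forall (X : sampleSpace R) (P : set (probability X R)),
     in_category c X -> regular P -> has_order P 1 -> constant_hsc P ->
     let equivalent_to (F : densityFamily R) :=
       equivalent P (members F : set (probability (borelSpace R c (fspace F)) R)) in
     (exists2 sigma, 0 < sigma & equivalent_to (normal_family sigma)) \/
     equivalent_to (poisson_family R) \/
     (exists2 a, 0 < a & equivalent_to (gamma_family a)) \/
     (exists2 n, (0 < n)%N & equivalent_to (binomial_family R n)) \/
     (exists2 r, 0 < r & equivalent_to (negative_binomial_family r)) \/
     (exists2 r, 0 < r & equivalent_to (ghs_family r)))
  /\
  (* normal *)
  (forall sigma : R, 0 < sigma ->
     exists mu, let F := normal_family sigma in
     inclusion_realization c F mu (fun m => m / sigma ^+ 2) /\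
     forall m, par F m ->
       let theta := m / sigma ^+ 2 in
       let phi := phi c F mu in
       let eta := derive1 phi theta in
       let V := derive1n 2 phi theta in
       (phi theta = m ^+ 2 / (2 * sigma ^+ 2) /\
        phi theta = sigma ^+ 2 * theta ^+ 2 / 2) /\
       (eta = sigma ^+ 2 * theta) /\
       (V = sigma ^+ 2) /\
       HSC c F mu theta = 0)
  /\
  (* Poisson *)
  (exists mu, let F := poisson_family R in
     inclusion_realization c F mu (fun lambda => ln lambda) /\
     forall lambda, par F lambda ->
       let theta := ln lambda in
       let phi := phi c F mu in
       let eta := derive1 phi theta in
       let V := derive1n 2 phi theta in
       (phi theta = lambda /\ phi theta = expR theta) /\
       (eta = lambda) /\
       (V = eta) /\
       HSC c F mu theta = 0)
  /\
  (* gamma *)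
  (forall a : R, 0 < a ->
     exists mu, let F := gamma_family a in
     inclusion_realization c F mu (fun b => - b) /\
     forall b, par F b ->
       let theta := - b in
       let phi := phi c F mu in
       let eta := derive1 phi theta in
       let V := derive1n 2 phi theta in
       (phi theta = - a * ln b) /\
       (eta = a / b /\ eta = - (a / theta)) /\
       (V = a / theta ^+ 2 /\ V = 1 / a * eta ^+ 2) /\
       HSC c F mu theta = 1 / a)
  /\
  (* binomial *)
  (forall n : nat, (0 < n)%N ->
     exists mu, let F := binomial_family R n in
     inclusion_realization c F mu (fun p => ln (p / (1 - p))) /\
     forall p, par F p ->
       let theta := ln (p / (1 - p)) in
       let phi := phi c F mu in
       let eta := derive1 phi theta in
       let V := derive1n 2 phi theta in
       (phi theta = - n%:R * ln (1 - p) /\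
        phi theta = n%:R * ln (1 + expR theta)) /\
       (eta = n%:R / (1 + expR (- theta))) /\
       (V = n%:R * expR theta / (1 + expR theta) ^+ 2 /\
        V = - (1 / n%:R) * eta ^+ 2 + eta) /\
       HSC c F mu theta = - (1 / n%:R))
  /\
  (* negative binomial *)
  (forall r : R, 0 < r ->
     exists mu, let F := negative_binomial_family r in
     inclusion_realization c F mu (fun p => ln p) /\
     forall p, par F p ->
       let theta := ln p in
       let phi := phi c F mu in
       let eta := derive1 phi theta in
       let V := derive1n 2 phi theta in
       (phi theta = - r * ln (1 - p) /\
        phi theta = - r * ln (1 - expR theta)) /\
       (eta = r / (expR (- theta) - 1)) /\
       (V = r * expR (- theta) / (expR (- theta) - 1) ^+ 2 /\
        V = 1 / r * eta ^+ 2 + eta) /\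
       HSC c F mu theta = 1 / r)
  /\
  (* NEF-GHS *)
  (forall r : R, 0 < r ->
     (forall x : R,
        (ghs_weight r x)%:C%C = ghs_complex_weight r x /\
        ghs_complex_weight r x =
          `|cGamma ((r +i* x)%C / 2)| ^+ 2 / (Gamma r)%:C%C) /\
     exists mu, let F := ghs_family r in
     inclusion_realization c F mu (fun theta => theta) /\
     forall theta, par F theta ->
       let phi := phi c F mu in
       let eta := derive1 phi theta in
       let V := derive1n 2 phi theta in
       (phi theta = - r * ln (cos theta)) /\
       (eta = r * tan theta) /\
       (V = r * (1 + tan theta ^+ 2) /\ V = r + eta ^+ 2 / r) /\
       HSC c F mu theta = 1 / r)
  /\
  (* equivalences within the series *)
  let equivalent_families (F G : densityFamily R) :=
    equivalent
      (members F : set (probability (borelSpace R c (fspace F)) R))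
      (members G : set (probability (borelSpace R c (fspace G)) R)) in
  (forall sigma tau : R, 0 < sigma -> 0 < tau ->
     equivalent_families (normal_family sigma) (normal_family tau)) /\
  (forall a b : R, 0 < a -> 0 < b -> a <> b ->
     ~ equivalent_families (gamma_family a) (gamma_family b)) /\
  (forall n m : nat, (0 < n)%N -> (0 < m)%N -> n <> m ->
     ~ equivalent_families (binomial_family R n) (binomial_family R m)) /\
  (forall r s : R, 0 < r -> 0 < s -> r <> s ->
     ~ equivalent_families (negative_binomial_family r)
         (negative_binomial_family s)) /\
  (forall r s : R, 0 < r -> 0 < s -> r <> s ->
     ~ equivalent_families (ghs_family r) (ghs_family s)).
Proof.
split; first by move=> X P; exact: classification.
split=> [s s0|].
  have [mu [ir _ H]] := normal_model c s0; exists mu; split=> // m _ /=.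
  move: (H m I) => /= [[-> -> -> ->] _]; have sn : s != 0 by rewrite gt_eqF.
  by split; [split; field|split; [|split; [ring|]]].
split.
  have [mu [ir _ H]] := @poisson_model R c; exists mu; split=> // l /= l0.
  move: (H l l0) => /= [[-> -> -> ->] _]; rewrite lnK ?posrE//.
  by split; [|split; [|split; [ring|]]].
split=> [a a0|].
  have [mu [ir _ H]] := gamma_model c a0; exists mu; split=> // b /= b0.
  move: (H b b0) => /= [[-> -> -> ->] _]; have [an bn] : a != 0 /\ b != 0 by rewrite !gt_eqF.
  rewrite opprK; split=> //; split; first by split; [field|].
  by split=> //; split; field; rewrite ?an ?bn ?oppr_eq0.
split=> [n n0|].
  have [mu [ir _ H]] := @binomial_model R c n n0; exists mu; split=> // p /= p01.
  move: (H p p01) => /= [[-> -> -> ->] _]; have [p0 p1] := andP p01.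
  have nn : n%:R != 0 :> R by rewrite pnatr_eq0 -lt0n.
  have q0 : 0 < 1 - p by lra.
  have xp : p / (1 - p) \is Num.pos by rewrite posrE divr_gt0.
  have pn : p != 0 by rewrite gt_eqF.
  have qn : 1 - p != 0 by rewrite gt_eqF.
  have E : 1 + p / (1 - p) = (1 - p)^-1 by field.
  have E' : 1 + (1 - p) / p = p^-1 by field.
  rewrite expRN (lnK xp) E invf_div E' lnV ?posrE// invrK; split; first by split; ring.
  split=> //; split=> //; split; last by ring.
  have var (u v : R) : u != 0 -> 1 - v != 0 ->
      - (1 / u) * (u * v) ^+ 2 + 1 * (u * v) + 0 = u * (v / (1 - v)) / (1 - v)^-1 ^+ 2.
    by move=> un vn; rewrite exprVn invrK; field; rewrite ?un ?vn.
  exact: var.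
split=> [r r0|].
  have [mu [ir _ H]] := negative_binomial_model c r0; exists mu; split=> // p /= p01.
  move: (H p p01) => /= [[-> -> -> ->] _]; have [p0 p1] := andP p01.
  rewrite expRN lnK ?posrE//; split=> //; split=> //.
  have rn : r != 0 by rewrite gt_eqF.
  have pn : p^-1 - 1 != 0 by rewrite subr_eq0 gt_eqF// invf_gt1.
  (* Makes the variance a rational function of p^-1 - 1, the denominator of the mean. *)
  have E : p^-1 = (p^-1 - 1) + 1 by ring.
  split=> //; split; last by ring.
  by rewrite {3}E; move: (p^-1 - 1) pn => v vn; field; rewrite vn.
split=> [r r0|].
  split=> [x|].
    by rewrite -ghs_complex_weight_norm// /ghs_weight ghs_complex_weightE.
  have [mu [ir _ H]] := ghs_model c r0; exists mu; split=> // th hth /=.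
  move: (H th hth) => /= [[-> -> -> ->] _]; have rn : r != 0 by rewrite gt_eqF.
  by split=> //; split=> //; split=> //; split; field.
split=> [s u s0 u0|]; first exact: normal_equivalent.
split=> [a b a0 b0 ab E|].
  have := equivalent_leading_coefficient (gamma_model c a0) (gamma_model c b0) E.
  by rewrite !div1r => /invr_inj.
split=> [n m n0 m0 nm E|].
  have := equivalent_leading_coefficient (@binomial_model R c n n0) (@binomial_model R c m m0) E.
  by rewrite !div1r => /oppr_inj/invr_inj/eqP; rewrite eqr_nat => /eqP.
split=> r s r0 s0 rs E.
  have := equivalent_leading_coefficient (negative_binomial_model c r0) (negative_binomial_model c s0) E.
  by rewrite !div1r => /invr_inj.
have := equivalent_leading_coefficient (ghs_model c r0) (ghs_model c s0) E.
by rewrite !div1r => /invr_inj.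
Qed.
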